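(* Let $K$ be a number field with ring of integers $\mathcal{O}$, and let $Q_{2,1}$ be the unipotent group scheme over $\mathbb{Z}$ defined in the context (case $m=2$, $n=1$). For every non-zero prime ideal $\mathfrak{p}$ of $\mathcal{O}$, let $\mathcal{O}_{\mathfrak p}$ be the completion of $\mathcal{O}$ at $\mathfrak p$, let $q=|\mathcal{O}/\mathfrak{p}|$ and write $t=q^{-s}$. Then $$\zeta_{Q_{2,1}(\mathcal{O}_{\mathfrak p})}(s)=\frac{(1-t)(1+q^{3}t)(1-q^{2}t)\left(q^{8}t^{3}-q^{7}t^{2}+q^{6}t^{2}-q^{5}t^{2}-q^{3}t+q^{2}t-qt+1\right)}{(1-q^{5}t)(1-q^{5}t^{2})(1-q^{4}t)(1-q^{8}t^{2})}.$$
   Context: **Representation zeta function.** For a pro-$p$ group $G=Q_{m,n}(\mathcal{O}_{\mathfrak p})$ as below, two continuous irreducible finite-dimensional complex representations $\rho,\sigma$ of $G$ are twist-equivalent if $\sigma\cong\rho\otimes\chi$ for some continuous one-dimensional representation $\chi$ of $G$. The equivalence classes are called twist-isoclasses. Let $\widetilde r_k(G)$ be the number of twist-isoclasses of continuous irreducible complex representations of $G$ of dimension $k$. The zeta function of $G$ is $\zeta_G(s)=\sum_{k\ge1}\widetilde r_k(G)k^{-s}$, with $s$ a complex variable. It converges for $\mathrm{Re}(s)$ sufficiently large, and the identity is one of Dirichlet series there, hence of meromorphic functions. **The group schemes $Q_{m,n}$.** Let $m\ge n\ge1$. Let $\mathbf{Y}_0=(Y_{11},\dots,Y_{2m,2n})$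 be variables, $(Y_{ij})$ the generic $2m\times2n$ matrix in these variables, and $Y$ a further variable; put $\mathbf{Y}=(Y,\mathbf{Y}_0)$. Let $J_m\in\mathrm{Mat}_{2m}(\mathbb{Z})$ be the matrix $(a_{ij})$ with $a_{2i-1,2i}=1$ and $a_{2i,2i-1}=-1$ for $1\le i\le m$, all other entries zero. Define the antisymmetric matrix $$\mathcal{R}(\mathbf{Y})=\begin{pmatrix}YJ_m&(Y_{ij})\\-(Y_{ij})^{\mathrm t}&0\end{pmatrix}\in\mathrm{Mat}_{2(m+n)}(\mathbb{Z}[\mathbf{Y}]).$$ Let $\mathcal{Q}_{m,n}$ be the nilpotent $\mathbb{Z}$-Lie lattice of class $2$, free as a $\mathbb{Z}$-module on generators $x_r$ ($1\le r\le2(m+n)$), $y_{ij}$ ($1\le i\le2m$, $1\le j\le2n$) and $y$, with $y$ and all $y_{ij}$ central and $[x_a,x_b]=\mathcal{R}(\mathbf{y})_{a,b}$ for $1\le a,b\le2(m+n)$, where $\mathcal{R}(\mathbf{y})$ is obtained by substituting $Y\mapsto y$, $Y_{ij}\mapsto y_{ij}$. Let $Z$ be the $\mathbb{Z}$-span of $y$ and the $y_{ij}$. Then $Q_{m,n}$ is the associated class-$2$ unipotent group scheme over $\mathbb{Z}$: for a commutative ring $R$, $Q_{m,n}(R)$ is the set $R^{2(m+n)}\times(Z\otimes R)$ with multiplication $$(u,z)(u',z')=\Big(u+u',\,z+z'+\sum_{a<b}u_au'_b\,[x_a,x_b]\Big).$$ The commutator of $(u,z)$ and $(u',z')$ is then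 $(0,[\sum_a u_ax_a,\sum_b u'_bx_b])$. If $2$ is invertible in $R$, this group is isomorphic to the group on $\mathcal{Q}_{m,n}\otimes R$ with Hausdorff multiplication $v*w=v+w+\frac12[v,w]$. The group $Q_{m,n}(\mathcal{O}_{\mathfrak p})$ carries its $\mathfrak p$-adic (pro-$p$) topology. *)

(* Defs.v *)
From HB Require Import structures.
From mathcomp Require Import all_boot all_order all_algebra all_field.
From mathcomp Require Import finmap.
From mathcomp Require Import all_classical all_reals all_analysis.
From mathcomp Require Import complex.
Import numFieldNormedType.Exports.
Import Order.TTheory GRing.Theory Num.Theory.

Set Implicit Arguments.
Unset Strict Implicit.
Unset Printing Implicit Defensive.

Local Open Scope classical_set_scope.
Local Open Scope quotient_scope.
Local Open Scope ring_scope.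

(* These two structures only join a topology and an algebraic structure; they  *)
(* do not require the operations to be continuous.                             *)
#[short(type="topComNzRingType")]
HB.structure Definition TopComNzRing := {R of Topological R & GRing.ComNzRing R}.

#[short(type="topGroupType")]
HB.structure Definition TopGroup := {G of Topological G & Group G}.

Definition integral_int (K : fieldExtType rat) : {pred K} :=
  fun x => `[< integralOver (intr : int -> K) x >].

Lemma integral_int_subring_closed (K : fieldExtType rat) :
  subring_closed (@integral_int K).
Proof.
split.
- exact/asboolP/integral1.
- by move=> x y /asboolP xi /asboolP yi; exact/asboolP/integral_sub.
- by move=> x y /asboolP xi /asboolP yi; exact/asboolP/integral_mul.
Qed.

HB.instance Definition _ (K : fieldExtType rat) :=
  GRing.isSubringClosed.Build K (@integral_int K)
    (integral_int_subring_closed K).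

Definition ring_of_integers (K : fieldExtType rat) :=
  {x : K | x \in @integral_int K}.

HB.instance Definition _ (K : fieldExtType rat) :=
  SubChoice.on (ring_of_integers K).
HB.instance Definition _ (K : fieldExtType rat) :=
  [SubChoice_isSubComNzRing of ring_of_integers K by <:].

Section IdealPowers.
Variable R : comNzRingType.

Definition ideal_mul (I J : {pred R}) : {pred R} := fun x =>
  `[< exists s : seq (R * R),
        {in s, forall ab, ab.1 \in I /\ ab.2 \in J} /\
        x = \sum_(ab <- s) ab.1 * ab.2 >].

(* [ideal_powS I n] is the power [I ^ n.+1]: the shift keeps the ideal proper, *)
(* so that the quotient is a nonzero ring.                                     *)
Fixpoint ideal_powS (I : {pred R}) (n : nat) : {pred R} :=
  if n is n'.+1 then ideal_mul I (ideal_powS I n') else I.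

Lemma ideal_mul_sub (I : idealr R) (J : {pred R}) :
  {subset ideal_mul I J <= I}.
Proof.
move=> x /asboolP[s [sIJ ->]]; rewrite big_seq; apply: rpred_sum => ab abs.
by rewrite mulrC idealMr //; case: (sIJ _ abs).
Qed.

Lemma ideal_mul_closed (I : idealr R) (J : {pred R}) :
  idealr_closed (ideal_mul I J).
Proof.
split.
- by apply/asboolP; exists [::]; rewrite big_nil.
- by apply: contraFN (idealr1 I) => /ideal_mul_sub.
move=> a u v /asboolP[s [sIJ ->]] /asboolP[t [tIJ ->]]; apply/asboolP.
exists ([seq (a * ab.1, ab.2) | ab <- s] ++ t); split.
  move=> ab; rewrite mem_cat => /orP[/mapP[cd cds ->]|/tIJ//].
  by case: (sIJ _ cds) => /= cI dJ; split=> //; exact: idealMr.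
rewrite big_cat big_map mulr_sumr; congr (_ + _).
by apply: eq_bigr => ab _; rewrite mulrA.
Qed.

Lemma ideal_powS_closed (I : idealr R) n : idealr_closed (ideal_powS I n).
Proof.
case: n => [|n] /=; last exact: ideal_mul_closed.
split; [exact: idealr0 | by rewrite idealr1 |].
by move=> a u v uI vI; rewrite rpredD // idealMr.
Qed.

HB.instance Definition _ (I : idealr R) n :=
  isIdealr.Build R (ideal_powS I n) (ideal_powS_closed I n).

Lemma ideal_powS_sub (I : idealr R) n :
  {subset ideal_powS I n.+1 <= ideal_powS I n}.
Proof.
elim: n => [|n IHn]; first exact: ideal_mul_sub.
move=> x /asboolP[s [sI ->]]; apply/asboolP; exists s; split=> // ab abs.
by case: (sI _ abs) => abI abJ; split=> //; exact: IHn.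
Qed.

End IdealPowers.

Section Completion.
Variables (R : comNzRingType) (I : idealr R).

Local Notation quo n := {ideal_quot (ideal_powS I n)}.

Definition quo_red n : quo n.+1 -> quo n := fun x => \pi_(quo n) (repr x).

Lemma quo_red_pi n (x : R) : quo_red (\pi_(quo n.+1) x) = \pi_(quo n) x.
Proof.
apply/eqP; rewrite -Quotient.idealrBE; apply: ideal_powS_sub.
by rewrite Quotient.idealrBE reprK.
Qed.

Lemma quo_red_is_zmod_morphism n : zmod_morphism (@quo_red n).
Proof.
move=> x y; rewrite -[x]reprK -[y]reprK.
by rewrite -rmorphB !quo_red_pi rmorphB.
Qed.

Lemma quo_red_is_monoid_morphism n : monoid_morphism (@quo_red n).
Proof.
split=> [|x y]; first by rewrite -(rmorph1 (\pi_(quo n.+1))) quo_red_pi rmorph1.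
rewrite -[x]reprK -[y]reprK.
by rewrite -rmorphM !quo_red_pi rmorphM.
Qed.

HB.instance Definition _ n :=
  GRing.isZmodMorphism.Build _ _ (@quo_red n) (@quo_red_is_zmod_morphism n).
HB.instance Definition _ n :=
  GRing.isMonoidMorphism.Build _ _ (@quo_red n) (@quo_red_is_monoid_morphism n).

(* The [I]-adic completion, as the inverse limit of the rings R / I^n, n >= 1. *)
Record completion := Completion {
  cproj : forall n, quo n;
  cprojP : forall n, quo_red (cproj n.+1) = cproj n }.

Lemma completion_eq (x y : completion) :
  (forall n, cproj x n = cproj y n) -> x = y.
Proof.
case: x y => [x xP] [y yP] /= exy.
have {}exy : x = y by apply: functional_extensionality_dep.
case: y / exy yP => yP; congr Completion; exact: Prop_irrelevance.
Qed.

HB.instance Definition _ := gen_eqMixin completion.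
HB.instance Definition _ := gen_choiceMixin completion.

Fact czero_subproof n : quo_red (0 : quo n.+1) = 0. Proof. exact: rmorph0. Qed.
Fact cone_subproof n : quo_red (1 : quo n.+1) = 1. Proof. exact: rmorph1. Qed.
Fact copp_subproof x n : quo_red (- cproj x n.+1) = - cproj x n.
Proof. by rewrite rmorphN /= cprojP. Qed.
Fact cadd_subproof x y n :
  quo_red (cproj x n.+1 + cproj y n.+1) = cproj x n + cproj y n.
Proof. by rewrite rmorphD /= !cprojP. Qed.
Fact cmul_subproof x y n :
  quo_red (cproj x n.+1 * cproj y n.+1) = cproj x n * cproj y n.
Proof. by rewrite rmorphM /= !cprojP. Qed.

Definition czero := Completion czero_subproof.
Definition cone := Completion cone_subproof.
Definition copp x := Completion (copp_subproof x).
Definition cadd x y := Completion (cadd_subproof x y).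
Definition cmul x y := Completion (cmul_subproof x y).

Fact caddA : associative cadd.
Proof. by move=> x y z; apply: completion_eq => n /=; rewrite addrA. Qed.
Fact caddC : commutative cadd.
Proof. by move=> x y; apply: completion_eq => n /=; rewrite addrC. Qed.
Fact cadd0 : left_id czero cadd.
Proof. by move=> x; apply: completion_eq => n /=; rewrite add0r. Qed.
Fact caddN : left_inverse czero copp cadd.
Proof. by move=> x; apply: completion_eq => n /=; rewrite addNr. Qed.
Fact cmulA : associative cmul.
Proof. by move=> x y z; apply: completion_eq => n /=; rewrite mulrA. Qed.
Fact cmulC : commutative cmul.
Proof. by move=> x y; apply: completion_eq => n /=; rewrite mulrC. Qed.
Fact cmul1 : left_id cone cmul.
Proof. by move=> x; apply: completion_eq => n /=; rewrite mul1r. Qed.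
Fact cmulDl : left_distributive cmul cadd.
Proof. by move=> x y z; apply: completion_eq => n /=; rewrite mulrDl. Qed.
Fact cone_neq0 : cone != czero.
Proof.
apply/eqP => /(congr1 (fun x => cproj x 0)) /eqP /=.
by rewrite oner_eq0.
Qed.

HB.instance Definition _ :=
  GRing.isZmodule.Build completion caddA caddC cadd0 caddN.
HB.instance Definition _ := GRing.Zmodule_isComNzRing.Build completion
  cmulA cmulC cmul1 cmulDl cone_neq0.

(* The [I]-adic (inverse limit) topology: the neighbourhoods of [x] are the    *)
(* sets containing all [y] with the same image as [x] in some R / I^n.         *)
Definition cnbhs (x : completion) : set_system completion :=
  filter_from [set: nat] (fun n => [set y | cproj y n = cproj x n]).

Lemma cproj_le (x y : completion) m n : (m <= n)%N ->
  cproj x n = cproj y n -> cproj x m = cproj y m.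
Proof.
move=> /subnK <-; elim: (n - m)%N => [|k IHk]//.
by rewrite addSn => exy; apply: IHk; rewrite -(cprojP x) -(cprojP y) exy.
Qed.

Fact cnbhs_filter x : ProperFilter (cnbhs x).
Proof.
apply: filter_from_proper; last by move=> n _; exists x.
apply: filter_from_filter; first by exists 0%N.
move=> m n _ _; exists (maxn m n) => // y /= exy.
by split; apply: cproj_le exy; rewrite (leq_maxl, leq_maxr).
Qed.

Fact cnbhs_singleton x (A : set completion) : cnbhs x A -> A x.
Proof. by case=> n _; apply. Qed.

Fact cnbhs_nbhs x (A : set completion) : cnbhs x A -> cnbhs x (cnbhs^~ A).
Proof.
case=> n _ nA; exists n => // y /= exy; exists n => // z /= ezy.
by apply: nA; rewrite /= ezy.
Qed.

HB.instance Definition _ := hasNbhs.Build completion cnbhs.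
HB.instance Definition _ := Nbhs_isNbhsTopological.Build completion
  cnbhs_filter cnbhs_singleton cnbhs_nbhs.

End Completion.

(* Indices start at 0, so the entry 1 sits at (2i, 2i+1), -1 at (2i+1, 2i).    *)
Definition Jmx m : 'M[int]_(2 * m) := \matrix_(i, j)
  if ~~ odd i && (j == i.+1 :> nat) then 1
  else if odd i && (i == j.+1 :> nat) then -1 else 0.

(* The commutator matrix R(Y), with the variables replaced by elements of an   *)
(* arbitrary abelian group.                                                    *)
Definition commutator_mx (V : zmodType) m n (y : V)
    (Y : 'M[V]_(2 * m, 2 * n)) : 'M[V]_(2 * m + 2 * n) :=
  block_mx (\matrix_(i, j) (y *~ Jmx m i j)) Y (- Y^T) 0.

(* Z (x) R in coordinates: (c, C) stands for y (x) c + sum_ij y_ij (x) C_ij.   *)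
Definition Qcenter m n (T : Type) : Type := (T * 'M[T]_(2 * m, 2 * n))%type.

Definition Qgroup m n (T : Type) : Type :=
  ('rV[T]_(2 * m + 2 * n) * Qcenter m n T)%type.

HB.instance Definition _ m n (R : zmodType) :=
  GRing.Zmodule.copy (Qcenter m n R) (R * 'M[R]_(2 * m, 2 * n))%type.
HB.instance Definition _ m n (T : topologicalType) :=
  Topological.copy (Qcenter m n T) (T * 'M[T]_(2 * m, 2 * n))%type.
HB.instance Definition _ m n (T : choiceType) :=
  Choice.copy (Qgroup m n T) ('rV[T]_(2 * m + 2 * n) * Qcenter m n T)%type.

Section Qgroup.
Variables (m n : nat) (R : comNzRingType).

Definition Qscale (c : R) (z : Qcenter m n R) : Qcenter m n R :=
  (c * z.1, c *: z.2).

(* [x_a, x_b] = R(y)_{a,b}, read in Z (x) R.                                   *)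
Definition Qbracket (a b : 'I_(2 * m + 2 * n)) : Qcenter m n R :=
  commutator_mx ((1, 0) : Qcenter m n R)
    (\matrix_(i, j) ((0, delta_mx i j) : Qcenter m n R)) a b.

Definition Qcocycle (u v : 'rV[R]_(2 * m + 2 * n)) : Qcenter m n R :=
  \sum_(a < 2 * m + 2 * n) \sum_(b < 2 * m + 2 * n | (a < b)%N)
    Qscale (u 0 a * v 0 b) (Qbracket a b).

Definition Qmul (g h : Qgroup m n R) : Qgroup m n R :=
  (g.1 + h.1, g.2 + h.2 + Qcocycle g.1 h.1).
Definition Qone : Qgroup m n R := (0, 0).
Definition Qinv (g : Qgroup m n R) : Qgroup m n R :=
  (- g.1, - g.2 + Qcocycle g.1 g.1).

Lemma QscaleDl c d z : Qscale (c + d) z = Qscale c z + Qscale d z.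
Proof. by congr pair; rewrite /= ?mulrDl ?scalerDl. Qed.

Lemma QcocycleDl u v w : Qcocycle (u + v) w = Qcocycle u w + Qcocycle v w.
Proof.
rewrite /Qcocycle -big_split; apply: eq_bigr => a _.
rewrite -big_split; apply: eq_bigr => b _.
by rewrite mxE mulrDl QscaleDl.
Qed.

Lemma QcocycleDr u v w : Qcocycle u (v + w) = Qcocycle u v + Qcocycle u w.
Proof.
rewrite /Qcocycle -big_split; apply: eq_bigr => a _.
rewrite -big_split; apply: eq_bigr => b _.
by rewrite mxE mulrDr QscaleDl.
Qed.

Lemma Qcocycle0l u : Qcocycle 0 u = 0.
Proof. by apply: (addrI (Qcocycle 0 u)); rewrite -QcocycleDl !addr0. Qed.

Lemma Qcocycle0r u : Qcocycle u 0 = 0.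
Proof. by apply: (addrI (Qcocycle u 0)); rewrite -QcocycleDr !addr0. Qed.

Lemma QcocycleNl u v : Qcocycle (- u) v = - Qcocycle u v.
Proof. by apply/eqP; rewrite -addr_eq0 -QcocycleDl addNr Qcocycle0l. Qed.

Lemma QcocycleNr u v : Qcocycle u (- v) = - Qcocycle u v.
Proof. by apply/eqP; rewrite -addr_eq0 -QcocycleDr addNr Qcocycle0r. Qed.

Fact QmulA : associative Qmul.
Proof.
move=> [u x] [v y] [w z]; congr pair => /=; first by rewrite addrA.
rewrite QcocycleDl QcocycleDr !addrA.
by rewrite [LHS](ACl (1*2*5*3*6*4)).
Qed.

Fact Qmul1 : left_id Qone Qmul.
Proof. by case=> u x; congr pair; rewrite /= ?Qcocycle0l ?addr0 add0r. Qed.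

Fact QmulN : left_inverse Qone Qinv Qmul.
Proof.
case=> u x; congr pair; rewrite /= ?addNr //.
by rewrite QcocycleNl addrAC addrK addNr.
Qed.

Fact Qmulr1 : right_id Qone Qmul.
Proof. by case=> u x; congr pair; rewrite /= ?Qcocycle0r ?addr0. Qed.

Fact QmulrN : right_inverse Qone Qinv Qmul.
Proof.
case=> u x; congr pair; rewrite /= ?subrr //.
by rewrite QcocycleNr addrA addrK subrr.
Qed.

End Qgroup.

HB.instance Definition _ m n (R : comNzRingType) :=
  isGroup.Build (Qgroup m n R)
    (@QmulA m n R) (@Qmul1 m n R) (@Qmulr1 m n R) (@QmulN m n R) (@QmulrN m n R).

(* Product topology in the coordinates: for R = O_p, the p-adic topology.      *)
HB.instance Definition _ m n (R : topComNzRingType) :=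
  Topological.copy (Qgroup m n R)
    ('rV[R]_(2 * m + 2 * n) * Qcenter m n R)%type.

Section Representations.
Variables (C : numClosedFieldType) (G : topGroupType).

Definition cont_rep k (rho : G -> 'M[C]_k) :=
  [/\ rho 1%g = 1%:M, {morph rho : g h / (g * h)%g >-> g *m h} & continuous rho].

(* As in mxrepresentation, matrices act on row vectors and a matrix U stands for    *)
(* the subspace spanned by its rows.                                           *)
Definition irr_rep k (rho : G -> 'M[C]_k) :=
  [/\ (0 < k)%N, cont_rep rho
    & forall U : 'M[C]_k, (forall g, stablemx U (rho g)) ->
        U != 0 -> row_full U].

Definition rep_iso k (rho sigma : G -> 'M[C]_k) :=
  exists2 B, B \in unitmx & forall g, rho g *m B = B *m sigma g.

(* rho (x) chi, for chi of dimension 1.                                        *)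
Definition twist k (rho : G -> 'M[C]_k) (chi : G -> 'M[C]_1) : G -> 'M[C]_k :=
  fun g => chi g 0 0 *: rho g.

Definition twist_equiv k (rho sigma : G -> 'M[C]_k) :=
  exists2 chi, cont_rep chi & rep_iso sigma (twist rho chi).

Definition twist_isoclasses k : set (set (G -> 'M[C]_k)) :=
  [set [set sigma | irr_rep sigma /\ twist_equiv rho sigma]
    | rho in @irr_rep k].

(* Meaningful when there are finitely many classes ([fset_set A] is empty for  *)
(* infinite [A]).                                                              *)
Definition num_twist_isoclasses k : nat := #|` fset_set (@twist_isoclasses k)|.

End Representations.

Arguments twist_isoclasses : clear implicits.
Arguments num_twist_isoclasses : clear implicits.

Definition complexes (R : realType) : numClosedFieldType := R[i].

Definition cexp (R : realType) (z : complexes R) : complexes R :=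
  Complex (expR (complex.Re z) * cos (complex.Im z))
          (expR (complex.Re z) * sin (complex.Im z)).

(* k ^ s = exp (s ln k), for k > 0. *)
Definition natpow (R : realType) (k : nat) (s : complexes R) : complexes R :=
  cexp (s * (ln k%:R)%:C%C).

Section Zeta.
Variables (R : realType) (G : topGroupType).

Definition zeta_partial (s : complexes R) (N : nat) : complexes R :=
  \sum_(1 <= k < N.+1)
    (num_twist_isoclasses (complexes R) G k)%:R * natpow k (- s).

Definition zeta (s : complexes R) : complexes R := limn (zeta_partial s).

End Zeta.

Definition ideal_card (R : comNzRingType) (I : idealr R) : nat :=
  #|` fset_set [set: {ideal_quot I}]|.

(* Main.v *)
(* The centre Z of G = Q_{2,1}(O_p) is the commutator subgroup, so twisting *)
(* does not change the central character of an irreducible representation, and *)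
(* conversely the central character determines the twist class: all of G acts *)
(* on intertwining matrices through the abelian quotient G/Z.  A continuous *)
(* representation factors through A = O/p^N for some N (small neighbourhoods *)
(* of 1 in GL_k(C) contain no subgroup), and the characters of Z(A) correspond *)
(* to triples (y, a, b) in A * A^4 * A^4; the representation above (y, a, b) *)
(* has dimension |A^6 : Rad|^(1/2), with Rad the kernel of R(y, (a | b)). *)
(* The ring A is a finite chain ring.  Moving a primitive vector to e_1 by a *)
(* symplectic change of variables computes the size of this kernel, and *)
(* splitting vectors into primitive ones and multiples of the uniformizer *)
(* gives linear recurrences in N for the sum of t^(log_q dim) over all *)
(* characters.  Its closed form is a constant, the zeta function, plus *)
(* geometric terms that tend to 0 with N when t is small. *)
Require Import Defs.
From HB Require Import structures.
From mathcomp Require Import all_fingroup cyclic.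
From mathcomp Require Import all_boot all_order all_algebra all_field.
From mathcomp Require Import boolp.
From mathcomp Require Import ring zify.
Set Implicit Arguments.
Unset Strict Implicit.
Unset Printing Implicit Defensive.
Import Order.TTheory GRing.Theory Num.Theory.
Local Open Scope ring_scope.

(** * Finite chain rings *)

(** Write A = O/p^N, a finite chain ring whose residue field has q elements. Irreducible
    representations are twist-equivalent exactly when they agree on the centre
    ([twist_equiv_center]), every continuous one factors through some finite level
    ([cont_rep_level]), and the characters of the centre at level N are indexed by triples d = (y,
    a, b) in A x A^4 x A^4 ([dual_char_surj], [dual_char_inj]). Orthogonality ([rep_dim]) together
    with [card_radical] gives the dimension [q ^ dim_len y a b] in terms of the kernel of the
    commutator matrix. So the sum S_N of [t ^+ dim_len] over all triples approximates the zeta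
    function; it remains to evaluate S_N and to control what it has in excess of a partial sum.

    Evaluation of the kernel: take out the largest common power of the uniformizer. If y is then a
    unit, the system is solved for the vector in A^4 and only [symp a b] matters
    ([ker_size_invertible]). Otherwise a or b is primitive; the symplectic group is transitive on
    primitive vectors, so it may be taken to be e_1, which leaves a system in (y, b2, b3, b4). After
    a further common power is removed, its kernel depends only on y b2 ([ker_size_e1],
    [ker4_size_primitive]).

    Evaluation of the sum: the same case distinction gives linear recurrences ([sumL_rec] to
    [sumS_rec]). Divided by the number of terms, the sums depend only on 1/q, t and the remaining
    level ([sumS_seq]). Solving them shows that S_N is [zeta_value] minus combinations of the N-th
    powers of q^9 t^3, q^8 t^2, q^5 t and q^5 t^2, one of them with a factor linear in N
    ([seqS_closed]).

    Passage to the limit: level n+1 contains all classes of dimension at most n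
    ([twist_classes_count]). The excess, that is the characters of larger dimension, is at most
    1/(n+1) times the same sum with |t| q in place of t, which stays bounded when t is small
    ([zeta_partial_bound]). Hence the partial sums tend to [zeta_value].

    The arithmetic input is that O/p^N is a chain ring ([residue_chain_ring]). It rests on a local
    generator of p ([prime_uniformizer]), obtained from the fact that O is completely integrally
    closed ([almost_integral]). *)

Definition chain_ring (A : finComNzRingType) (pi : A) (N : nat) :=
  [/\ forall x, (exists y, x = pi * y) \/ (exists y, x * y = 1),
      (0 < N)%N, pi ^+ N = 0 & pi ^+ N.-1 != 0].

Definition ann (A : finComNzRingType) (x : A) : {set A} := [set w | x * w == 0].

Lemma in_ann (A : finComNzRingType) (x w : A) : (w \in ann x) = (x * w == 0).
Proof. by rewrite inE. Qed.

Definition invertible (A : finComNzRingType) (x : A) := [exists y, x * y == 1].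

Section Chain.
Variables (A : finComNzRingType) (pi : A) (N : nat).
Hypothesis chA : chain_ring pi N.

Local Notation q := #|ann pi|.

Lemma chain_pow_eq0 i : (pi ^+ i == 0) = (N <= i)%N.
Proof.
case: chA => _ N0 piN piN1; apply/idP/idP => [/eqP pi0|/subnK <-]; last first.
  by rewrite exprD piN mulr0.
rewrite leqNgt; apply: contra piN1 => iN; have/subnK <- : (i <= N.-1)%N.
  by rewrite -ltnS prednK.
by rewrite exprD pi0 mulr0.
Qed.

Lemma mul_invertible (u x : A) : invertible u -> (u * x == 0) = (x == 0).
Proof.
case/existsP => v /eqP uv; apply/eqP/eqP => [ux|->]; last by rewrite mulr0.
by rewrite -[x]mul1r -uv mulrAC ux mul0r.
Qed.

Lemma invertible_pi x : ~~ invertible (pi * x).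
Proof.
apply/negP => /existsP[y /eqP pxy]; case/eqP: (oner_neq0 A).
by rewrite -(expr1n _ N) -pxy -mulrA exprMn (eqP (_ : pi ^+ N == 0)) ?mul0r // chain_pow_eq0.
Qed.

Lemma invertibleP x : reflect (exists y, x = pi * y) (~~ invertible x).
Proof.
apply: (iffP idP) => [|[y ->]]; last exact: invertible_pi.
case: chA => /(_ x) [//|[y xy]] _ _ _ /negP[].
by apply/existsP; exists y; rewrite xy.
Qed.

Lemma chain_decomp x : x != 0 ->
  exists i u, [/\ (i < N)%N, invertible u & x = pi ^+ i * u].
Proof.
suff H j k y : (N - j <= k)%N -> x = pi ^+ j * y -> x != 0 ->
    exists i u, [/\ (i < N)%N, invertible u & x = pi ^+ i * u].
  by apply: (H 0%N N x); rewrite ?subn0 // mul1r.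
elim: k j y => [|k IHk] j y.
  rewrite leqn0 subn_eq0 -chain_pow_eq0.
  by move=> /eqP -> ->; rewrite mul0r eqxx.
move=> Njk xE x0; have [uy|/invertibleP[z yE]] := boolP (invertible y).
  exists j, y; split=> //; rewrite ltnNge -chain_pow_eq0.
  by apply: contra x0; rewrite xE => /eqP ->; rewrite mul0r.
apply: (IHk j.+1 z) => //; first by rewrite subnS -subn1 leq_subLR add1n.
by rewrite xE yE exprSr mulrA.
Qed.

Lemma ann_mul_invertible (u x : A) : invertible u -> ann (x * u) = ann x.
Proof.
by move=> uu; apply/setP => w; rewrite !in_ann mulrAC mulrC (mul_invertible _ uu).
Qed.

Lemma ann_pi_sub i (x : A) : (i < N)%N -> x \in ann (pi ^+ i) -> ~~ invertible x.
Proof.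
rewrite in_ann => iN /eqP xi; apply/negP => /(mul_invertible (pi ^+ i)).
by rewrite mulrC xi eqxx chain_pow_eq0 leqNgt iN.
Qed.

(** Multiplication by [pi] maps A onto the non-units, and its fibres are cosets of [ann pi]. For A =
    O/p^N the number [q] is the size of the residue field, by [card_residue_ann]. *)
Lemma sum_mul_pi (V : nmodType) (F : A -> V) :
  \sum_x F (pi * x) = (\sum_(x | ~~ invertible x) F x) *+ q.
Proof.
rewrite (partition_big (fun x => pi * x) (fun x => ~~ invertible x)) /=; last first.
  by move=> x _; exact: invertible_pi.
rewrite -sumrMnl; apply: eq_bigr => z /invertibleP[y ->].
rewrite (eq_bigr (fun=> F (pi * y))) => [|x /eqP -> //].
rewrite sumr_const; congr (_ *+ _).
rewrite -(card_imset (mem (ann pi)) (addrI y)); apply: eq_card => x.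
rewrite [LHS]unfold_in; apply/eqP/imsetP => [pxy|[w]]; last first.
  by rewrite in_ann => /eqP pw ->; rewrite mulrDr pw addr0.
exists (x - y); last by rewrite addrC subrK.
by rewrite in_ann mulrBr pxy subrr.
Qed.

Lemma card_sum1 (T : finType) (P : pred T) :
  #|[set x | P x]| = (\sum_x (P x : nat))%N.
Proof. by rewrite -sum1_card big_mkcond; apply: eq_bigr => x _; rewrite inE; case: (P x). Qed.

(** For i < N everything killed by [pi ^+ i] is a non-unit, hence of the form [pi * x] for exactly
    [q] values of x. *)
Lemma card_ann_pi i : (i <= N)%N -> #|ann (pi ^+ i)| = (q ^ i)%N.
Proof.
elim: i => [_|i IHi iN].
  by rewrite expr0 -[RHS](cards1 (0 : A)); apply: eq_card => x; rewrite in_ann !inE mul1r.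
rewrite expnS -IHi ?(ltnW iN) // {1}/ann card_sum1.
under eq_bigr do rewrite exprSr -mulrA.
rewrite (sum_mul_pi (fun y => (pi ^+ i * y == 0 : nat))) -mulr_natl natn; congr (_ * _)%N.
rewrite card_sum1 [RHS](bigID (@invertible A)) /= [X in (X + _)%N]big1 ?add0n // => x ux.
case: eqP => // /eqP xi; have := @ann_pi_sub i x iN.
by rewrite in_ann xi ux => /(_ isT).
Qed.

Lemma card_chain : #|A| = (q ^ N)%N.
Proof.
rewrite -card_ann_pi // -cardsT; apply: eq_card => x; rewrite in_ann !inE.
by rewrite (eqP (_ : pi ^+ N == 0)) ?mul0r ?eqxx // chain_pow_eq0.
Qed.

Lemma card_ann_pi_gt1 : (1 < q)%N.
Proof.
case: chA => _ N0 _ pN; apply/card_gt1P; exists 0, (pi ^+ N.-1).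
split; rewrite ?in_ann ?mulr0 //; last by rewrite eq_sym.
by rewrite -exprS prednK // chain_pow_eq0.
Qed.

End Chain.

(** * The kernel of the commutator matrix *)

Section Quadruples.
Variable A : finComNzRingType.

Definition quad := (A * A * A * A)%type.

Definition qscale (c : A) (v : quad) : quad :=
  let: (v1, v2, v3, v4) := v in (c * v1, c * v2, c * v3, c * v4).

Definition symp (a b : quad) : A :=
  let: (a1, a2, a3, a4) := a in let: (b1, b2, b3, b4) := b in
  a1 * b2 - a2 * b1 + a3 * b4 - a4 * b3.

Definition quad_e1 : quad := (1, 0, 0, 0).

Definition primitive_quad (a : quad) : bool :=
  let: (a1, a2, a3, a4) := a in
  [|| invertible a1, invertible a2, invertible a3 | invertible a4].

(* Up to the symplectic change of variables x |-> x J, the kernel of the *)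
(* commutator matrix R(y, (a | b)) on row vectors (x, w1, w2). *)
Definition in_ker (y : A) (a b : quad) (s : quad) (w1 w2 : A) : bool :=
  [&& qscale y s == qscale w1 a + qscale w2 b, symp s a == 0 & symp s b == 0].

Definition ker_size (y : A) (a b : quad) : nat :=
  (\sum_(s : quad) \sum_(w1 : A) \sum_(w2 : A) in_ker y a b s w1 w2)%N.

Lemma sum_quad (V : nmodType) (F : quad -> V) :
  \sum_v F v = \sum_v1 \sum_v2 \sum_v3 \sum_v4 F (v1, v2, v3, v4).
Proof.
rewrite !pair_bigA /=; apply: eq_bigr => -[[[v1 v2] v3] v4] _ //.
Qed.

Lemma quadP (a1 a2 a3 a4 b1 b2 b3 b4 : A) :
  ((a1, a2, a3, a4) == (b1, b2, b3, b4) :> quad) =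
  [&& a1 == b1, a2 == b2, a3 == b3 & a4 == b4].
Proof. by rewrite !xpair_eqE -!andbA. Qed.

Lemma quadD (a1 a2 a3 a4 b1 b2 b3 b4 : A) :
  ((a1, a2, a3, a4) : quad) + ((b1, b2, b3, b4) : quad) =
  (a1 + b1, a2 + b2, a3 + b3, a4 + b4).
Proof. by []. Qed.

Definition symplectic (g : quad -> quad) :=
  [/\ forall s s', g (s + s') = g s + g s',
      forall c s, g (qscale c s) = qscale c (g s),
      forall s s', symp (g s) (g s') = symp s s' & injective g].

Lemma symplectic_comp g h :
  symplectic g -> symplectic h -> symplectic (fun s => g (h s)).
Proof.
case=> gD gZ gS gI [hD hZ hS hI]; split=> [s s'|c s|s s'|s s' /gI/hI //].
- by rewrite hD gD.
- by rewrite hZ gZ.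
- by rewrite gS hS.
Qed.

(** Injectivity comes from nondegeneracy: pairing with the four basis vectors recovers a vector. *)
Lemma symplectic_build (g : quad -> quad) :
    (forall s s', g (s + s') = g s + g s') ->
    (forall c s, g (qscale c s) = qscale c (g s)) ->
    (forall s s', symp (g s) (g s') = symp s s') -> symplectic g.
Proof.
move=> gD gZ gS; split=> // s s' gss'.
have E r : symp s r = symp s' r by rewrite -gS gss' gS.
case: s s' E {gss'} => [[[a1 a2] a3] a4] [[[b1 b2] b3] b4] E.
have := E (1, 0, 0, 0); have := E (0, 1, 0, 0); have := E (0, 0, 1, 0).
have := E (0, 0, 0, 1); rewrite /symp !(mulr0, mulr1, oppr0, add0r, addr0).
by move=> -> /oppr_inj -> -> /oppr_inj ->.
Qed.

Ltac symplectic_tac :=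
  apply: symplectic_build;
  [ move=> [[[a1 a2] a3] a4] [[[b1 b2] b3] b4]; rewrite !quadD
  | move=> c [[[a1 a2] a3] a4]; rewrite /qscale
  | move=> [[[a1 a2] a3] a4] [[[b1 b2] b3] b4]; rewrite /symp ].

Lemma symplectic_swap :
  symplectic (fun '(a1, a2, a3, a4) => (a3, a4, a1, a2)).
Proof. symplectic_tac => //; ring. Qed.

Lemma symplectic_rot :
  symplectic (fun '(a1, a2, a3, a4) => (a2, - a1, a3, a4)).
Proof. symplectic_tac; [congr (_, _, _, _); ring|congr (_, _, _, _); ring|ring]. Qed.

Lemma symplectic_dilate u v : u * v = 1 ->
  symplectic (fun '(a1, a2, a3, a4) => (u * a1, v * a2, a3, a4)).
Proof.
move=> uv; symplectic_tac; [congr (_, _, _, _); ring|congr (_, _, _, _); ring|].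
by rewrite mulrACA uv mul1r [v * a2 * _]mulrACA [v * u]mulrC uv mul1r.
Qed.

Lemma symplectic_shear x y z :
  symplectic (fun '(a1, a2, a3, a4) =>
    (a1, a2 - x * a1 + (y * a4 - z * a3), a3 - y * a1, a4 - z * a1)).
Proof. symplectic_tac; [congr (_, _, _, _); ring|congr (_, _, _, _); ring|ring]. Qed.

(** Rotation and swap bring a unit into first position, a dilation turns it into 1 (and the second
    coordinate into [a1 * a2]), and a shear clears the other three. *)
Lemma primitive_symplectic a : primitive_quad a ->
  exists2 g, symplectic g & g a = quad_e1.
Proof.
have H1 a1 a2 a3 a4 : invertible a1 ->
    exists2 g, symplectic g & g (a1, a2, a3, a4) = quad_e1.
  case/existsP => v /eqP av; have va : v * a1 = 1 by rewrite mulrC.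
  exists (fun s => (fun '(s1, s2, s3, s4) =>
    (s1, s2 - (a1 * a2) * s1 + (a3 * s4 - a4 * s3), s3 - a3 * s1, s4 - a4 * s1) : quad)
    ((fun '(s1, s2, s3, s4) => (v * s1, a1 * s2, s3, s4)) s)).
    exact: (symplectic_comp (symplectic_shear _ _ _) (symplectic_dilate va)).
  rewrite va /quad_e1; congr (_, _, _, _); ring.
have H2 a1 a2 a3 a4 : invertible a1 || invertible a2 ->
    exists2 g, symplectic g & g (a1, a2, a3, a4) = quad_e1.
  case/orP => [/H1 //|/(H1 a2 (- a1) a3 a4)[g gs ga]].
  by exists (fun s => g ((fun '(a1, a2, a3, a4) => (a2, - a1, a3, a4)) s)) => //;
     apply: symplectic_comp symplectic_rot.
case: a => [[[a1 a2] a3] a4]; rewrite /primitive_quad orbA => /orP[/H2 //|].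
move=> /(H2 a3 a4 a1 a2)[g gs ga].
by exists (fun s => g ((fun '(a1, a2, a3, a4) => (a3, a4, a1, a2)) s)) => //;
   apply: symplectic_comp symplectic_swap.
Qed.

Lemma ker_size_symplectic g y a b : symplectic g ->
  ker_size y (g a) (g b) = ker_size y a b.
Proof.
case=> gD gZ gS gI; rewrite /ker_size (reindex_inj gI) /=.
apply: eq_bigr => s _; apply: eq_bigr => w1 _; apply: eq_bigr => w2 _.
by rewrite /in_ker -!gZ -gD (inj_eq gI) !gS.
Qed.

Lemma ker_sizeC y a b : ker_size y a b = ker_size y b a.
Proof.
rewrite /ker_size; apply: eq_bigr => s _; rewrite exchange_big /=.
apply: eq_bigr => w1 _; apply: eq_bigr => w2 _.
by rewrite /in_ker addrC; congr (nat_of_bool (_ && _)); rewrite andbC.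
Qed.

End Quadruples.

Section KernelSizes.
Variable A : finComNzRingType.
Implicit Types (c y f z : A).

Lemma sum_coset c f : (\sum_(u : A) (c * (u - f) == 0)%R = #|ann c|)%N.
Proof.
rewrite (reindex_inj (addIr f)) /= -card_sum1; apply: eq_card => u.
by rewrite [RHS]in_ann inE addrK.
Qed.

Lemma sum_ann z : (\sum_(u : A) (z * u == 0)%R = #|ann z|)%N.
Proof. by rewrite -card_sum1; apply: eq_card => u; rewrite [RHS]in_ann inE. Qed.

(* Each [u]-variable runs over a coset of [ann c] once the others are fixed. *)
Lemma sum_triangular c z (f : A -> A -> A -> A) (g : A -> A -> A)
    (P : A -> A -> A -> A -> bool) :
    (forall u1 u2 v1 v2, P u1 u2 v1 v2 =
      [&& c * (u1 - f u2 v1 v2) == 0, c * (u2 - g v1 v2) == 0,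
          z * v1 == 0 & z * v2 == 0]) ->
  (\sum_v1 \sum_v2 \sum_u2 \sum_u1 P u1 u2 v1 v2 =
   #|ann c| ^ 2 * #|ann z| ^ 2)%N.
Proof.
move=> PE; pose a := #|ann c|.
transitivity (\sum_v1 \sum_v2 (a ^ 2 * ((z * v1 == 0)%R * (z * v2 == 0)%R)))%N.
  apply: eq_bigr => v1 _; apply: eq_bigr => v2 _.
  transitivity (\sum_u2 (a * ((c * (u2 - g v1 v2) == 0)%R *
                  ((z * v1 == 0)%R * (z * v2 == 0)%R))))%N.
    apply: eq_bigr => u2 _; rewrite /a -(sum_coset c (f u2 v1 v2)) big_distrl /=.
    by apply: eq_bigr => u1 _; rewrite PE !mulnb.
  by rewrite -big_distrr /= -big_distrl /= sum_coset -/a; lia.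
rewrite -(sum_ann z) -[in RHS](mulnn (\sum_u _)) big_distrlr big_distrr /=.
by apply: eq_bigr => v1 _; rewrite big_distrr.
Qed.

(** What remains of [in_ker] for a = e_1 once [s2] and [w1] have been eliminated; [w] stands for
    [w2]. *)
Definition in_ker4 y b2 b3 b4 s1 s3 s4 w : bool :=
  [&& w * b2 == 0, y * s3 == w * b3, y * s4 == w * b4
    & s1 * b2 + s3 * b4 == s4 * b3].

Definition ker4_size y b2 b3 b4 : nat :=
  (\sum_(s1 : A) \sum_(s3 : A) \sum_(s4 : A) \sum_(w : A)
    in_ker4 y b2 b3 b4 s1 s3 s4 w)%N.

Lemma ker4_size_le y b2 b3 b4 : (ker4_size y b2 b3 b4 <= #|A| ^ 4)%N.
Proof.
have sumle (F : A -> nat) m : (forall x, F x <= m)%N -> (\sum_x F x <= #|A| * m)%N.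
  by move=> Fm; rewrite -sum_nat_const; apply: leq_sum => x _.
rewrite !expnS expn0.
apply: (sumle) => s1; apply: (sumle) => s3; apply: (sumle) => s4; apply: (sumle) => w.
exact: leq_b1.
Qed.

Lemma sum3_rev (T1 T2 T3 : finType) (F : T1 -> T2 -> T3 -> nat) :
  (\sum_a \sum_b \sum_c F a b c = \sum_c \sum_b \sum_a F a b c)%N.
Proof.
rewrite exchange_big [RHS]exchange_big /=.
by apply: eq_bigr => b _; rewrite exchange_big.
Qed.

(** A unit coordinate makes two of the four unknowns pivots: s3 and s4 if it is y, and w together
    with s1, s4 or s3 if it is b2, b3 or b4. Each pivot is determined up to [ann c], and in all four
    cases each of the other two unknowns is constrained only by [c * y * b2]. *)
Lemma ker4_size_primitive c y b2 b3 b4 :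
  primitive_quad (y, b2, b3, b4) ->
  ker4_size (c * y) (c * b2) (c * b3) (c * b4) =
  (#|ann c| ^ 2 * #|ann (c * y * b2)%R| ^ 2)%N.
Proof.
have key (P : A -> A -> A -> A -> bool) (f : A -> A -> A -> A) (g : A -> A -> A) z :
    (forall u1 u2 v1 v2, P u1 u2 v1 v2 <->
       [/\ c * (u1 - f u2 v1 v2) = 0, c * (u2 - g v1 v2) = 0,
           z * v1 = 0 & z * v2 = 0]) ->
    (\sum_v1 \sum_v2 \sum_u2 \sum_u1 P u1 u2 v1 v2 =
      #|ann c| ^ 2 * #|ann z| ^ 2)%N.
  move=> PE; apply: (sum_triangular (f := f) (g := g)) => u1 u2 v1 v2.
  apply/idP/and4P => [/PE[-> -> -> ->] //|].
  by case=> /eqP ? /eqP ? /eqP ? /eqP ?; apply/PE.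

(* The coefficient lists passed to [lc4] are certificates: the goal is that combination of the four
   equations and of [bv], which says that the pivot is a unit; [ring] checks it. *)
have lc4 k1 k2 k3 k4 k5 e1 e2 e3 e4 e5 (X : A) :
    e1 = 0 -> e2 = 0 -> e3 = 0 -> e4 = 0 -> e5 = 0 ->
    X = k1 * e1 + k2 * e2 + k3 * e3 + k4 * e4 + k5 * e5 -> X = 0.
  by move=> -> -> -> -> -> ->; rewrite !mulr0 !addr0.
pose P s1 s3 s4 w := in_ker4 (c * y) (c * b2) (c * b3) (c * b4) s1 s3 s4 w.
have condE s1 s3 s4 w : P s1 s3 s4 w <-> [/\ w * (c * b2) = 0, c * y * s3 - w * (c * b3) = 0,
            c * y * s4 - w * (c * b4) = 0 &
            s1 * (c * b2) + s3 * (c * b4) - s4 * (c * b3) = 0].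
  rewrite /P /in_ker4 -[c * y * s3 == _]subr_eq0 -[c * y * s4 == _]subr_eq0.
  rewrite -[_ + _ == s4 * _]subr_eq0.
  by split=> [/and4P[/eqP ? /eqP ? /eqP ? /eqP ?]|[-> -> -> ->]] //; rewrite eqxx.
rewrite /primitive_quad /ker4_size => /or4P[] /existsP[v /eqP bv];
  move/eqP: bv; rewrite -subr_eq0 => /eqP bv.
- transitivity (\sum_s1 \sum_w \sum_s4 \sum_s3 P s1 s3 s4 w)%N.
    by apply: eq_bigr => s1 _; rewrite sum3_rev.
  apply: (key (fun s3 s4 s1 w => P s1 s3 s4 w) (fun _ s1 w => v * w * b3) (fun s1 w => v * w * b4)).
  move=> s3 s4 s1 w; apply: iff_trans (condE _ _ _ _) _; split=> -[H1 H2 H3 H4]; split.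
  + by apply: (lc4 0 v 0 0 (- c * s3) _ _ _ _ _ _ H1 H2 H3 H4 bv); ring.
  + by apply: (lc4 0 0 v 0 (- c * s4) _ _ _ _ _ _ H1 H2 H3 H4 bv); ring.
  + by apply: (lc4 0 (- b4) b3 y 0 _ _ _ _ _ _ H1 H2 H3 H4 bv); ring.
  + by apply: (lc4 y 0 0 0 0 _ _ _ _ _ _ H1 H2 H3 H4 bv); ring.
  + by apply: (lc4 0 0 0 v (- w * c * b2) _ _ _ _ _ _ H1 H2 H3 H4 bv); ring.
  + by apply: (lc4 y 0 0 0 (c * w * b3) _ _ _ _ _ _ H1 H2 H3 H4 bv); ring.
  + by apply: (lc4 0 y 0 0 (c * w * b4) _ _ _ _ _ _ H1 H2 H3 H4 bv); ring.
  + by apply: (lc4 (v * b4 * y) (- v * b3 * y) v 0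
      (- (s1 * c * b2 + s3 * c * b4 - s4 * c * b3)) _ _ _ _ _ _ H1 H2 H3 H4 bv); ring.
- transitivity (\sum_s3 \sum_s4 \sum_s1 \sum_w P s1 s3 s4 w)%N.
    by rewrite exchange_big /=; apply: eq_bigr => s3 _; rewrite exchange_big.
  apply: (key (fun w s1 s3 s4 => P s1 s3 s4 w) (fun _ s3 s4 => 0)
    (fun s3 s4 => v * (s4 * b3 - s3 * b4))).
  move=> w s1 s3 s4; apply: iff_trans (condE _ _ _ _) _; split=> -[H1 H2 H3 H4]; split.
  + by apply: (lc4 v 0 0 0 (- w * c) _ _ _ _ _ _ H1 H2 H3 H4 bv); ring.
  + by apply: (lc4 0 0 0 v (- c * s1) _ _ _ _ _ _ H1 H2 H3 H4 bv); ring.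
  + by apply: (lc4 b3 b2 0 0 0 _ _ _ _ _ _ H1 H2 H3 H4 bv); ring.
  + by apply: (lc4 b4 0 b2 0 0 _ _ _ _ _ _ H1 H2 H3 H4 bv); ring.
  + by apply: (lc4 b2 0 0 0 0 _ _ _ _ _ _ H1 H2 H3 H4 bv); ring.
  + by apply: (lc4 (- b3) 0 v 0 (- c * y * s3) _ _ _ _ _ _ H1 H2 H3 H4 bv); ring.
  + by apply: (lc4 (- b4) 0 0 v (- c * y * s4) _ _ _ _ _ _ H1 H2 H3 H4 bv); ring.
  + by apply: (lc4 0 b2 0 0 (c * (s4 * b3 - s3 * b4)) _ _ _ _ _ _ H1 H2 H3 H4 bv); ring.
- apply: (key (fun w s4 s1 s3 => P s1 s3 s4 w) (fun _ s1 s3 => v * y * s3)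
    (fun s1 s3 => v * (s1 * b2 + s3 * b4))).
  move=> w s4 s1 s3; apply: iff_trans (condE _ _ _ _) _; split=> -[H1 H2 H3 H4]; split.
  + by apply: (lc4 0 (- v) 0 0 (- c * w) _ _ _ _ _ _ H1 H2 H3 H4 bv); ring.
  + by apply: (lc4 0 0 0 (- v) (- c * s4) _ _ _ _ _ _ H1 H2 H3 H4 bv); ring.
  + by apply: (lc4 0 (- b4) b3 y 0 _ _ _ _ _ _ H1 H2 H3 H4 bv); ring.
  + by apply: (lc4 b3 b2 0 0 0 _ _ _ _ _ _ H1 H2 H3 H4 bv); ring.
  + by apply: (lc4 b2 0 0 v 0 _ _ _ _ _ _ H1 H2 H3 H4 bv); ring.
  + by apply: (lc4 (- b3) 0 0 0 (- c * y * s3) _ _ _ _ _ _ H1 H2 H3 H4 bv); ring.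
  + have H4' : s1 * (c * b2) + s3 * (c * b4) - s4 * (c * b3) = 0.
      by apply: (lc4 0 (- b3) 0 0 (- c * (s1 * b2 + s3 * b4)) _ _ _ _ _ _ H1 H2 H3 H4 bv); ring.
    have H2' : c * y * s3 - w * (c * b3) = 0.
      by apply: (lc4 (- b3) 0 0 0 (- c * y * s3) _ _ _ _ _ _ H1 H2 H3 H4 bv); ring.
    by apply: (lc4 0 (v * b4) v (- v * y) (- (c * y * s4 - w * (c * b4)))
      _ _ _ _ _ _ H1 H2' H3 H4' bv); ring.
  + by apply: (lc4 0 (- b3) 0 0 (- c * (s1 * b2 + s3 * b4)) _ _ _ _ _ _ H1 H2 H3 H4 bv); ring.
- transitivity (\sum_s1 \sum_s4 \sum_s3 \sum_w P s1 s3 s4 w)%N.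
    by apply: eq_bigr => s1 _; rewrite exchange_big.
  apply: (key (fun w s3 s1 s4 => P s1 s3 s4 w) (fun _ s1 s4 => v * y * s4)
    (fun s1 s4 => v * (s4 * b3 - s1 * b2))).
  move=> w s3 s1 s4; apply: iff_trans (condE _ _ _ _) _; split=> -[H1 H2 H3 H4]; split.
  + by apply: (lc4 0 0 (- v) 0 (- c * w) _ _ _ _ _ _ H1 H2 H3 H4 bv); ring.
  + by apply: (lc4 0 0 0 v (- c * s3) _ _ _ _ _ _ H1 H2 H3 H4 bv); ring.
  + by apply: (lc4 0 (- b4) b3 y 0 _ _ _ _ _ _ H1 H2 H3 H4 bv); ring.
  + by apply: (lc4 b4 0 b2 0 0 _ _ _ _ _ _ H1 H2 H3 H4 bv); ring.
  + by apply: (lc4 b2 0 0 v 0 _ _ _ _ _ _ H1 H2 H3 H4 bv); ring.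
  + have H4' : s1 * (c * b2) + s3 * (c * b4) - s4 * (c * b3) = 0.
      by apply: (lc4 0 b4 0 0 (c * (s4 * b3 - s1 * b2)) _ _ _ _ _ _ H1 H2 H3 H4 bv); ring.
    have H3' : c * y * s4 - w * (c * b4) = 0.
      by apply: (lc4 (- b4) 0 0 0 (- c * y * s4) _ _ _ _ _ _ H1 H2 H3 H4 bv); ring.
    by apply: (lc4 0 (v * b3) (- v) (v * y) (- (c * y * s3 - w * (c * b3)))
      _ _ _ _ _ _ H1 H3' H3 H4' bv); ring.
  + by apply: (lc4 (- b4) 0 0 0 (- c * y * s4) _ _ _ _ _ _ H1 H2 H3 H4 bv); ring.
  + by apply: (lc4 0 b4 0 0 (c * (s4 * b3 - s1 * b2)) _ _ _ _ _ _ H1 H2 H3 H4 bv); ring.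
Qed.

End KernelSizes.

Section CommutatorKernel.
Variable A : finComNzRingType.
Implicit Types (c y : A).

Lemma linear_combination6 k1 k2 k3 k4 k5 k6 e1 e2 e3 e4 e5 e6 (X : A) :
    e1 = 0 -> e2 = 0 -> e3 = 0 -> e4 = 0 -> e5 = 0 -> e6 = 0 ->
  X = k1 * e1 + k2 * e2 + k3 * e3 + k4 * e4 + k5 * e5 + k6 * e6 -> X = 0.
Proof. by move=> -> -> -> -> -> -> ->; rewrite !mulr0 !addr0. Qed.
Arguments linear_combination6 k1 k2 k3 k4 k5 k6 {e1 e2 e3 e4 e5 e6 X}.

(** The pairing of s with e_1 is [- s2], and the first coordinate of [y s = w1 a + w2 b] gives [w1].
    Both are thus determined up to [ann c], whence the square. *)
Lemma ker_size_e1 c y b1 b2 b3 b4 :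
  ker_size (c * y) (qscale c (quad_e1 A)) (qscale c (b1, b2, b3, b4)) =
  (#|ann c| ^ 2 * ker4_size (c * y)%R (c * b2)%R (c * b3)%R (c * b4)%R)%N.
Proof.
pose al s1 w1 w2 := c * (w1 - (y * s1 - w2 * b1)) == 0.
pose be s2 := c * (s2 - 0) == 0.
pose ga s1 s3 s4 w := in_ker4 (c * y) (c * b2) (c * b3) (c * b4) s1 s3 s4 w.
have condE s1 s2 s3 s4 w1 w2 :
    in_ker (c * y) (qscale c (quad_e1 A)) (qscale c (b1, b2, b3, b4))
      (s1, s2, s3, s4) w1 w2 = [&& al s1 w1 w2, be s2 & ga s1 s3 s4 w2].
  rewrite /in_ker /qscale quadD quadP /al /be /ga /in_ker4 /symp /quad_e1.
  rewrite -[c * y * s1 == _]subr_eq0 -[c * y * s2 == _]subr_eq0.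
  rewrite -![c * y * _ == _]subr_eq0 -[_ + _ == s4 * _]subr_eq0.
  apply/idP/idP.
    case/and3P => /and4P[/eqP H1 /eqP H2 /eqP H3 /eqP H4] /eqP H5 /eqP H6.
    apply/and3P; split.
    - apply/eqP; apply: (linear_combination6 (-1) 0 0 0 0 0 H1 H2 H3 H4 H5 H6); ring.
    - apply/eqP; apply: (linear_combination6 0 0 0 0 (-1) 0 H1 H2 H3 H4 H5 H6); ring.
    - apply/and4P; split; apply/eqP.
      + apply: (linear_combination6 0 (-1) 0 0 (- y) 0 H1 H2 H3 H4 H5 H6); ring.
      + apply: (linear_combination6 0 0 1 0 0 0 H1 H2 H3 H4 H5 H6); ring.
      + apply: (linear_combination6 0 0 0 1 0 0 H1 H2 H3 H4 H5 H6); ring.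
      + apply: (linear_combination6 0 0 0 0 (- b1) 1 H1 H2 H3 H4 H5 H6); ring.
  case/and3P => /eqP H1 /eqP H2 /and4P[/eqP H3 /eqP H4 /eqP H5 /eqP H6].
  apply/and3P; split.
  - apply/and4P; split; apply/eqP.
    + apply: (linear_combination6 (-1) 0 0 0 0 0 H1 H2 H3 H4 H5 H6); ring.
    + apply: (linear_combination6 0 y (-1) 0 0 0 H1 H2 H3 H4 H5 H6); ring.
    + apply: (linear_combination6 0 0 0 1 0 0 H1 H2 H3 H4 H5 H6); ring.
    + apply: (linear_combination6 0 0 0 0 1 0 H1 H2 H3 H4 H5 H6); ring.
  - apply/eqP; apply: (linear_combination6 0 (-1) 0 0 0 0 H1 H2 H3 H4 H5 H6); ring.
  - apply/eqP; apply: (linear_combination6 0 (- b1) 0 0 0 1 H1 H2 H3 H4 H5 H6); ring.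
rewrite /ker_size sum_quad /ker4_size big_distrr /=; apply: eq_bigr => s1 _.
rewrite -mulnn -{1}(sum_coset c 0) -mulnA [RHS]big_distrl /=; apply: eq_bigr => s2 _.
rewrite !big_distrr /=; apply: eq_bigr => s3 _.
rewrite !big_distrr /=; apply: eq_bigr => s4 _.
rewrite exchange_big /= !big_distrr /=; apply: eq_bigr => w2 _.
rewrite -(sum_coset c (y * s1 - w2 * b1)) big_distrl big_distrr /=.
by apply: eq_bigr => w1 _; rewrite condE /al /be /ga -!mulnb mulnCA.
Qed.

(** The unit [y] gives each coordinate of s up to [ann c]; substitution into the two symplectic
    conditions leaves [c * symp a b] killing [w1] and [w2]. *)
Lemma ker_size_invertible c y a b : invertible y ->
  ker_size (c * y) (qscale c a) (qscale c b) =
  (#|ann c| ^ 4 * #|ann (c * symp a b)%R| ^ 2)%N.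
Proof.
case: a b => [[[a1 a2] a3] a4] [[[b1 b2] b3] b4] /existsP[v /eqP].
move/eqP; rewrite -subr_eq0 => /eqP yv.
set z := c * symp _ _.
pose al (x1 x2 s w1 w2 : A) := c * (s - v * (w1 * x1 + w2 * x2)) == 0.
have condE s1 s2 s3 s4 w1 w2 :
    in_ker (c * y) (qscale c (a1, a2, a3, a4)) (qscale c (b1, b2, b3, b4))
      (s1, s2, s3, s4) w1 w2 =
    [&& al a1 b1 s1 w1 w2, al a2 b2 s2 w1 w2, al a3 b3 s3 w1 w2,
        al a4 b4 s4 w1 w2, z * w1 == 0 & z * w2 == 0].
  rewrite /in_ker /qscale quadD quadP /al /z /symp.
  rewrite -[c * y * s1 == _]subr_eq0 -[c * y * s2 == _]subr_eq0.
  rewrite -[c * y * s3 == _]subr_eq0 -[c * y * s4 == _]subr_eq0.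
  have fwd x1 x2 s : c * y * s - (w1 * (c * x1) + w2 * (c * x2)) = 0 ->
      c * (s - v * (w1 * x1 + w2 * x2)) = 0.
    move=> H; apply: (linear_combination6 v (- c * s) 0 0 0 0 H yv yv yv yv yv); ring.
  have bwd x1 x2 s : c * (s - v * (w1 * x1 + w2 * x2)) = 0 ->
      c * y * s - (w1 * (c * x1) + w2 * (c * x2)) = 0.
    move=> H; apply: (linear_combination6 y (c * (w1 * x1 + w2 * x2)) 0 0 0 0 H yv yv yv yv yv); ring.
  apply/idP/idP.
    case/and3P => /and4P[/eqP H1 /eqP H2 /eqP H3 /eqP H4] /eqP H5 /eqP H6.
    rewrite !fwd // eqxx /=; apply/andP; split; apply/eqP.
    - apply: (linear_combination6 (- b2) b1 (- b4) b3 y 0 H1 H2 H3 H4 H6 H6); ring.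
    - apply: (linear_combination6 a2 (- a1) a4 (- a3) (- y) 0 H1 H2 H3 H4 H5 H6); ring.
  case/and5P => /eqP H1 /eqP H2 /eqP H3 /eqP H4 /andP[/eqP H5 /eqP H6].
  rewrite !bwd // eqxx /=; apply/andP; split; apply/eqP.
  - apply: (linear_combination6 a2 (- a1) a4 (- a3) 0 (- v) H1 H2 H3 H4 H5 H6); ring.
  - apply: (linear_combination6 b2 (- b1) b4 (- b3) v 0 H1 H2 H3 H4 H5 H6); ring.
rewrite /ker_size sum3_rev.
transitivity (\sum_w2 \sum_w1 (#|ann c| ^ 4 * ((z * w1 == 0)%R * (z * w2 == 0)%R)))%N.
  apply: eq_bigr => w2 _; apply: eq_bigr => w1 _.
  rewrite sum_quad !expnS expn0 muln1 -!mulnA.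
  rewrite -{1}(sum_coset c (v * (w1 * a1 + w2 * b1))) big_distrl /=; apply: eq_bigr => s1 _.
  rewrite -{1}(sum_coset c (v * (w1 * a2 + w2 * b2))) big_distrl big_distrr /=; apply: eq_bigr => s2 _.
  rewrite -{1}(sum_coset c (v * (w1 * a3 + w2 * b3))) big_distrl !big_distrr /=; apply: eq_bigr => s3 _.
  rewrite -{1}(sum_coset c (v * (w1 * a4 + w2 * b4))) big_distrl !big_distrr /=; apply: eq_bigr => s4 _.
  by rewrite condE /al !mulnb.
rewrite exchange_big -(sum_ann z) -[in RHS](mulnn (\sum_u _)) big_distrlr big_distrr /=.
by apply: eq_bigr => w1 _; rewrite big_distrr.
Qed.

End CommutatorKernel.

(** * Recurrences in the level *)

Section Lengths.
Variables (A : finComNzRingType) (pi : A) (N : nat).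
Hypothesis chA : chain_ring pi N.
Local Notation q := #|ann pi|.

(** The length of the ideal xA, which has [#|A| / #|ann x|] elements. *)
Definition len (x : A) : nat := (N - trunc_log q #|ann x|)%N.

(* The character (y, a, b) of the centre gives dimension [q ^ dim_len y a b], *)
(* the square root of [q ^ (6 * N) / ker_size y a b]. *)
Definition dim_len (y : A) (a b : quad A) : nat :=
  (3 * N - (trunc_log q (ker_size y a b))./2)%N.

(** The share of the four-variable system in [dim_len]: its kernel has index [q ^ (2 * len4)] in
    A^4. *)
Definition len4 (v : quad A) : nat :=
  let: (y, b2, b3, b4) := v in (2 * N - (trunc_log q (ker4_size y b2 b3 b4))./2)%N.

Lemma card_ann_pi_min i : #|ann (pi ^+ i)| = (q ^ minn i N)%N.
Proof.
case: (leqP i N) => [iN|Ni]; first exact: (card_ann_pi chA).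
rewrite -(card_chain chA) -cardsT; apply: eq_card => w; rewrite in_ann inE.
by rewrite (eqP (_ : pi ^+ i == 0)) ?mul0r ?eqxx // (chain_pow_eq0 chA) ltnW.
Qed.

Let q_gt1 : (1 < q)%N := card_ann_pi_gt1 chA.

Lemma card_ann_len x : #|ann x| = (q ^ (N - len x))%N /\ (len x <= N)%N.
Proof.
split; last exact: leq_subr.
have [->|x0] := eqVneq x 0.
  have E : #|ann (0 : A)| = (q ^ N)%N.
    by rewrite -(card_chain chA) -cardsT; apply: eq_card => w; rewrite in_ann inE mul0r eqxx.
  by rewrite /len E trunc_expnK // subnn subn0.
have [i [u [iN uu ->]]] := chain_decomp chA x0.
rewrite /len (ann_mul_invertible _ uu) (card_ann_pi chA) 1?ltnW // trunc_expnK //.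
by rewrite subKn // ltnW.
Qed.

Lemma len_mul_invertible x u : invertible u -> len (x * u) = len x.
Proof. by move=> uu; rewrite /len (ann_mul_invertible _ uu). Qed.

Lemma len_pi i : len (pi ^+ i) = (N - i)%N.
Proof. by rewrite /len card_ann_pi_min trunc_expnK //; lia. Qed.

Lemma trunc_logMexp k n : (0 < n)%N ->
  trunc_log q (q ^ k * n) = (k + trunc_log q n)%N.
Proof.
move=> n0; elim: k => [|k IHk]; first by rewrite mul1n.
by rewrite expnS -mulnA trunc_logMp ?IHk ?muln_gt0 ?expn_gt0 ?n0 ?(ltnW q_gt1).
Qed.

Lemma len4_primitive i y b2 b3 b4 : primitive_quad (y, b2, b3, b4) ->
  len4 (qscale (pi ^+ i) (y, b2, b3, b4)) = ((N - i) + len (pi ^+ i * (y * b2))%R)%N.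
Proof.
move=> pr; rewrite /len4 /qscale ker4_size_primitive // mulrA.
have [-> le] := card_ann_len (pi ^+ i * y * b2).
rewrite card_ann_pi_min -!expnM -expnD trunc_expnK //; lia.
Qed.

Lemma ker4_size_gt0 (y b2 b3 b4 : A) : (0 < ker4_size y b2 b3 b4)%N.
Proof.
rewrite /ker4_size (bigD1 (0 : A)) //= (bigD1 (0 : A)) //= (bigD1 (0 : A)) //=.
by rewrite (bigD1 (0 : A)) //= /in_ker4 !(mul0r, mulr0) addr0 eqxx.
Qed.

Lemma dim_len_symplectic_primitive i y a b g : symplectic g -> g a = quad_e1 A ->
    dim_len (pi ^+ i * y) (qscale (pi ^+ i) a) (qscale (pi ^+ i) b) =
    ((N - i) + len4 (qscale (pi ^+ i)
       (let: (b1, b2, b3, b4) := g b in (y, b2, b3, b4)))%R)%N.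
Proof.
move=> gs ga; rewrite /dim_len.
rewrite -(ker_size_symplectic _ _ _ gs); case: (gs) => _ gZ _ _; rewrite !gZ ga.
case: (g b) => [[[b1 b2] b3] b4]; rewrite ker_size_e1 /len4 /qscale.
set k := ker4_size _ _ _ _.
rewrite card_ann_pi_min -expnM trunc_logMexp ?ker4_size_gt0 //.
have : (trunc_log q k <= 4 * N)%N.
  rewrite -(trunc_expnK (4 * N) q_gt1); apply: leq_trunc_log.
  by rewrite mulnC expnM -(card_chain chA) ker4_size_le.
by lia.
Qed.

Lemma dim_len_invertible i y a b : invertible y ->
  dim_len (pi ^+ i * y) (qscale (pi ^+ i) a) (qscale (pi ^+ i) b) =
  (2 * (N - i) + len (pi ^+ i * symp a b)%R)%N.
Proof.
move=> yu; rewrite /dim_len ker_size_invertible //.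
have [-> le] := card_ann_len (pi ^+ i * symp a b).
rewrite card_ann_pi_min -!expnM -expnD trunc_expnK //; lia.
Qed.

Lemma dim_lenC y a b : dim_len y a b = dim_len y b a.
Proof. by rewrite /dim_len ker_sizeC. Qed.

End Lengths.

Section Sums.
Variables (A : finComNzRingType) (pi : A) (N : nat).
Hypothesis chA : chain_ring pi N.
Variables (F : numFieldType) (t : F).
Local Notation q := #|ann pi|.
Local Notation Q := (q%:R : F).
Local Notation a := (#|A|%:R : F).
Local Notation len := (len pi N).
Local Notation dim_len := (dim_len pi N).
Local Notation len4 := (len4 pi N).

Let q_gt0 : (0 < q)%N := ltnW (card_ann_pi_gt1 chA).

Let Q0 : Q != 0.
Proof. by rewrite pnatr_eq0 -lt0n. Qed.

Lemma sum_split (f : A -> F) :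
  \sum_x f x = \sum_(x | invertible x) f x + Q^-1 * \sum_x f (pi * x).
Proof.
by rewrite (sum_mul_pi chA) -[X in _ * X]mulr_natl mulKf // [LHS](bigID (@invertible A)).
Qed.

(** A non-primitive vector is [pi] times a vector in q^4 ways. *)
Lemma sum_split_quad (f : quad A -> F) :
  \sum_v f v = \sum_(v | primitive_quad v) f v
               + Q^-1 ^+ 4 * \sum_v f (qscale pi v).
Proof.
rewrite [LHS](bigID (@primitive_quad A)) /=; congr (_ + _).
rewrite big_mkcond !sum_quad.
have nonprim (g : A -> F) : \sum_(x | ~~ invertible x) g x = Q^-1 * \sum_x g (pi * x).
  by rewrite (sum_mul_pi chA) -[X in _ * X]mulr_natl mulKf.
transitivity (\sum_(v1 | ~~ invertible v1) \sum_(v2 | ~~ invertible v2)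
   \sum_(v3 | ~~ invertible v3) \sum_(v4 | ~~ invertible v4) f (v1, v2, v3, v4 : A)).
  rewrite [RHS]big_mkcond; apply: eq_bigr => v1 _; rewrite /primitive_quad.
  case: (invertible v1) => /=; first by rewrite !big1 // => ? _; rewrite !big1 // => ? _; rewrite big1.
  rewrite [RHS]big_mkcond; apply: eq_bigr => v2 _.
  case: (invertible v2) => /=; first by rewrite !big1 // => ? _; rewrite !big1.
  rewrite [RHS]big_mkcond; apply: eq_bigr => v3 _.
  case: (invertible v3) => /=; first by rewrite !big1.
  by rewrite [RHS]big_mkcond.
rewrite nonprim exprS -mulrA; congr (_ * _); rewrite [RHS]big_distrr; apply: eq_bigr => v1 _ /=.
rewrite nonprim exprS -mulrA; congr (_ * _); rewrite [RHS]big_distrr; apply: eq_bigr => v2 _ /=.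
rewrite nonprim exprS -mulrA; congr (_ * _); rewrite [RHS]big_distrr; apply: eq_bigr => v3 _ /=.
by rewrite nonprim expr1.
Qed.

Lemma sum_invertible_const (c : F) :
  \sum_(x : A | invertible x) c = (1 - Q^-1) * a * c.
Proof.
have := sum_split (fun=> c); rewrite sumr_const -[c *+ _]mulr_natl => E.
by rewrite -mulrA mulrBl mul1r {1}E addrK.
Qed.

Lemma sum_primitive_const (c : F) :
  \sum_(v : quad A | primitive_quad v) c = (1 - Q^-1 ^+ 4) * a ^+ 4 * c.
Proof.
have := sum_split_quad (fun=> c); rewrite sumr_const -[c *+ _]mulr_natl.
rewrite !card_prod !natrM (_ : a * a * a * a = a ^+ 4); last by ring.
by move=> E; rewrite -mulrA mulrBl mul1r {1}E addrK.
Qed.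

(* All variables are scaled by [pi ^+ i]: splitting a sum into its primitive *)
(* vectors and the multiples of [pi] relates it to the sums for [i.+1]. *)
Definition sumL i := \sum_x t ^+ len (pi ^+ i * x).
Definition sumT i := \sum_y \sum_b t ^+ len (pi ^+ i * (y * b)).
Definition sumE i := \sum_a \sum_b t ^+ len (pi ^+ i * symp a b).
Definition sumX i := \sum_v t ^+ len4 (qscale (pi ^+ i) v).
Definition sumS i := \sum_y \sum_a \sum_b
  t ^+ dim_len (pi ^+ i * y) (qscale (pi ^+ i) a) (qscale (pi ^+ i) b).

Lemma sumL_rec i : sumL i = (1 - Q^-1) * a * t ^+ (N - i) + Q^-1 * sumL i.+1.
Proof.
rewrite /sumL sum_split; congr (_ + _ * _); last first.
  by apply: eq_bigr => x _; rewrite exprSr -mulrA.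
rewrite -sum_invertible_const; apply: eq_bigr => x ux.
by rewrite len_mul_invertible // len_pi.
Qed.

Lemma sumT_rec i : sumT i = (1 - Q^-1) * a * sumL i + Q^-1 * sumT i.+1.
Proof.
rewrite /sumT sum_split; congr (_ + _ * _); last first.
  by apply: eq_bigr => x _; apply: eq_bigr => b _; rewrite exprSr -!mulrA.
rewrite -sum_invertible_const; apply: eq_bigr => y uy.
by apply: eq_bigr => b _; rewrite [y * b]mulrC mulrA len_mul_invertible.
Qed.

Lemma qscale1 (v : quad A) : qscale 1 v = v.
Proof. by case: v => [[[? ?] ?] ?]; rewrite /qscale !mul1r. Qed.

Lemma qscaleA (c d : A) (v : quad A) : qscale (c * d) v = qscale c (qscale d v).
Proof. by case: v => [[[? ?] ?] ?]; rewrite /qscale !mulrA. Qed.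

Lemma sympZl (c : A) (v w : quad A) : symp (qscale c v) w = c * symp v w.
Proof. by case: v w => [[[? ?] ?] ?] [[[? ?] ?] ?]; rewrite /symp /qscale; ring. Qed.

Lemma sympZr (c : A) (v w : quad A) : symp v (qscale c w) = c * symp v w.
Proof. by case: v w => [[[? ?] ?] ?] [[[? ?] ?] ?]; rewrite /symp /qscale; ring. Qed.

(** A primitive first argument can be moved to e_1; the form is then the second coordinate of b. The
    exponent 7 counts the primitive vector (4) and the three free coordinates of b. *)
Lemma sumE_rec i :
  sumE i = (1 - Q^-1 ^+ 4) * a ^+ 7 * sumL i + Q^-1 ^+ 4 * sumE i.+1.
Proof.
rewrite /sumE sum_split_quad; congr (_ + _ * _); last first.
  apply: eq_bigr => v _; apply: eq_bigr => b _.
  by rewrite exprSr sympZl mulrA.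
rewrite (exprD a 4 3) mulrA -[_ * sumL i]mulrA -sum_primitive_const; apply: eq_bigr => v pv.
have [g [_ _ gS gI] gv] := primitive_symplectic pv.
transitivity (\sum_b t ^+ len (pi ^+ i * symp (quad_e1 A) b)).
  by rewrite [RHS](reindex_inj gI); apply: eq_bigr => b _; rewrite -gv gS.
rewrite sum_quad /sumL.
transitivity (\sum_(v1 : A) \sum_(v2 : A) \sum_(v3 : A) \sum_(v4 : A) t ^+ len (pi ^+ i * v2)).
  do 4![apply: eq_bigr => ? _]; rewrite /symp /quad_e1.
  by rewrite mul1r !mul0r !subr0 addr0.
rewrite sumr_const -[_ *+ #|_|]mulr_natl [a ^+ 3]exprS -mulrA; congr (_ * _).
rewrite !mulr_sumr; apply: eq_bigr => b2 _.
rewrite sumr_const sumr_const -!mulrnA -[_ *+ _]mulr_natl natrM; ring.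
Qed.

(** [len4_primitive] applies to primitive vectors only, so its sum is taken over all vectors and the
    multiples of [pi] are subtracted; on those, [y * b2] gains [pi ^+ 2], whence [sumT i.+2]. *)
Lemma sumX_rec i :
  sumX i = t ^+ (N - i) * a ^+ 2 * (sumT i - Q^-1 ^+ 4 * sumT i.+2)
           + Q^-1 ^+ 4 * sumX i.+1.
Proof.
rewrite /sumX sum_split_quad; congr (_ + _ * _); last first.
  by apply: eq_bigr => v _; rewrite exprSr qscaleA.
pose f (v : quad A) := let: (y, b2, b3, b4) := v in
  t ^+ (N - i) * t ^+ len (pi ^+ i * (y * b2)).
transitivity (\sum_(v | primitive_quad v) f v).
  by apply: eq_bigr => -[[[y b2] b3] b4] pv; rewrite len4_primitive // exprD.
have -> : \sum_(v | primitive_quad v) f v =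
    \sum_v f v - Q^-1 ^+ 4 * \sum_v f (qscale pi v).
  by rewrite [\sum_v f v]sum_split_quad addrK.
have E j (g : A -> A -> F) : (forall y b, g y b = t ^+ (N - i) * t ^+ len (pi ^+ j * (y * b))) ->
    \sum_(y : A) \sum_(b2 : A) \sum_(b3 : A) \sum_(b4 : A) g y b2 = t ^+ (N - i) * a ^+ 2 * sumT j.
  move=> gE; rewrite /sumT mulr_sumr; apply: eq_bigr => y _; rewrite mulr_sumr.
  apply: eq_bigr => b _; rewrite !sumr_const -mulrnA -[_ *+ _]mulr_natl natrM gE; ring.
rewrite !sum_quad (E i) // (E i.+2 (fun y b => f (qscale pi (y, b, 0, 0)))).
  by ring.
by move=> y b; rewrite /f /qscale; congr (_ * t ^+ len _); rewrite 2!exprSr; ring.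
Qed.

(** Needed in [sumS_rec] when only one of a, b is primitive: the other is a multiple of [pi], while
    y stays arbitrary. *)
Definition sumY i := \sum_(y : A) \sum_(b2 : A) \sum_(b3 : A) \sum_(b4 : A)
  t ^+ len4 (qscale (pi ^+ i) (y, pi * b2, pi * b3, pi * b4)).

Lemma sumY_rec i :
  sumY i = (1 - Q^-1) * a ^+ 3 * t ^+ (N - i) * sumL i.+1 + Q^-1 * sumX i.+1.
Proof.
rewrite /sumY sum_split; congr (_ + _ * _); last first.
  rewrite /sumX sum_quad; do 4![apply: eq_bigr => ? _].
  by rewrite exprSr qscaleA.
transitivity (\sum_(y : A | invertible y) (a ^+ 2 * t ^+ (N - i) * sumL i.+1)).
  apply: eq_bigr => y uy; rewrite /sumL mulr_sumr; apply: eq_bigr => b2 _.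
  transitivity (\sum_(b3 : A) \sum_(b4 : A) (t ^+ (N - i) * t ^+ len (pi ^+ i.+1 * b2))).
    do 2![apply: eq_bigr => ? _].
    rewrite (len4_primitive chA) /primitive_quad ?uy // exprD.
    by rewrite [y * _]mulrC !mulrA -exprSr len_mul_invertible.
  rewrite !sumr_const -mulrnA -[_ *+ _]mulr_natl natrM; ring.
by rewrite sum_invertible_const; ring.
Qed.

Lemma sum_dim_primitive i (c y : A) (v : quad A) : primitive_quad v ->
  \sum_b t ^+ dim_len (pi ^+ i * y) (qscale (pi ^+ i) v) (qscale (pi ^+ i) (qscale c b)) =
  a * t ^+ (N - i) * \sum_(b2 : A) \sum_(b3 : A) \sum_(b4 : A)
    t ^+ len4 (qscale (pi ^+ i) (y, c * b2, c * b3, c * b4)).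
Proof.
case/primitive_symplectic => g gs ga.
have gE b := dim_len_symplectic_primitive chA i y (qscale c b) gs ga.
case: (gs) => _ gZ _ gI.
under eq_bigr do rewrite gE gZ exprD.
rewrite -mulr_sumr [a * _]mulrC -mulrA; congr (_ * _).
transitivity (\sum_b t ^+ len4 (qscale (pi ^+ i)
  (let: (b1, b2, b3, b4) := qscale c b in (y, b2, b3, b4)))).
  by rewrite [RHS](reindex_inj gI); apply: eq_bigr => b _.
by rewrite sum_quad /= sumr_const -[_ *+ #|_|]mulr_natl.
Qed.

(** Either a is primitive ([sumX]), or a is divisible by [pi] and b primitive ([sumY], by the
    symmetry [dim_lenC]), or both are divisible. In the last case a unit y leaves the form of two
    multiples of [pi], hence [sumE i.+2], and a non-unit y leads back to [sumS i.+1]. *)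
Lemma sumS_rec i :
  sumS i = (1 - Q^-1 ^+ 4) * a ^+ 5 * t ^+ (N - i) * (sumX i + Q^-1 ^+ 4 * sumY i)
    + Q^-1 ^+ 8 * ((1 - Q^-1) * a * t ^+ (2 * (N - i)) * sumE i.+2
                   + Q^-1 * sumS i.+1).
Proof.
pose W y v b := t ^+ dim_len (pi ^+ i * y) (qscale (pi ^+ i) v) (qscale (pi ^+ i) b).
have W_C y v b : W y v b = W y b v by rewrite /W dim_lenC.
have Wprim c v : primitive_quad v -> \sum_y \sum_b W y v (qscale c b) =
    a * t ^+ (N - i) * \sum_(y : A) \sum_(b2 : A) \sum_(b3 : A) \sum_(b4 : A)
      t ^+ len4 (qscale (pi ^+ i) (y, c * b2, c * b3, c * b4)).
  move=> pv; rewrite mulr_sumr; apply: eq_bigr => y _.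
  exact: sum_dim_primitive.
have part1 : \sum_(v | primitive_quad v) \sum_y \sum_b W y v b =
    (1 - Q^-1 ^+ 4) * a ^+ 5 * t ^+ (N - i) * sumX i.
  transitivity (\sum_(v : quad A | primitive_quad v) (a * t ^+ (N - i) * sumX i)).
    apply: eq_bigr => v pv; rewrite /sumX sum_quad.
    transitivity (\sum_y \sum_b W y v (qscale 1 b)).
      by do 2![apply: eq_bigr => ? _]; rewrite qscale1.
    by rewrite Wprim //; congr (_ * _); do 4![apply: eq_bigr => ? _]; rewrite !mul1r.
  by rewrite sum_primitive_const; ring.
have part2 : \sum_(v | primitive_quad v) \sum_y \sum_b W y v (qscale pi b) =
    (1 - Q^-1 ^+ 4) * a ^+ 5 * t ^+ (N - i) * sumY i.
  transitivity (\sum_(v : quad A | primitive_quad v) (a * t ^+ (N - i) * sumY i)).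
    by apply: eq_bigr => v pv; rewrite Wprim.
  by rewrite sum_primitive_const; ring.
have part3 : \sum_y \sum_v \sum_b W y (qscale pi v) (qscale pi b) =
    (1 - Q^-1) * a * t ^+ (2 * (N - i)) * sumE i.+2 + Q^-1 * sumS i.+1.
  rewrite sum_split; congr (_ + _ * _); last first.
    do 3![apply: eq_bigr => ? _]; by rewrite /W exprSr !qscaleA mulrA.
  rewrite -mulrA -sum_invertible_const; apply: eq_bigr => y uy.
  rewrite /sumE mulr_sumr; apply: eq_bigr => v _.
  rewrite mulr_sumr; apply: eq_bigr => b _.
  rewrite /W dim_len_invertible // exprD sympZl sympZr.
  by congr (_ * t ^+ len _); rewrite 2!exprSr; ring.
transitivity (\sum_v \sum_y \sum_b W y v b); first by rewrite exchange_big.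
rewrite sum_split_quad part1.
transitivity ((1 - Q^-1 ^+ 4) * a ^+ 5 * t ^+ (N - i) * sumX i + Q^-1 ^+ 4 *
   \sum_b \sum_y \sum_v W y b (qscale pi v)).
  congr (_ + _ * _); rewrite exchange_big [RHS]exchange_big /=; apply: eq_bigr => y _.
  by rewrite exchange_big; do 2![apply: eq_bigr => ? _].
rewrite sum_split_quad part2.
rewrite [\sum_v \sum_y \sum_b W y (qscale pi v) (qscale pi b)]exchange_big part3.
ring.
Qed.

End Sums.

(** * Exactness of the logarithms, and divisibility of triples of small dimension *)

Section Decomposition.
Variables (A : finComNzRingType) (pi : A) (N : nat).
Hypothesis chA : chain_ring pi N.
Local Notation q := #|ann pi|.
Local Notation dlen := (dim_len pi N).

Let q_gt1 : (1 < q)%N := card_ann_pi_gt1 chA.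

Lemma nonprimitive_quad (v : quad A) : ~~ primitive_quad v ->
  exists w, v = qscale pi w.
Proof.
case: v => [[[v1 v2] v3] v4]; rewrite /primitive_quad !negb_or.
case/and4P => /(invertibleP chA)[w1 ->] /(invertibleP chA)[w2 ->].
move=> /(invertibleP chA)[w3 ->] /(invertibleP chA)[w4 ->].
by exists (w1, w2, w3, w4).
Qed.

Lemma quad_decomp (v : quad A) : exists i w,
  [/\ (i <= N)%N, v = qscale (pi ^+ i) w & (i < N)%N -> primitive_quad w].
Proof.
suff H k : forall i w, (N <= i + k)%N -> (i <= N)%N -> v = qscale (pi ^+ i) w -> exists i w,
    [/\ (i <= N)%N, v = qscale (pi ^+ i) w & (i < N)%N -> primitive_quad w].
  by apply: (H N 0%N v) => //; rewrite qscale1.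
elim: k => [|k IHk] i w Nik iN vE; first by exists i, w; split=> // ; lia.
have [pw|/nonprimitive_quad[w' wE]] := boolP (primitive_quad w).
  by exists i, w.
have [iN'|Ni] := ltnP i N; last by exists i, w; split=> //; lia.
by apply: (IHk i.+1 w'); rewrite ?addSnnS // vE wE exprSr qscaleA.
Qed.

Lemma triple_decomp (y : A) (a b : quad A) : exists i y' a' b',
  [/\ (i <= N)%N, y = pi ^+ i * y', a = qscale (pi ^+ i) a',
      b = qscale (pi ^+ i) b' &
      (i < N)%N -> [\/ invertible y', primitive_quad a' | primitive_quad b']].
Proof.
pose P i y' a' b' := [/\ (i <= N)%N, y = pi ^+ i * y', a = qscale (pi ^+ i) a' &
      b = qscale (pi ^+ i) b'].
suff H k : forall i y' a' b', (N <= i + k)%N -> P i y' a' b' ->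
    exists i y' a' b', P i y' a' b' /\
     ((i < N)%N -> [\/ invertible y', primitive_quad a' | primitive_quad b']).
  have [|i [y' [a' [b' [[? ? ? ?] ?]]]]] := H N 0%N y a b (leqnn _).
    by split; rewrite ?qscale1 ?mul1r.
  by exists i, y', a', b'.
elim: k => [|k IHk] i y' a' b' Nik Pi; first by exists i, y', a', b'; split=> //; lia.
have [yu|/(invertibleP chA)[y'' yE]] := boolP (invertible y').
  by exists i, y', a', b'; split=> // _; constructor 1.
have [pa|/nonprimitive_quad[a'' aE]] := boolP (primitive_quad a').
  by exists i, y', a', b'; split=> // _; constructor 2.
have [pb|/nonprimitive_quad[b'' bE]] := boolP (primitive_quad b').
  by exists i, y', a', b'; split=> // _; constructor 3.
have [iN'|Ni] := ltnP i N; last by exists i, y', a', b'; split=> //; lia.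
apply: (IHk i.+1 y'' a'' b''); rewrite ?addSnnS // /P; case: Pi => _ -> -> ->.
by split=> //; rewrite ?yE ?aE ?bE exprSr ?qscaleA ?mulrA.
Qed.

Let pow0 i : (N <= i)%N -> pi ^+ i = 0.
Proof. by rewrite -(chain_pow_eq0 chA) => /eqP. Qed.

Lemma qscale0 (v : quad A) : qscale 0 v = 0.
Proof. by case: v => [[[? ?] ?] ?]; rewrite /qscale !mul0r. Qed.

Lemma ker4_size_square (v : quad A) :
  let: (y, b2, b3, b4) := v in exists j, ker4_size y b2 b3 b4 = (q ^ (2 * j))%N.
Proof.
have [i [w [iN -> pw]]] := quad_decomp v.
have H (w' : quad A) : primitive_quad w' -> qscale (pi ^+ i) w = qscale (pi ^+ i) w' ->
    let: (y, b2, b3, b4) := qscale (pi ^+ i) w in exists j, ker4_size y b2 b3 b4 = (q ^ (2 * j))%N.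
  move=> pw' ->; case: w' pw' => [[[y b2] b3] b4] pw'; rewrite /qscale.
  rewrite ker4_size_primitive // (card_ann_pi_min chA).
  have [-> _] := card_ann_len chA (pi ^+ i * y * b2).
  by rewrite -!expnM -expnD mulnC [(_ * 2)%N]mulnC -mulnDr; eexists.
have [/pw pw'|Ni] := ltnP i N; first exact: (H w).
apply: (H (1, 0, 0, 0)); last by rewrite pow0 // !qscale0.
by rewrite /primitive_quad; apply/orP; left; apply/existsP; exists 1; rewrite mulr1.
Qed.

Lemma ker_size_le (y : A) a b : (ker_size y a b <= q ^ (2 * (3 * N)))%N.
Proof.
have -> : (q ^ (2 * (3 * N)) = #|{: quad A}| * (#|A| * #|A|))%N.
  by rewrite !card_prod (card_chain chA) -!expnD; congr (q ^ _)%N; lia.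
rewrite -sum_nat_const; apply: leq_sum => s _.
rewrite -sum_nat_const; apply: leq_sum => w1 _.
by rewrite -[X in (_ <= X)%N]sum1_card; apply: leq_sum => w2 _; apply: leq_b1.
Qed.

(** Makes [trunc_log] and the halving in [dim_len] exact, so that [ker_size_dim_len] holds as an
    equality. *)
Lemma ker_size_square (y : A) (a b : quad A) :
  exists j, ker_size y a b = (q ^ (2 * j))%N.
Proof.
have [i [y' [a' [b' [iN -> -> -> pw]]]]] := triple_decomp y a b.
have Hy (y'' : A) a'' b'' : invertible y'' ->
    exists j, ker_size (pi ^+ i * y'') (qscale (pi ^+ i) a'') (qscale (pi ^+ i) b'') = (q ^ (2 * j))%N.
  move=> yu; rewrite ker_size_invertible // (card_ann_pi_min chA).
  have [-> _] := card_ann_len chA (pi ^+ i * symp a'' b'').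
  exists (2 * minn i N + (N - len pi N (pi ^+ i * symp a'' b'')%R))%N.
  by rewrite -!expnM -expnD; congr (q ^ _)%N; lia.
have Ha (y'' : A) (a'' b'' : quad A) : primitive_quad a'' ->
    exists j, ker_size (pi ^+ i * y'') (qscale (pi ^+ i) a'') (qscale (pi ^+ i) b'') = (q ^ (2 * j))%N.
  case/primitive_symplectic => g gs ga; case: (gs) => _ gZ _ _.
  rewrite -(ker_size_symplectic _ _ _ gs) !gZ ga.
  case: (g b'') => [[[b1 b2] b3] b4]; rewrite ker_size_e1.
  have [j ->] := ker4_size_square (qscale (pi ^+ i) (y'', b2, b3, b4)).
  exists (minn i N + j)%N; rewrite (card_ann_pi_min chA) -expnM -expnD.
  by congr (q ^ _)%N; lia.
have [iN'|Ni] := ltnP i N.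
  by case: (pw iN') => [/Hy|/Ha|/Ha] //; rewrite ker_sizeC.
(* Here [pi ^+ i = 0], so the triple vanishes and its y may be written as [pi ^+ i] times the unit
   1. *)
have := Hy 1 a' b'; rewrite pow0 // !mul0r; apply.
by apply/existsP; exists 1; rewrite mulr1.
Qed.

Lemma ker_size_dim_len y a b :
  (ker_size y a b * (q ^ dlen y a b) ^ 2 = #|A| ^ 6)%N.
Proof.
have := ker_size_le y a b; rewrite /dim_len.
have [j ->] := ker_size_square y a b; rewrite trunc_expnK // leq_exp2l // => le.
by rewrite (card_chain chA) -!expnM -expnD; congr (q ^ _)%N; lia.
Qed.

(** A triple with exact common factor [pi ^+ i], i < N, has [dim_len] at least N - i, whichever of
    y, a, b is responsible. This is what lets a character of small dimension descend to a lower
    level. *)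
Lemma dim_len_le m y a b : (m <= N)%N -> (dlen y a b <= m)%N ->
  exists y' a' b', [/\ y = pi ^+ (N - m) * y', a = qscale (pi ^+ (N - m)) a' &
    b = qscale (pi ^+ (N - m)) b'].
Proof.
move=> mN; have [i [y' [a' [b' [iN -> -> -> pw]]]]] := triple_decomp y a b.
suff H : (i < N)%N -> (N - i <= dlen (pi ^+ i * y')%R (qscale (pi ^+ i) a') (qscale (pi ^+ i) b'))%N.
  move=> le; have Nmi : (N - m <= i)%N.
    by case: (ltnP i N) => [/H|]; lia.
  exists (pi ^+ (i - (N - m)) * y'), (qscale (pi ^+ (i - (N - m))) a'),
     (qscale (pi ^+ (i - (N - m))) b').
  by rewrite mulrA -!qscaleA -exprD subnKC.
move=> /pw[yu|pa|pb].
- by rewrite dim_len_invertible //; lia.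
- have [g gs ga] := primitive_symplectic pa.
  by rewrite (dim_len_symplectic_primitive chA _ _ _ gs ga) leq_addr.
- have [g gs ga] := primitive_symplectic pb.
  by rewrite dim_lenC (dim_len_symplectic_primitive chA _ _ _ gs ga) leq_addr.
Qed.

End Decomposition.

(** * Solution of the recurrences *)

Section Sequences.
Variables (F : numFieldType) (u t : F).

(* The sums above divided by their number of terms: they depend only on *)
(* [u = q^-1], [t] and the remaining level [n = N - i]. *)
Fixpoint seqL n : F :=
  if n is m.+1 then (1 - u) * t ^+ n + u * seqL m else 1.
Fixpoint seqT n : F :=
  if n is m.+1 then (1 - u) * seqL n + u * seqT m else 1.
Fixpoint seqE n : F :=
  if n is m.+1 then (1 - u ^+ 4) * seqL n + u ^+ 4 * seqE m else 1.
Fixpoint seqX n : F :=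
  if n is m.+1 then t ^+ n * (seqT n - u ^+ 4 * seqT (n - 2)) + u ^+ 4 * seqX m
  else 1.
(** The terms of [sumS_rec] at remaining level n+1 that do not involve [sumS], with [sumY] expanded
    by [sumY_rec]. The truncation in [n - 1] is right: the sums no longer change once
    [pi ^+ i = 0]. *)
Definition seqH n : F :=
  (1 - u ^+ 4) * t ^+ n.+1 * (seqX n.+1 +
     u ^+ 4 * ((1 - u) * t ^+ n.+1 * seqL n + u * seqX n))
  + u ^+ 8 * ((1 - u) * t ^+ (2 * n.+1) * seqE (n - 1)).
Fixpoint seqS n : F :=
  if n is m.+1 then seqH m + u ^+ 9 * seqS m else 1.

Hypotheses (u0 : u != 0) (t0 : t != 0).
Hypotheses (tu : t - u != 0) (tu3 : t - u ^+ 3 != 0) (tu4 : t - u ^+ 4 != 0).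
Hypothesis (u31 : 1 - u ^+ 3 != 0).

(** Undetermined coefficients of the closed forms below. The term linear in n in [seqT] is a
    resonance: [u ^+ n] occurs in the forcing term and also solves the homogeneous recurrence. It
    passes to [seqX] through [x3] and to [seqH] through [h2']. *)
Let cA := (1 - u) * t / (t - u).
Let cB := 1 - cA.
Let cF := (1 - u ^+ 4) * cA * t / (t - u ^+ 4).
Let cG := (1 - u ^+ 4) * cB / (1 - u ^+ 3).
Let cH := 1 - cF - cG.
Let c2 := (1 - cA ^+ 2) * (1 - u ^+ 2) + 2 * u ^+ 2 * (1 - u) * cB.
Let c3 := (1 - u) * cB * (1 - u ^+ 2).
Let x3 := c3 * t / (t - u ^+ 3).
Let x2 := (c2 * t - u ^+ 3 * x3) / (t - u ^+ 3).
Let x4 := 1 - cA ^+ 2 - x2.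
Let h1 := (1 - u ^+ 4) * (cA ^+ 2 + u ^+ 4 * ((1 - u) * cA / t + u * cA ^+ 2 / t ^+ 2))
          + u ^+ 8 * (1 - u) * cF / t ^+ 2.
Let h2 := (1 - u ^+ 4) * (x2 + u ^+ 4 * ((1 - u) * cB / u + (x2 - x3) / t))
          + u ^+ 6 * (1 - u) * cG.
Let h2' := (1 - u ^+ 4) * x3 * (1 + u ^+ 4 / t).
Let h3 := (1 - u ^+ 4) * (1 + u) * x4.
Let h4 := (1 - u) * cH.

Lemma seqL_closed n : seqL n = cA * t ^+ n + cB * u ^+ n.
Proof.
elim: n => [|n IHn]; first by rewrite /= /cB; ring.
rewrite /= IHn !exprS; set T := t ^+ n; set U := u ^+ n.
by rewrite /cB /cA; field.
Qed.

Lemma seqT_closed n :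
  seqT n = cA ^+ 2 * t ^+ n + (1 - cA ^+ 2 + (1 - u) * cB * n%:R) * u ^+ n.
Proof.
elim: n => [|n IHn]; first by rewrite /=; ring.
rewrite [LHS]/= -/(seqL n.+1) IHn seqL_closed !exprS -natr1.
set T := t ^+ n; set U := u ^+ n; set M := n%:R.
by rewrite /cB /cA; field.
Qed.

(* At n = 0 the truncated index n - 1 is 0 instead of -1; the closed form takes *)
(* the value 1 at both. *)
Lemma seqT_closed2 n : seqT (n - 1) = cA ^+ 2 * t ^+ n / t
  + (1 - cA ^+ 2 + (1 - u) * cB * (n%:R - 1)) * u ^+ n / u.
Proof.
case: n => [|n].
  by rewrite /= /cB /cA; field; apply/and3P.
rewrite subn1 seqT_closed !exprS -natr1.
set T := t ^+ n; set U := u ^+ n; set M := n%:R.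
by rewrite /cB /cA; field; apply/and3P.
Qed.

Lemma seqE_closed n : seqE n = cF * t ^+ n + cG * u ^+ n + cH * (u ^+ n) ^+ 4.
Proof.
elim: n => [|n IHn]; first by rewrite /= /cH; ring.
rewrite [LHS]/= -/(seqL n.+1) IHn seqL_closed !exprS.
set T := t ^+ n; set U := u ^+ n.
by rewrite /cH /cF /cG /cB; field; apply/andP.
Qed.

(** As for [seqT_closed2], the closed form is 1 at -1 as well as at 0, which absorbs the truncation
    at n = 0. *)
Lemma seqE_closed1 n : seqE (n - 1) =
  cF * t ^+ n / t + cG * u ^+ n / u + cH * (u ^+ n) ^+ 4 / u ^+ 4.
Proof.
case: n => [|n].
  by rewrite /= /cH /cF /cG /cB /cA; field; apply/and5P.
rewrite subn1 seqE_closed !exprS.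
by field; apply/andP.
Qed.

Lemma seqX_closed n : seqX n =
  cA ^+ 2 * (t ^+ n) ^+ 2 + (x2 + x3 * n%:R) * t ^+ n * u ^+ n + x4 * (u ^+ n) ^+ 4.
Proof.
elim: n => [|n IHn]; first by rewrite /= /x4; ring.
rewrite [LHS]/= -/(seqT n.+1) IHn subSS seqT_closed2 seqT_closed !exprS -natr1.
set T := t ^+ n; set U := u ^+ n; set M := n%:R.
rewrite /x4 /x2 /x3 /c2 /c3 /cB; set A := cA.
by field; apply/and3P.
Qed.

Lemma seqH_closed n : seqH n = h1 * (t ^+ n.+1) ^+ 3
  + (h2 + h2' * n.+1%:R) * (t ^+ n.+1) ^+ 2 * u ^+ n.+1
  + h3 * t ^+ n.+1 * (u ^+ n.+1) ^+ 4 + h4 * (t ^+ n.+1) ^+ 2 * (u ^+ n.+1) ^+ 4.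
Proof.
rewrite /seqH !seqX_closed seqE_closed1 seqL_closed mulnC exprM !exprS -natr1.
set T := t ^+ n; set U := u ^+ n; set M := n%:R.
rewrite /h1 /h2 /h2' /h3 /h4.
generalize cA cB cF cG cH x2 x3 x4 => A B F' G H X2 X3 X4.
by field; apply/andP.
Qed.

Let q := u^-1.
(** The ratios q^9 t^3, q^9 t^2 u, q^9 t u^4 and q^9 t^2 u^4 of the terms of [seqH_closed], after
    scaling by [q ^+ (9 * n)]. *)
Let r1 := q ^+ 9 * t ^+ 3.
Let r2 := q ^+ 8 * t ^+ 2.
Let r3 := q ^+ 5 * t.
Let r4 := q ^+ 5 * t ^+ 2.

Definition zeta_value (q t : F) : F :=
  ((1 - t) * (1 + q ^+ 3 * t) * (1 - q ^+ 2 * t) *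
       (q ^+ 8 * t ^+ 3 - q ^+ 7 * t ^+ 2 + q ^+ 6 * t ^+ 2 - q ^+ 5 * t ^+ 2
        - q ^+ 3 * t + q ^+ 2 * t - q * t + 1))
      / ((1 - q ^+ 5 * t) * (1 - q ^+ 5 * t ^+ 2) * (1 - q ^+ 4 * t)
         * (1 - q ^+ 8 * t ^+ 2)).

Hypotheses (r1n : 1 - r1 != 0) (r2n : 1 - r2 != 0) (r3n : 1 - r3 != 0).
Hypotheses (r4n : 1 - r4 != 0) (r5n : 1 - q ^+ 4 * t != 0).

(** The right-hand side is the formal sum of all increments [q ^+ (9 * n.+1) * seqH n], plus the
    initial 1. In the total the denominators [1 - r1], [t - u], [t - u ^+ 3], [t - u ^+ 4] and one
    factor [1 + q ^+ 4 * t] of [(1 - r2) ^+ 2] cancel. *)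
Lemma zeta_value_sum : zeta_value q t =
  1 + h1 * r1 / (1 - r1) + h2 * r2 / (1 - r2) + h2' * r2 / (1 - r2) ^+ 2
  + h3 * r3 / (1 - r3) + h4 * r4 / (1 - r4).
Proof.
move: r1n r2n r3n r4n r5n; rewrite /r1 /r2 /r3 /r4.
have [Q QE] : exists Q, Q = q by exists q.
rewrite -QE => e1 e2 e3 e4 e5.
have q0 : Q != 0 by rewrite QE invr_eq0.
have uE : u = Q^-1 by rewrite QE invrK.
have scaled k (x y : F) : y != 0 -> y = Q^-1 ^+ k * x -> x != 0.
  by move=> y0 yE; apply: contra y0 => /eqP x0; rewrite yE x0 mulr0.
have d1 : Q * t - 1 != 0 by apply: (scaled 1%N) tu _; rewrite uE; field.
have d3 : Q ^+ 3 * t - 1 != 0 by apply: (scaled 3%N) tu3 _; rewrite uE; field.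
have d4 : Q ^+ 4 * t - 1 != 0 by apply: (scaled 4%N) tu4 _; rewrite uE; field.
have d5 : Q ^+ 3 - 1 != 0 by apply: (scaled 3%N) u31 _; rewrite uE; field.
rewrite /zeta_value /h1 /h2 /h2' /h3 /h4 /x4 /x2 /x3 /c2 /c3 /cH /cG /cF /cB /cA uE.
field.
by rewrite ![t * _]mulrC t0 q0 d1 d3 d4 d5 e1 e2 e3 e4 e5.
Qed.

Lemma seqS_closed n : q ^+ (9 * n) * seqS n = zeta_value q t -
  (h1 * r1 / (1 - r1) * r1 ^+ n + h2 * r2 / (1 - r2) * r2 ^+ n
   + h2' * r2 / (1 - r2) ^+ 2 * ((n%:R * (1 - r2) + 1) * r2 ^+ n)
   + h3 * r3 / (1 - r3) * r3 ^+ n + h4 * r4 / (1 - r4) * r4 ^+ n).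
Proof.
have qu : q * u = 1 by rewrite mulVf.
elim: n => [|n IHn].
  rewrite zeta_value_sum /=; field.
  by rewrite r1n r2n r3n r4n.
have E1 : q ^+ (9 * n.+1) * (t ^+ n.+1) ^+ 3 = r1 ^+ n.+1.
  by rewrite /r1 exprMn -!exprM [(3 * _)%N]mulnC.
have E2 : q ^+ (9 * n.+1) * ((t ^+ n.+1) ^+ 2 * u ^+ n.+1) = r2 ^+ n.+1.
  rewrite /r2 exprMn -!exprM [(2 * _)%N]mulnC mulrCA mulrC; congr (_ * _).
  by rewrite mulSn exprD mulrAC -exprMn qu expr1n mul1r.
have E3 : q ^+ (9 * n.+1) * (t ^+ n.+1 * (u ^+ n.+1) ^+ 4) = r3 ^+ n.+1.
  rewrite /r3 exprMn -!exprM [(n.+1 * 4)%N]mulnC mulrCA mulrC; congr (_ * _).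
  by rewrite -[9%N]/(4 + 5)%N mulnDl exprD mulrAC -exprMn qu expr1n mul1r.
have E4 : q ^+ (9 * n.+1) * ((t ^+ n.+1) ^+ 2 * (u ^+ n.+1) ^+ 4) = r4 ^+ n.+1.
  rewrite /r4 exprMn -!exprM [(2 * _)%N]mulnC [(n.+1 * 4)%N]mulnC mulrCA mulrC; congr (_ * _).
  by rewrite -[9%N]/(4 + 5)%N mulnDl exprD mulrAC -exprMn qu expr1n mul1r.
have step : q ^+ (9 * n.+1) * seqS n.+1 = q ^+ (9 * n.+1) * seqH n + q ^+ (9 * n) * seqS n.
  rewrite /= mulrDr mulnS exprD; congr (_ + _).
  by rewrite [q ^+ 9 * _]mulrC -mulrA [X in _ * X]mulrA -exprMn qu expr1n mul1r.
rewrite step IHn seqH_closed.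
rewrite (_ : q ^+ (9 * n.+1) * _ =
   h1 * (q ^+ (9 * n.+1) * (t ^+ n.+1) ^+ 3)
   + (h2 + h2' * n.+1%:R) * (q ^+ (9 * n.+1) * ((t ^+ n.+1) ^+ 2 * u ^+ n.+1))
   + h3 * (q ^+ (9 * n.+1) * (t ^+ n.+1 * (u ^+ n.+1) ^+ 4))
   + h4 * (q ^+ (9 * n.+1) * ((t ^+ n.+1) ^+ 2 * (u ^+ n.+1) ^+ 4))); last by ring.
rewrite E1 E2 E3 E4 -natr1 !exprS.
move: r1n r2n r3n r4n; generalize (zeta_value q t) h1 h2 h2' h3 h4 r1 r2 r3 r4.
move=> z H1 H2 H2' H3 H4 R1 R2 R3 R4 n1 n2 n3 n4.
set M := n%:R; set T1 := R1 ^+ n; set T2 := R2 ^+ n; set T3 := R3 ^+ n; set T4 := R4 ^+ n.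
by field; rewrite n1 n2 n3 n4.
Qed.

(** The bound 1/4 on the ratios, rather than 1/2, absorbs the linear factor: n / 4^n is at most 1 /
    2^n. *)
Lemma seqS_bound : `|r1| <= 4^-1 -> `|r2| <= 4^-1 -> `|r3| <= 4^-1 -> `|r4| <= 4^-1 ->
  exists C, forall n, `|q ^+ (9 * n) * seqS n - zeta_value q t| <= C * 2^-1 ^+ n.
Proof.
move=> b1 b2 b3 b4.
have half (r : F) n : `|r| <= 4^-1 -> `|r ^+ n| <= 2^-1 ^+ n.
  move=> br; rewrite normrX; apply: lerXn2r; rewrite ?nnegrE ?invr_ge0 ?ler0n //.
  by apply: le_trans br _; rewrite lef_pV2 ?posrE ?ltr0n // ler_nat.
have nhalf n : `|n%:R * r2 ^+ n| <= 2^-1 ^+ n.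
  rewrite normrM normrX normr_nat; apply: (@le_trans _ _ (2 ^+ n * 4^-1 ^+ n)).
    apply: ler_pM; rewrite ?ler0n ?exprn_ge0 //.
      by rewrite -natrX ler_nat ltnW // ltn_expl.
    by apply: lerXn2r; rewrite ?nnegrE ?invr_ge0 ?ler0n.
  by rewrite -exprMn (_ : 2 * 4^-1 = 2^-1) //; field.
exists (`|h1 * r1 / (1 - r1)| + `|h2 * r2 / (1 - r2)|
   + `|h2' * r2 / (1 - r2) ^+ 2| * (`|1 - r2| + 1)
   + `|h3 * r3 / (1 - r3)| + `|h4 * r4 / (1 - r4)|) => n.
rewrite seqS_closed [X in `|X|]addrC addKr normrN.
generalize (h1 * r1 / (1 - r1)) (h2 * r2 / (1 - r2)) (h2' * r2 / (1 - r2) ^+ 2)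
  (h3 * r3 / (1 - r3)) (h4 * r4 / (1 - r4)) => k1 k2 k2' k3 k4; rewrite !mulrDl.
have term (c x : F) : `|x| <= 2^-1 ^+ n -> `|c * x| <= `|c| * 2^-1 ^+ n.
  by move=> bx; rewrite normrM ler_wpM2l.
apply: le_trans (ler_normD _ _) _; apply: lerD; last by apply: term; apply: half.
apply: le_trans (ler_normD _ _) _; apply: lerD; last by apply: term; apply: half.
apply: le_trans (ler_normD _ _) _; apply: lerD; last first.
  rewrite -[leRHS]mulrA normrM; apply: ler_wpM2l => //.
  rewrite ?mulrDl !mul1r mulrAC [_ * (1 - r2)]mulrC.
  apply: le_trans (ler_normD _ _) _; apply: lerD; last exact: half.
  exact: term.
apply: le_trans (ler_normD _ _) _; apply: lerD; by apply: term; apply: half.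
Qed.

End Sequences.

(** * Identification of the sums with the sequences *)

Section Link.
Variables (A : finComNzRingType) (pi : A) (N : nat).
Hypothesis chA : chain_ring pi N.
Variables (F : numFieldType) (t : F).
Local Notation q := #|ann pi|.
Local Notation u := ((q%:R : F)^-1).
Local Notation a := (#|A|%:R : F).
Local Notation len := (len pi N).

(** The recurrences express level i through i+1 and i+2, and the sums are trivial for i at least N,
    where [pi ^+ i = 0]. *)
Lemma descending_ind (P : nat -> Prop) :
  (forall i, (N <= i)%N -> P i) -> (forall i, (i < N)%N -> (forall j, (i < j)%N -> P j) -> P i) ->
  forall i, P i.
Proof.
move=> P0 PS; suff H k : forall i, (N - i <= k)%N -> P i by move=> i; exact: (H (N - i)%N).
elim: k => [|k IHk] i ki; first by apply: P0; lia.
have [iN|Ni] := ltnP i N; last exact: P0.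
by apply: PS => // j ij; apply: IHk; lia.
Qed.

Lemma chain_pow_ge i : (N <= i)%N -> pi ^+ i = 0.
Proof. by rewrite -(chain_pow_eq0 chA) => /eqP. Qed.

Lemma len0 : len 0 = 0%N.
Proof. by rewrite -(chain_pow_ge (leqnn N)) len_pi // subnn. Qed.

Lemma sum_const (c : F) (T : finType) : \sum_(x : T) c = #|T|%:R * c.
Proof. by rewrite sumr_const -[c *+ _]mulr_natl. Qed.

Lemma sumL_seq i : sumL pi N t i = a * seqL u t (N - i).
Proof.
move: i; apply: descending_ind => [i Ni|i iN IH].
  rewrite /sumL (eqP (_ : (N - i == 0)%N)) // chain_pow_ge //.
  by under eq_bigr do rewrite mul0r len0 expr0; rewrite sum_const.
by rewrite (sumL_rec chA) IH // -(subnSK iN) /=; ring.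
Qed.

Lemma sumT_seq i : sumT pi N t i = a ^+ 2 * seqT u t (N - i).
Proof.
move: i; apply: descending_ind => [i Ni|i iN IH].
  rewrite /sumT (eqP (_ : (N - i == 0)%N)) // chain_pow_ge //.
  by under eq_bigr do under eq_bigr do rewrite mul0r len0 expr0; rewrite !sum_const mulrA.
by rewrite (sumT_rec chA) IH // sumL_seq -(subnSK iN) /=; ring.
Qed.

Lemma sumE_seq i : sumE pi N t i = a ^+ 8 * seqE u t (N - i).
Proof.
move: i; apply: descending_ind => [i Ni|i iN IH].
  rewrite /sumE (eqP (_ : (N - i == 0)%N)) // chain_pow_ge //.
  under eq_bigr do under eq_bigr do rewrite mul0r len0 expr0.
  by rewrite !sum_const !card_prod !natrM /=; ring.
by rewrite (sumE_rec chA) IH // sumL_seq -(subnSK iN) /=; ring.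
Qed.

Lemma sumX_seq i : sumX pi N t i = a ^+ 4 * seqX u t (N - i).
Proof.
move: i; apply: descending_ind => [i Ni|i iN IH].
  rewrite /sumX (eqP (_ : (N - i == 0)%N)) // chain_pow_ge //.
  transitivity (\sum_(v : quad A) (1 : F)); last by rewrite sum_const !card_prod !natrM /=; ring.
  apply: eq_bigr => v _; rewrite qscale0 -(qscale0 (1, 0, 0, 0)) -(chain_pow_ge (leqnn N)).
  rewrite (len4_primitive chA) ?subnn ?chain_pow_ge ?mul0r ?len0 ?expr0 //.
  by apply/orP; left; apply/existsP; exists 1; rewrite mulr1.
rewrite (sumX_rec chA) IH // !sumT_seq (_ : N - i.+2 = N - i - 2)%N; last by lia.
by rewrite -(subnSK iN) /= -/(seqT _ _ _); ring.
Qed.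

Lemma sumS_seq i : sumS pi N t i = a ^+ 9 * seqS u t (N - i).
Proof.
move: i; apply: descending_ind => [i Ni|i iN IH].
  rewrite /sumS (eqP (_ : (N - i == 0)%N)) // chain_pow_ge //.
  transitivity (\sum_(y : A) \sum_(v : quad A) \sum_(w : quad A) (1 : F)); last first.
    by rewrite !sum_const !card_prod !natrM /=; ring.
  do 3![apply: eq_bigr => ? _]; rewrite mul0r !qscale0.
  (* The zero triple is rewritten as [pi ^+ N] times one with y = 1, so that [dim_len_invertible]
     applies. *)
  rewrite -(qscale0 0) -[X in dim_len _ _ X](mul0r 1) -(chain_pow_ge (leqnn N)).
  rewrite dim_len_invertible // ?subnn ?chain_pow_ge ?mul0r ?len0 ?expr0 //.
  by apply/existsP; exists 1; rewrite mulr1.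
rewrite (sumS_rec chA) (sumY_rec chA) IH // sumE_seq !sumX_seq sumL_seq.
rewrite (_ : N - i.+2 = N - i.+1 - 1)%N; last by lia.
rewrite -(subnSK iN); set n := (N - i.+1)%N.
by rewrite [seqS _ _ _.+1]/= /seqH; ring.
Qed.

Lemma sumS0 : sumS pi N t 0 = (q%:R) ^+ (9 * N) * seqS u t N.
Proof. by rewrite sumS_seq subn0 (card_chain chA) natrX -exprM mulnC. Qed.

End Link.

(** * Representations of finite groups of class two *)

Section CentralExtension.
Variables (U : finZmodType) (V : zmodType) (c : U -> U -> V).
Hypothesis cDl : forall u v w, c (u + v) w = c u w + c v w.
Hypothesis cDr : forall u v w, c u (v + w) = c u v + c u w.
Variable C : numClosedFieldType.

Definition ext_mul (g h : U * V) : U * V := (g.1 + h.1, g.2 + h.2 + c g.1 h.1).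

Definition ext_rep k (rho : U * V -> 'M[C]_k) :=
  rho (0, 0) = 1%:M /\ forall g h, rho (ext_mul g h) = rho g *m rho h.

Definition ext_irr k (rho : U * V -> 'M[C]_k) :=
  [/\ (0 < k)%N, ext_rep rho & forall W : 'M[C]_k,
      (forall g, stablemx W (rho g)) -> W != 0 -> row_full W].

Definition unit_char (W : zmodType) (psi : W -> C) :=
  psi 0 = 1 /\ forall z w, psi (z + w) = psi z * psi w.

Lemma unit_char_neq0 (W : zmodType) (psi : W -> C) z : unit_char psi -> psi z != 0.
Proof.
case=> p0 pD; apply/eqP => pz; have := oner_neq0 C.
by rewrite -p0 -(subrr z) pD pz mul0r eqxx.
Qed.

Lemma unit_charN (W : zmodType) (psi : W -> C) z : unit_char psi -> psi (- z) = (psi z)^-1.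
Proof.
move=> pc; apply: (mulfI (unit_char_neq0 z pc)).
by rewrite divff ?unit_char_neq0 //; case: pc => p0 pD; rewrite -pD subrr.
Qed.

Let c0l u : c 0 u = 0.
Proof. by apply: (addrI (c 0 u)); rewrite -cDl !addr0. Qed.
Let c0r u : c u 0 = 0.
Proof. by apply: (addrI (c u 0)); rewrite -cDr !addr0. Qed.
Let cNr u v : c u (- v) = - c u v.
Proof. by apply/eqP; rewrite -addr_eq0 -cDr addNr c0r. Qed.

Definition ext_inv (g : U * V) : U * V := (- g.1, - g.2 + c g.1 g.1).

Lemma ext_mulV g : ext_mul g (ext_inv g) = (0, 0).
Proof. by rewrite /ext_mul /= cNr subrr addrA addrK subrr. Qed.

Lemma ext_rep_mulV k (rho : U * V -> 'M[C]_k) g : ext_rep rho ->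
  rho g *m rho (ext_inv g) = 1%:M.
Proof. by case=> r1 rM; rewrite -rM ext_mulV. Qed.

Lemma ext_rep_Vmul k (rho : U * V -> 'M[C]_k) g : ext_rep rho ->
  rho (ext_inv g) *m rho g = 1%:M.
Proof. by move=> /(ext_rep_mulV g)/mulmx1C. Qed.

Lemma schur_scalar k (rho : U * V -> 'M[C]_k) (M : 'M[C]_k) : ext_irr rho ->
  (forall g, M *m rho g = rho g *m M) -> exists a, M = a%:M.
Proof.
case=> k0 rr ir cM; have [a ea] := eigenvalue_closed M k0; exists a.
have /row_fullP[B BE] : row_full (eigenspace M a).
  by apply: ir => // g; apply: comm_mx_stable_eigenspace; apply: cM.
have /eigenspaceP : (1%:M <= eigenspace M a)%MS by rewrite -BE submxMl.
by rewrite mul1mx scalemx1.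
Qed.

Lemma central_char k (rho : U * V -> 'M[C]_k) : ext_irr rho ->
  exists psi, unit_char psi /\ forall z, rho (0, z) = (psi z)%:M.
Proof.
move=> ir; have [k0 [r1 rM] _] := ir.
have /choice[psi psiE] z : exists a, rho (0, z) = a%:M.
  apply: schur_scalar ir _ => -[u w]; rewrite -!rM /ext_mul /=.
  by rewrite c0l c0r add0r !addr0 addrC.
have inj a b : a%:M = b%:M :> 'M[C]_k -> a = b.
  by move=> /matrixP/(_ (Ordinal k0) (Ordinal k0)); rewrite !mxE eqxx.
exists psi; split=> //; split=> [|z w]; apply: inj; first by rewrite -psiE.
rewrite scalar_mxM -!psiE -rM /ext_mul /=; congr (rho (_, _)); first by rewrite addr0.
by rewrite c0l addr0.
Qed.

Definition radical (psi : V -> C) : {set U} :=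
  [set u | [forall v, psi (c u v - c v u) == 1]].

Lemma ext_rep_split k (rho : U * V -> 'M[C]_k) psi u z : ext_rep rho ->
  (forall z, rho (0, z) = (psi z)%:M) -> rho (u, z) = psi z *: rho (u, 0).
Proof.
case=> _ rM pE; rewrite -mul_scalar_mx -pE -rM /ext_mul /=.
by rewrite c0l !addr0 add0r.
Qed.

(* By Schur's lemma, averaging the matrices E_ij over the group gives *)
(* [sum_u tr (r u) tr (r u)^-1 = #|U|]; off the radical the traces vanish. *)
Lemma rep_dim k (rho : U * V -> 'M[C]_k) psi : ext_irr rho -> unit_char psi ->
  (forall z, rho (0, z) = (psi z)%:M) -> (k ^ 2 * #|radical psi| = #|U|)%N.
Proof.
move=> ir pc pE; have [k0 rr _] := ir; have [r1 rM] := rr.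
pose r u := rho (u, 0); pose ri u := rho (ext_inv (u, 0)).
have rri u : r u *m ri u = 1%:M by exact: ext_rep_mulV.
have rir u : ri u *m r u = 1%:M by exact: ext_rep_Vmul.
have rD u v : r u *m r v = psi (c u v) *: r (u + v).
  rewrite -rM /ext_mul /= !add0r; exact: ext_rep_split.
have k0C : k%:R != 0 :> C by rewrite pnatr_eq0 -lt0n.
have avg X : exists a, \sum_u r u *m X *m ri u = a%:M.
  apply: schur_scalar ir _ => -[v w].
  rewrite (ext_rep_split _ _ rr pE) -scalemxAl -scalemxAr; congr (_ *: _).
  suff E : r v *m (\sum_u r u *m X *m ri u) *m ri v = \sum_u r u *m X *m ri u.
    by rewrite -/(r v) -{1}E -!mulmxA rir mulmx1.
  rewrite mulmx_sumr mulmx_suml [RHS](reindex_inj (addrI v)) /=.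
  apply: eq_bigr => u _.
  have pn := unit_char_neq0 (c v u) pc.
  have rE : r (v + u) = (psi (c v u))^-1 *: (r v *m r u).
    by rewrite rD scalerA mulVf ?scale1r.
  have riE : ri (v + u) = psi (c v u) *: (ri u *m ri v).
    rewrite -[LHS]mulmx1 -{1}(rri v) -[r v]mulmx1 -(rri u).
    rewrite !mulmxA -[ri (v + u) *m r v *m r u]mulmxA rD -scalemxAr rir.
    by rewrite -!scalemxAl mul1mx.
  rewrite rE riE -!scalemxAl -!scalemxAr scalerA mulVf // scale1r.
  by rewrite !mulmxA.
have tr_delta i j : \tr (delta_mx i j : 'M[C]_k) = (i == j)%:R.
  rewrite /mxtrace (bigD1 i) //= big1 ?addr0 ?mxE ?eqxx // => l li.
  by rewrite mxE (negPf li).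
have avgE X : \sum_u r u *m X *m ri u = (#|U|%:R * \tr X / k%:R)%:M.
  have [a aE] := avg X; rewrite aE; congr _%:M.
  apply: (mulIf k0C); rewrite divfK // mulr_natr -mxtrace_scalar -aE raddf_sum /=.
  rewrite (eq_bigr (fun=> \tr X)) ?sumr_const -?[LHS]mulr_natl // => u _.
  by rewrite mxtrace_mulC mulmxA rir mul1mx.
(* Take the (i, j) entry of the average of [delta_mx i j] and sum over i and j; the average is a
   scalar matrix, so only i = j contributes. *)
have trE : \sum_u \tr (r u) * \tr (ri u) = #|U|%:R.
  transitivity (\sum_i \sum_j (\sum_u r u *m delta_mx i j *m ri u) i j).
    under [RHS]eq_bigr do under eq_bigr do rewrite summxE.
    under [RHS]eq_bigr do rewrite exchange_big /=.
    rewrite [RHS]exchange_big /=; apply: eq_bigr => u _.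
    rewrite mulr_suml; apply: eq_bigr => i _; rewrite mulr_sumr.
    apply: eq_bigr => j _; rewrite -mulmxA mxE (bigD1 i) //= big1 ?addr0.
      rewrite mxE (bigD1 j) //= big1 ?addr0 ?mxE ?eqxx ?mul1r //.
      by move=> l lj; rewrite mxE (negPf lj) andbF mul0r.
    move=> l li; rewrite mxE big1 ?mulr0 // => l' _.
    by rewrite mxE (negPf li) mul0r.
  transitivity (\sum_(i < k) (#|U|%:R / k%:R : C)).
    apply: eq_bigr => i _; under eq_bigr do rewrite avgE mxE tr_delta.
    rewrite (bigD1 i) //= big1 ?addr0 ?eqxx ?mulr1 // => j ji.
    by rewrite [i == j]eq_sym (negPf ji).
  by rewrite sumr_const card_ord -[_ *+ k]mulr_natr divfK.
have tr0 u : u \notin radical psi -> \tr (r u) = 0.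
  rewrite inE => /forallPn[v]; apply: contraNeq => tru.
  have conjE : r v *m r u *m ri v = psi (c v u - c u v) *: r u.
    have -> : r v *m r u = psi (c v u - c u v) *: (r u *m r v).
      by case: (pc) => _ pD; rewrite !rD scalerA -pD subrK [u + v]addrC.
    by rewrite -scalemxAl -mulmxA rri mulmx1.
  have /eqP := congr1 mxtrace conjE; rewrite mxtrace_mulC mulmxA rir mul1mx mxtraceZ.
  rewrite -{1}[\tr (r u)]mul1r (inj_eq (mulIf tru)) => /eqP E.
  by rewrite -opprB unit_charN // -E invr1.
have trk u : u \in radical psi -> \tr (r u) * \tr (ri u) = (k ^ 2)%:R.
  rewrite inE => /forallP uR.
  have [a aE] : exists a, r u = a%:M.
    apply: schur_scalar ir _ => -[v w].
    rewrite (ext_rep_split _ _ rr pE) -scalemxAl -scalemxAr; congr (_ *: _).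
    rewrite -/(r v) !rD addrC; congr (_ *: _).
    have /eqP E := uR v; case: (pc) => _ pD.
    by rewrite -[c u v](subrK (c v u)) pD E mul1r.
  have aV : a *: ri u = 1%:M by rewrite -mul_scalar_mx -aE rri.
  rewrite aE mxtrace_scalar -[a *+ k]mulr_natl -mulrA -mxtraceZ aV mxtrace1.
  by rewrite -natrM mulnn.
apply/eqP; rewrite -(eqr_nat C) -trE (bigID (mem (radical psi))) /=.
rewrite [X in _ == _ + X]big1 ?addr0 => [|u /tr0 ->]; last by rewrite mul0r.
by rewrite (eq_bigr (fun=> (k ^ 2)%:R)) // sumr_const -[X in _ == X]mulr_natr -natrM.
Qed.

Lemma ext_rep_cocycle k (rho : U * V -> 'M[C]_k) psi u v : ext_rep rho ->
  (forall z, rho (0, z) = (psi z)%:M) ->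
  rho (u, 0) *m rho (v, 0) = psi (c u v) *: rho (u + v, 0).
Proof.
move=> rr pE; case: (rr) => _ rM; rewrite -rM /ext_mul /= !add0r.
exact: ext_rep_split.
Qed.

Lemma ext_rep_cocycleV k (rho : U * V -> 'M[C]_k) psi u v : ext_rep rho ->
  (forall z, rho (0, z) = (psi z)%:M) ->
  rho (ext_inv (u + v, 0)) = psi (c u v) *: (rho (ext_inv (v, 0)) *m rho (ext_inv (u, 0))).
Proof.
move=> rr pE; rewrite -[LHS]mulmx1 -{1}(ext_rep_mulV (u, 0) rr).
rewrite -[rho (u, 0)]mulmx1 -(ext_rep_mulV (v, 0) rr) (mulmxA (rho (u, 0))).
rewrite (ext_rep_cocycle _ _ rr pE) -!scalemxAl -scalemxAr !mulmxA.
by rewrite ext_rep_Vmul // mul1mx.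
Qed.

(* The group acts on matrices through the commutative quotient [U] by *)
(* [X |-> rho X sigma^-1]; a common eigenvector is an intertwiner up to twist. *)
Lemma same_central_twist k (rho sigma : U * V -> 'M[C]_k) psi :
    ext_irr rho -> ext_irr sigma -> unit_char psi ->
    (forall z, rho (0, z) = (psi z)%:M) -> (forall z, sigma (0, z) = (psi z)%:M) ->
  exists chi : U * V -> C, exists B : 'M[C]_k,
    [/\ chi (0, 0) = 1, forall g h, chi (ext_mul g h) = chi g * chi h, B \in unitmx &
        forall g, rho g *m B = B *m (chi g *: sigma g)].
Proof.
move=> ri si pc pE sE; have [k0 rr rirr] := ri; have [_ sr _] := si.
pose act u : 'M[C]_(k * k) :=
  lin_mulmx (rho (u, 0)) *m lin_mulmxr (sigma (ext_inv (u, 0))).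
have actE u X : mxvec X *m act u = mxvec (rho (u, 0) *m X *m sigma (ext_inv (u, 0))).
  by rewrite mulmxA !mul_vec_lin.
have actM u v : act u *m act v = act (v + u).
  apply/row_matrixP => i; rewrite !rowE -[delta_mx 0 i]vec_mxK.
  move: (vec_mx _) => X; rewrite mulmxA !actE !mulmxA; congr mxvec.
  rewrite (ext_rep_cocycle _ _ rr pE) (ext_rep_cocycleV _ _ sr sE).
  by rewrite -!scalemxAl -scalemxAr !mulmxA.
have kk0 : (0 < k * k)%N by rewrite muln_gt0 k0.
have [|v v0 /allP vs] := @common_eigenvector C _ [seq act u | u <- enum U] kk0.
  by move=> _ _ /mapP[u _ ->] /mapP[w _ ->]; rewrite /comm_mx !actM addrC.
pose X := vec_mx v; have X0 : X != 0.
  by apply: contra v0 => /eqP X0; rewrite -[v]vec_mxK -/X X0 linear0.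
have /choice[chi chiE] u : exists a, rho (u, 0) *m X = a *: (X *m sigma (u, 0)).
  have /sub_rVP[a aE] : (v *m act u <= v)%MS by apply: (vs (act u)); rewrite map_f ?mem_enum.
  exists a; rewrite scalemxAl.
  have <- : rho (u, 0) *m X *m sigma (ext_inv (u, 0)) = a *: X.
    by apply: (can_inj mxvecK); rewrite -actE vec_mxK aE linearZ /= vec_mxK.
  by rewrite -[RHS]mulmxA ext_rep_Vmul // mulmx1.
have twE g : rho g *m X = X *m (chi g.1 *: sigma g).
  case: g => u z; rewrite (ext_rep_split _ _ rr pE) (ext_rep_split _ _ sr sE) /=.
  by rewrite -scalemxAl chiE -!scalemxAr scalerA mulrC -scalerA.
have Xu : X \in unitmx.
  rewrite -row_free_unit -kermx_eq0; apply: contraNT X0 => kX0.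
  have /row_fullP[D DE] : row_full (kermx X).
    apply: rirr => // g; apply/sub_kermxP.
    by rewrite -mulmxA twE mulmxA mulmx_ker mul0mx.
  by rewrite -[X]mul1mx -DE -mulmxA mulmx_ker mulmx0.
have sn g : X *m sigma g != 0.
  apply: contraNneq X0 => E; rewrite -[X]mulmx1 -(ext_rep_mulV g sr) mulmxA E.
  by rewrite mul0mx.
have inj a b g : a *: (X *m sigma g) = b *: (X *m sigma g) -> a = b.
  move/eqP; rewrite -subr_eq0 -scalerBl scaler_eq0 (negPf (sn g)) orbF subr_eq0.
  by move/eqP.
exists (fun g => chi g.1), X; split=> // [|g h].
  apply: (inj _ _ (0, 0)); rewrite scalemxAr -twE scale1r.
  by case: rr sr => -> _ [-> _]; rewrite mul1mx mulmx1.
apply: (inj _ _ (ext_mul g h)); rewrite scalemxAr -twE.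
case: (rr) => _ ->; case: (sr) => _ ->.
by rewrite -mulmxA twE mulmxA twE -!mulmxA -!scalemxAl -!scalemxAr scalerA.
Qed.

(** The regular representation of U twisted by psi has the right central character; a non-zero
    stable subspace of least rank in it is irreducible. *)
Lemma central_rep_exists psi : unit_char psi ->
  exists k (rho : U * V -> 'M[C]_k),
    ext_irr rho /\ forall z, rho (0, z) = (psi z)%:M.
Proof.
move=> pc; case: (pc) => p0 pD; pose n := #|U|.
pose reg (g : U * V) : 'M[C]_n := \matrix_(i, j)
  (psi (g.2 + c (enum_val i) g.1) *+ (enum_val j == enum_val i + g.1)).
have regM g h : reg (ext_mul g h) = reg g *m reg h.
  apply/matrixP => i j; rewrite !mxE.
  rewrite (bigD1 (enum_rank (enum_val i + g.1))) //= !mxE enum_rankK eqxx.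
  rewrite big1 ?addr0 => [|l li]; last first.
    rewrite !mxE (negPf (_ : enum_val l != _)) ?mulr0n ?mul0r //.
    by apply: contra li => /eqP <-; rewrite enum_valK.
  rewrite addrA mulrnAr -pD; congr (psi _ *+ _); rewrite cDr cDl.
  by rewrite !addrA [LHS](ACl (1*4*2*5*3)).
have reg0 z : reg (0, z) = (psi z)%:M.
  apply/matrixP => i j; rewrite !mxE c0r !addr0 (inj_eq enum_val_inj).
  by rewrite eq_sym.
pose stab (W : 'M[C]_n) := forall g, stablemx W (reg g).
have n0 : (0 < n)%N by rewrite /n; apply/card_gt0P; exists 0.
have ex : exists r, (0 < r)%N && `[< exists2 W, stab W & \rank W = r >].
  exists n; rewrite n0; apply/asboolP; exists 1%:M; last by rewrite mxrank1.
  by move=> g; apply: submx1.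
have [r /andP[r0 /asboolP[W Ws Wr]] rmin] := ex_minnP ex.
pose B := row_base W.
have Bf : row_free B := row_base_free W.
have Bs g : stablemx B (reg g) by rewrite stablemx_row_base.
pose rho g := conjmx B (reg g); exists (\rank W), rho.
have rho0 z : rho (0, z) = (psi z)%:M by rewrite /rho reg0 conjmx_scalar.
split=> //; split; first by rewrite Wr.
  split; first by rewrite rho0 p0.
  by move=> g h; rewrite /rho regM conjmxM ?inE ?Bs.
move=> W' W's W'0; rewrite /row_full eqn_leq rank_leq_row /=.
apply: (@leq_trans r); first by rewrite Wr.
rewrite -(mxrankMfree W' Bf); apply: rmin; rewrite mxrankMfree // lt0n mxrank_eq0 W'0 /=.
apply/asboolP; exists <<W' *m B>>%MS; last by rewrite mxrank_gen mxrankMfree.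
move=> g; rewrite genmxE (eqmxMr _ (genmxE _)).
by have := W's g; rewrite stablemx_restrict.
Qed.

End CentralExtension.

(** * Characters of finite chain rings *)

Section Characters.
Variable C : numClosedFieldType.

Lemma mulrn_card (G : finZmodType) (x : G) : x *+ #|G| = 0.
Proof. by have := expg_cardG (in_setT x); rewrite cardsT FinRing.zmodXgE. Qed.

(* A common eigenvector of the regular representation inside the image of *)
(* [reg s - 1] cannot be fixed by [s]. *)
Lemma exists_unit_char (G : finZmodType) (s : G) : s != 0 ->
  exists2 chi : G -> C, unit_char chi & chi s != 1.
Proof.
move=> s0; pose n := #|G|.
pose reg (g : G) : 'M[C]_n := \matrix_(i, j) (enum_val j == enum_val i + g)%:R.
have regD g h : reg (g + h) = reg g *m reg h.
  apply/matrixP => i j; rewrite !mxE.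
  rewrite (bigD1 (enum_rank (enum_val i + g))) //= !mxE enum_rankK eqxx mul1r addrA.
  rewrite big1 ?addr0 // => l li.
  rewrite !mxE (negPf (_ : enum_val l != _)) ?mul0r //.
  by apply: contra li => /eqP <-; rewrite enum_valK.
have reg0 : reg 0 = 1%:M.
  by apply/matrixP => i j; rewrite !mxE addr0 (inj_eq enum_val_inj) eq_sym.
have regC g h : comm_mx (reg g) (reg h) by rewrite /comm_mx -!regD addrC.
pose D := reg s - 1%:M.
have D0 : D != 0.
  rewrite subr_eq0; apply/eqP => /matrixP/(_ (enum_rank 0) (enum_rank s)).
  rewrite !mxE !enum_rankK add0r eqxx (inj_eq enum_rank_inj) eq_sym (negPf s0).
  by move/eqP; rewrite oner_eq0.
have DC g : comm_mx D (reg g).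
  by rewrite /comm_mx mulmxBl mulmxBr mul1mx mulmx1 -!regD [s + g]addrC.
have Ds g : stablemx D (reg g) by rewrite DC submxMl.
have Dr : (0 < \rank D)%N by rewrite lt0n mxrank_eq0.
have [|v' v'0 /allP vs] :=
    @common_eigenvector C _ [seq restrictmx D (reg g) | g <- enum G] Dr.
  move=> _ _ /mapP[g _ ->] /mapP[h _ ->]; rewrite /comm_mx.
  by rewrite -!conjmxM ?inE ?stablemx_row_base // regC.
pose v := v' *m row_base D.
have v0 : v != 0 by rewrite mulmx_free_eq0 ?row_base_free.
have /choice[chi chiE] g : exists a, v *m reg g = a *: v.
  apply/sub_rVP; rewrite -stablemx_restrict //.
  by apply: (vs (restrictmx D (reg g))); apply: map_f; rewrite mem_enum.
have inj a b : a *: v = b *: v -> a = b.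
  by move/eqP; rewrite -subr_eq0 -scalerBl scaler_eq0 (negPf v0) orbF subr_eq0 => /eqP.
exists chi.
  split=> [|g h]; apply: inj; first by rewrite -chiE reg0 mulmx1 scale1r.
  by rewrite -chiE regD mulmxA chiE -scalemxAl chiE scalerA.
apply: contra v0 => /eqP chis1.
have /submxP[w vE] : (v <= D)%MS by rewrite mulmx_sub ?eq_row_base.
have vn j : v *m reg (s *+ j) = v.
  elim: j => [|j IHj]; first by rewrite mulr0n reg0 mulmx1.
  by rewrite mulrSr regD mulmxA IHj chiE chis1 scale1r.
(* If s fixes v = w D, then the sum of the [v *m reg (s *+ j)] is n v, but it also telescopes to w
   (reg (n s) - 1) = 0. *)
have : v *+ n = 0.
  transitivity (w *m (D *m \sum_(j < n) reg (s *+ j))).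
    rewrite mulmxA -vE mulmx_sumr (eq_bigr (fun=> v)) ?sumr_const ?card_ord //.
  rewrite mulmx_sumr (eq_bigr (fun j : 'I_n => reg (s *+ j.+1) - reg (s *+ j))); last first.
    by move=> j _; rewrite mulmxBl mul1mx -regD -mulrS.
  rewrite -(big_mkord xpredT (fun j => reg (s *+ j.+1) - reg (s *+ j))).
  by rewrite telescope_sumr // mulrn_card mulr0n reg0 subrr mulmx0.
rewrite -scaler_nat => /eqP; rewrite scaler_eq0 pnatr_eq0 => /orP[/eqP n0|//].
have : (0 < n)%N by apply/card_gt0P; exists 0.
by rewrite lt0n => /eqP[].
Qed.

Lemma sum_unit_char (G : finZmodType) (chi : G -> C) g : unit_char chi ->
  chi g != 1 -> \sum_x chi x = 0.
Proof.
case=> c0 cD cg; apply/eqP; have : (chi g - 1) * \sum_x chi x = 0.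
  rewrite mulrBl mul1r mulr_sumr [X in _ - X](reindex_inj (addrI g)) /=.
  by rewrite -sumrB big1 // => x _; rewrite cD subrr.
by move/eqP; rewrite mulf_eq0 subr_eq0 (negPf cg).
Qed.

Variables (A : finComNzRingType).

(** The kernel contains no non-zero ideal. Such a character generates the character group of A as an
    A-module, by [primitive_char_dual]. *)
Definition primitive_char (chi : A -> C) :=
  unit_char chi /\ forall r, (forall x, chi (r * x) = 1) -> r = 0.

(** Every non-zero ideal of a chain ring contains [pi ^+ N.-1], so non-triviality at this one
    element suffices. *)
Lemma primitive_char_exists (pi : A) N : chain_ring pi N ->
  exists chi, primitive_char chi.
Proof.
move=> chA; have [_ N0 _ pN] := chA.
have [chi cc cN] := exists_unit_char pN; exists chi; split=> // r rE.
apply/eqP; apply: contraNT cN => r0; rewrite -[_ == 1]/(_ == 1).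
have [i [w [iN /existsP[w' /eqP ww'] rE']]] := chain_decomp chA r0.
rewrite (_ : pi ^+ N.-1 = r * (w' * pi ^+ (N.-1 - i))) ?rE //.
by rewrite rE' mulrA -[_ * w * w']mulrA ww' mulr1 -exprD subnKC // -ltnS prednK.
Qed.

(** Sum psi(x) chi(-ax) over all a and x. Summing over a first leaves x = 0 and gives [#|A|]; if psi
    differed from every chi(a x), each sum over x would vanish by orthogonality. *)
Lemma primitive_char_dual (chi : A -> C) (psi : A -> C) :
  primitive_char chi -> unit_char psi -> exists a, forall x, psi x = chi (a * x).
Proof.
case=> cc cp pc; have [//|noa] := pselect (exists a, forall x, psi x = chi (a * x)).
have [c0 cD] := cc; have [p0 pD] := pc.
have A0 : #|A|%:R != 0 :> C.
  by rewrite pnatr_eq0 -lt0n; apply/card_gt0P; exists 0.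
case/eqP: A0; transitivity (\sum_a \sum_x psi x * chi (- (a * x))).
  rewrite exchange_big /= (bigD1 0) //= [X in _ + X]big1 ?addr0 => [|x x0].
    rewrite (eq_bigr (fun=> 1)) ?sumr_const // => a _.
    by rewrite p0 mulr0 oppr0 c0 mulr1.
  rewrite -mulr_sumr.
  have [g cg] : exists g, chi (- (g * x)) != 1.
    apply: contrapT => /forallNP H; case/eqP: x0; apply: cp => y.
    have /negP := H (- y); rewrite negbK mulNr opprK mulrC => /eqP //.
  rewrite (sum_unit_char (g := g)) ?mulr0 //; split; first by rewrite mul0r oppr0 c0.
  by move=> z w; rewrite mulrDl opprD cD.
rewrite big1 // => a _.
have [g pg] : exists g, psi g * chi (- (a * g)) != 1.
  apply: contrapT => /forallNP H; apply: noa; exists a => x.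
  have /negP := H x; rewrite negbK unit_charN // => /eqP E.
  by apply: (mulIf (_ : (chi (a * x))^-1 != 0));
    rewrite ?invr_eq0 ?unit_char_neq0 // E divff ?unit_char_neq0.
rewrite (sum_unit_char (g := g)) //; split; first by rewrite p0 mulr0 oppr0 c0 mulr1.
by move=> z w; rewrite pD mulrDr opprD cD mulrACA.
Qed.

End Characters.

(** * Rings of integers *)

(* Such a number is in fact an algebraic integer; this is proved here only for *)
(* rational numbers, which is what the coefficients of a minimal polynomial *)
(* require. *)
Definition almost_Aint (w : algC) :=
  exists2 D : nat, (0 < D)%N & forall k, D%:R * w ^+ k \in Aint.

Lemma almost_AintM v w : almost_Aint v -> almost_Aint w -> almost_Aint (v * w).
Proof.
case=> D D0 vD [E E0 wE]; exists (D * E)%N; first by rewrite muln_gt0 D0.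
by move=> k; rewrite natrM exprMn mulrACA rpredM.
Qed.

Lemma almost_AintD v w : almost_Aint v -> almost_Aint w -> almost_Aint (v + w).
Proof.
case=> D D0 vD [E E0 wE]; exists (D * E)%N; first by rewrite muln_gt0 D0.
move=> k; rewrite exprDn mulr_sumr; apply: rpred_sum => i _.
by rewrite mulrnAr rpredMn // natrM mulrACA rpredM.
Qed.

Lemma almost_Aint_int (z : int) : almost_Aint z%:~R.
Proof. by exists 1%N => // k; rewrite mul1r rpredX // Aint_int. Qed.

Lemma almost_Aint_prod (s : seq algC) i : (forall z, z \in s -> almost_Aint z) ->
  almost_Aint (\prod_(z <- s) ('X - z%:P))`_i.
Proof.
elim: s i => [|z s IHs] i sA.
  by rewrite big_nil coef1; case: (i == _); [exact: (almost_Aint_int 1)|exact: (almost_Aint_int 0)].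
rewrite big_cons mulrBl coefB coefXM mul_polyC coefZ.
have {}IHs j : almost_Aint (\prod_(z <- s) ('X - z%:P))`_j.
  by apply: IHs => w ws; apply: sA; rewrite inE ws orbT.
apply: almost_AintD; first by case: eqP => _ //; exact: (almost_Aint_int 0).
rewrite -mulN1r; apply: almost_AintM; first exact: (almost_Aint_int (-1)).
by apply: almost_AintM => //; apply: sA; rewrite inE eqxx.
Qed.

(** All powers of the denominator divide the fixed number D, so the denominator is 1. *)
Lemma almost_Aint_rat (r : rat) : almost_Aint (ratr r) -> r \in Num.int.
Proof.
case=> D D0 rD; rewrite Qint_def.
have den_dvd k : (`|denq r| ^ k %| D)%N.
  have : (D%:R * ratr r ^+ k : algC) \in Num.int.
    apply: Cint_rat_Aint => //; apply/CratP; exists (D%:R * r ^+ k).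
    by rewrite rmorphM rmorphXn /= ratr_nat.
  case/intrP=> m; rewrite -[D%:R]ratr_nat -rmorphXn -rmorphM -ratr_int /= => /(fmorph_inj _) E.
  have {}E : D%:Z * numq r ^+ k = m * denq r ^+ k.
    apply: (@intr_inj rat); rewrite !rmorphM !rmorphXn /= numqE exprMn -E.
    by rewrite !mulrA.
  rewrite -(@Gauss_dvdl _ _ (`|numq r| ^ k)).
    by rewrite -abszX -[D]absz_nat -abszX -abszM E abszM dvdn_mull.
  by rewrite coprimeXl // coprimeXr // coprime_sym coprime_num_den.
have := den_dvd D => /(dvdn_leq D0); case: (denqP r) => -[|d] -> //.
by rewrite leqNgt ltn_expl.
Qed.

(** Complete integral closedness. All conjugates of [gam] are almost algebraic integers, hence so
    are the coefficients of its minimal polynomial; being rational, these are integers. *)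
Lemma almost_integral (K : fieldExtType rat) (gam : K) (l : nat) : (0 < l)%N ->
  (forall k, integralOver (intr : int -> K) (l%:R * gam ^+ k)) ->
  integralOver (intr : int -> K) gam.
Proof.
move=> l0 gi; have [/polyOver1P[f Df]] := (minPolyOver 1 gam, monic_minPoly 1 gam).
rewrite Df map_monic => fm.
have fg : root (map_poly (in_alg K) f) gam by rewrite -Df root_minPoly.
have fdvd (g : {poly rat}) : root (map_poly (in_alg K) g) gam -> f %| g.
  by move=> gg; rewrite -(dvdp_map (in_alg K)) -Df minPoly_dvdp // alg_polyOver.
have [s sE] := closed_field_poly_normal (map_poly (ratr : rat -> algC) f).
have sA z : z \in s -> almost_Aint z.
  move=> zs; exists l => // k; have [h hm hr] := gi k.
  (* The minimal polynomial divides h(l X^k), so each conjugate z is a root of it and l z^k is a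
     root of the monic h. *)
  pose g : {poly rat} := map_poly intr h \Po (l%:R *: 'X^k).
  have gE (R : fieldType) (phi : {rmorphism rat -> R}) (x : R) :
      (map_poly phi g).[x] = (map_poly intr h).[l%:R * x ^+ k].
    rewrite /g map_comp_poly horner_comp map_polyZ map_polyXn /= hornerZ hornerXn.
    rewrite rmorph_nat -map_poly_comp; congr horner.
    by apply: eq_map_poly => a /=; rewrite rmorph_int.
  have /fdvd fdg : root (map_poly (in_alg K) g) gam by rewrite /root gE; exact: hr.
  apply: (@root_monic_Aint (map_poly intr h)); last by apply/polyOverP => i; rewrite coef_map intr_int.
    rewrite /root -(gE _ (ratr : {rmorphism rat -> algC})).
    have : map_poly (ratr : rat -> algC) f %| map_poly ratr g by rewrite dvdp_map.
    case/dvdpP=> r gr; rewrite -[_ == 0]/(root _ _) gr rootM; apply/orP; right.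
    rewrite sE rootZ ?lead_coef_eq0 ?map_poly_eq0 ?monic_neq0 //.
    by rewrite root_prod_XsubC.
  exact: monic_map.
have fint : f \is a polyOver Num.int.
  apply/polyOverP => i; apply: almost_Aint_rat; rewrite -coef_map sE /=.
  rewrite lead_coef_map (monicP fm) rmorph1 scale1r.
  exact: almost_Aint_prod.
have /floorpP[h fE] := fint.
exists h.
  rewrite monicE -(inj_eq (@intr_inj rat)) -(lead_coef_map_inj _ (rmorph0 _)) //; last exact: intr_inj.
  by rewrite -fE (monicP fm).
move: fg; rewrite fE -map_poly_comp (eq_map_poly (_ : _ =1 intr)) //.
by move=> a; rewrite [LHS](rmorph_int (in_alg K)).
Qed.

Section RingOfIntegers.
Variable K : fieldExtType rat.
Local Notation O := (ring_of_integers K).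

Lemma integers_mulfI (x y z : O) : x != 0 -> x * y = x * z -> y = z.
Proof.
move=> x0 /(congr1 val); rewrite !rmorphM /= => E; apply: val_inj.
apply: mulfI E; apply: contra x0 => /eqP x0; apply/eqP; apply: val_inj.
by rewrite [LHS]x0 rmorph0.
Qed.

Lemma integers_natf_neq0 n : (0 < n)%N -> (n%:R : O) != 0.
Proof.
move=> n0; apply/eqP => /(congr1 val) /eqP; rewrite rmorph_nat rmorph0.
by rewrite -(rmorph_nat (in_alg K)) fmorph_eq0 pnatr_eq0; case: n n0.
Qed.

Lemma integers_integral (x : O) : integralOver (intr : int -> K) (val x).
Proof. by have /asboolP := valP x. Qed.

Lemma integers_lift (x : K) : integralOver (intr : int -> K) x ->
  exists y : O, val y = x.
Proof. by move=> xi; exists (Sub x (asboolT xi)). Qed.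

(** Once powers of X are divided out, the constant term of an integral equation of x is a non-zero
    multiple of x. *)
Lemma integer_multiple (x : O) : x != 0 -> exists c : int, c != 0 /\
  exists y : O, c%:~R = x * y.
Proof.
move=> x0; have [h hm hr] := integers_integral x.
have {}hr : (map_poly (intr : int -> O) h).[x] = 0.
  apply: val_inj; rewrite rmorph0 -(horner_map (val : {rmorphism O -> K})) -map_poly_comp.
  rewrite (eq_map_poly (_ : _ =1 intr)); first exact/eqP.
  by move=> a; rewrite [LHS](rmorph_int (val : {rmorphism O -> K})).
have h0 : h != 0 by rewrite monic_neq0.
elim/poly_ind: h h0 hr {hm} => [|q c IHq]; first by rewrite eqxx.
have [->|c0 _] := eqVneq c 0.
  rewrite addr0 mulf_eq0 polyX_eq0 orbF => q0.
  rewrite rmorphM /= map_polyX hornerMX mulrC -[X in _ = X](mulr0 x).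
  by move/(integers_mulfI x0)/(IHq q0).
rewrite rmorphD rmorphM /= map_polyX map_polyC hornerD hornerMX hornerC /=.
move=> E; exists c; split=> //; exists (- (map_poly intr q).[x]).
by apply/eqP; rewrite mulrN -addr_eq0 addrC mulrC E.
Qed.

Section FiniteResidues.
Variable l : nat.
Hypothesis l_prime : prime l.

Let indep (t : seq O) := forall (c : nat -> int) (y : O),
  \sum_(i < size t) (c i)%:~R * t`_i = l%:R * y ->
  forall i, (i < size t)%N -> (l%:Z %| c i)%Z.

Let l0 : (l%:R : O) != 0.
Proof. by rewrite integers_natf_neq0 // prime_gt0. Qed.

(** Descent: the coefficients of a relation are divisible by l, and dividing by l gives another
    relation, so every power of l divides them. *)
Lemma indep_int (t : seq O) (c : nat -> int) : indep t ->
  \sum_(i < size t) (c i)%:~R * t`_i = 0 -> forall i, (i < size t)%N -> c i = 0.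
Proof.
move=> ti c0 i it; have : forall j, (l%:Z ^+ j %| c i)%Z.
  move=> j; elim: j c c0 => [|j IHj] c c0; first by rewrite dvd1z.
  have cl k : (k < size t)%N -> (l%:Z %| c k)%Z.
    by apply: (ti c 0); rewrite mulr0.
  rewrite -(divzK (cl i it)) exprSr dvdz_mul //.
  apply: (IHj (fun k => (c k %/ l)%Z)); apply: (integers_mulfI l0).
  rewrite mulr0 -[RHS]c0 mulr_sumr; apply: eq_bigr => k _.
  by rewrite mulrA -[in RHS](divzK (cl k (ltn_ord k))) rmorphM /= [l%:R * _]mulrC.
move=> lj; apply/eqP; rewrite -absz_eq0; apply: contraT; rewrite -lt0n => ci0.
have := lj `|c i|%N; rewrite dvdzE abszX absz_nat => /(dvdn_leq ci0).
by rewrite leqNgt ltn_expl // prime_gt1.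
Qed.

Lemma indep_size (t : seq O) : indep t -> (size t <= \dim {:K})%N.
Proof.
move=> ti; pose X := [tuple of [seq val x | x <- in_tuple t]].
have Xf : free X.
  apply/freeP => k k0 i.
  pose D := \prod_(j < size t) denq (k j).
  have D0 : D != 0 by apply/prodf_neq0 => j _; rewrite denq_eq0.
  pose c (j : nat) : int := if insub j is Some j' then numq (k j') * (D %/ denq (k j'))%Z else 0.
  have cE (j : 'I_(size t)) : (c j)%:~R = D%:~R * k j :> rat.
    rewrite /c valK rmorphM /= numqE -mulrA mulrC; congr (_ * _).
    rewrite -rmorphM /= mulrC divzK // /D (bigD1 j) //=; exact: dvdz_mulr.
  have : c i = 0.
    apply: (indep_int ti) => //; apply: val_inj.
    have := congr1 ( *:%R (D%:~R : rat)) k0; rewrite scaler0 scaler_sumr => kE.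
    rewrite rmorph0 rmorph_sum -[RHS]kE /=.
    apply: eq_bigr => j _;
    rewrite [X in X * _](rmorph_int (val : {rmorphism O -> K})) (nth_map 0) // scalerA -cE.
    by rewrite scaler_int mulrzl.
  move/(congr1 (intr : int -> rat)); rewrite cE => /eqP; rewrite mulf_eq0 intr_eq0 (negPf D0).
  by move/eqP.
by move: Xf; rewrite /free size_tuple => /eqP <-; rewrite dimvS ?subvf.
Qed.

(* A family independent modulo l is linearly independent over the rationals, *)
(* hence has at most [K : Q] elements; a maximal one spans O / l O. *)
Lemma finite_residues_prime : exists s : seq O, forall x, exists2 r, r \in s &
  exists y, x = r + l%:R * y.
Proof.
have ex : exists n, `[< exists2 t, size t = n & indep t >].
  by exists 0%N; apply/asboolP; exists [::].
have bnd n : `[< exists2 t, size t = n & indep t >] -> (n <= \dim {:K})%N.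
  by case/asboolP => t <-; apply: indep_size.
have [n /asboolP[t tn ti] tmax] := ex_maxnP ex bnd.
exists [seq \sum_(i < size t) (f i : nat)%:R * t`_i | f : {ffun 'I_(size t) -> 'I_l}].
move=> x.
have [c [y [cy [i it ci]]]] : exists (c : nat -> int) (y : O),
    \sum_(i < (size t).+1) (c i)%:~R * (rcons t x)`_i = l%:R * y /\
    exists2 i, (i < (size t).+1)%N & ~~ (l%:Z %| c i)%Z.
  apply: contrapT => H.
  suff /tmax : `[< exists2 t0 : seq O, size t0 = (size t).+1 & indep t0 >] by rewrite -tn ltnn.
  apply/asboolP; exists (rcons t x); rewrite ?size_rcons // => c y cy i it.
  apply: contrapT => ci; apply: H; exists c, y; split; first by rewrite -cy size_rcons.
  by exists i; [rewrite -(size_rcons t x) | apply/negP].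
move: cy; rewrite big_ord_recr /= nth_rcons ltnn eqxx.
under eq_bigr => j _ do rewrite nth_rcons ltn_ord.
move=> cy; have cm : ~~ (l%:Z %| c (size t))%Z.
  apply: contra ci => /dvdzP[e ce].
  move: it; rewrite ltnS leq_eqVlt => /orP[/eqP->|it]; first by rewrite ce dvdz_mull.
  apply: (ti c (y - e%:~R * x)) it; rewrite mulrBr -cy ce rmorphM /=.
  by rewrite mulrA [l%:R * _]mulrC addrK.
(* By maximality x satisfies a relation modulo l in which its own coefficient is prime to l; Bezout
   inverts that coefficient. *)
have [e [f ef]] : exists e f, e * c (size t) + f * l%:Z = 1.
  have /coprimezP[[e f] /= ef] : coprimez (c (size t)) l.
    by rewrite coprimez_sym coprimezE absz_nat prime_coprime.
  by exists e, f.
pose r (j : nat) : int := - (e * c j).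
have rl (j : nat) : (`|(r j %% l)%Z| < l)%N.
  by rewrite -ltz_nat gez0_abs ?modz_ge0 ?ltz_pmod //; have := prime_gt0 l_prime; case: (l).
pose g : {ffun 'I_(size t) -> 'I_l} := [ffun j : 'I_(size t) => Ordinal (rl j)].
exists (\sum_(i < size t) (g i : nat)%:R * t`_i); first exact: image_f.
exists (e%:~R * y + f%:~R * x + \sum_(j < size t) (r j %/ l)%Z%:~R * t`_j).
rewrite mulrDr mulr_sumr addrCA -big_split /=.
rewrite (eq_bigr (fun j : 'I_(size t) => (r j)%:~R * t`_j)); last first.
  move=> j _; rewrite ffunE /= [in RHS](divz_eq (r j) l) rmorphD rmorphM /=.
  rewrite mulrDl addrC -!mulrA [l%:R * (_ * _)]mulrCA; congr (_ + _ * _).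
  rewrite -[in RHS](@gez0_abs (r j %% l)%Z) ?modz_ge0 //.
  by have := prime_gt0 l_prime; case: (l).
have xE : x = e%:~R * ((c (size t))%:~R * x) + f%:~R * (l%:R * x).
  rewrite !mulrA -mulrDl -[LHS]mul1r; congr (_ * _).
  by have := congr1 (intr : int -> O) ef; rewrite rmorphD !rmorphM.
rewrite (eq_bigr (fun j : 'I_(size t) => - (e%:~R * ((c j)%:~R * t`_j)))); last first.
  by move=> j _; rewrite /r rmorphN rmorphM /= mulNr mulrA.
rewrite sumrN -mulr_sumr {1}xE mulrDr [l%:R * (e%:~R * y)]mulrCA -cy.
rewrite [l%:R * (f%:~R * x)]mulrCA mulrDr.
by move: (e%:~R * \sum_(_ < _) _) (e%:~R * _) (f%:~R * _) => a b d;
  rewrite [RHS]addrC !addrA addNr add0r.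
Qed.

End FiniteResidues.
End RingOfIntegers.

Section PrimeIdeal.
Variables (K : fieldExtType rat) (p : prime_idealr (ring_of_integers K)).
Local Notation O := (ring_of_integers K).
Hypothesis p_neq0 : exists2 x, x \in p & x != 0.

Lemma prime_number_in_prime_ideal : exists2 l, prime l & (l%:R : O) \in p.
Proof.
have [x xp x0] := p_neq0.
have [c [c0 [y cE]]] := integer_multiple x0.
have : (`|c|%N%:R : O) \in p.
  have : (c%:~R : O) \in p by rewrite cE mulrC idealMr.
  by rewrite {1}[c]intEsign rmorphMsign /= rpredMsign.
have : (0 < `|c|)%N by rewrite absz_gt0.
move: {c c0 cE} `|c|%N => n; have [m] := ubnP n; elim: m n => // m IHm n.
rewrite ltnS => nm n0 np; have [n1|n1] := eqVneq n 1%N.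
  by move: np; rewrite n1 idealr1.
have n_gt1 : (1 < n)%N by case: n n0 n1 {np nm} => [|[]].
have dn := pdiv_dvd n; have pn := pdiv_prime n_gt1.
move: np; rewrite -{1}(divnK dn) natrM prime_idealrM => /orP[np|]; last by exists (pdiv n).
apply: IHm np; last by rewrite divn_gt0 ?prime_gt0 ?pdiv_leq.
by apply: leq_trans nm; rewrite ltn_Pdiv // prime_gt1.
Qed.

Lemma finite_residues_exp l k : prime l -> exists s : seq O, forall x,
  exists2 r, r \in s & exists y, x = r + l%:R ^+ k * y.
Proof.
move=> lp; have [s0 s0P] := finite_residues_prime K lp.
elim: k => [|k [s sP]].
  by exists [:: 0] => x; exists 0; [rewrite inE|exists x; rewrite add0r mul1r].
exists [seq r + l%:R ^+ k * r' | r <- s, r' <- s0] => x.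
have [r rs [y xE]] := sP x; have [r' r's [z yE]] := s0P y.
exists (r + l%:R ^+ k * r'); first by apply: allpairs_f.
by exists z; rewrite xE yE mulrDr addrA mulrA exprSr.
Qed.

(** Pigeonhole on the powers of a in the finite ring O/lO. It makes elements outside p invertible
    modulo p, and bounds the exponent in [residual_multiplier]. *)
Lemma power_collision l (a : O) : prime l -> exists i j y,
  (0 < j)%N /\ a ^+ i * (1 - a ^+ j) = l%:R * y.
Proof.
move=> lp; have [s sP] := finite_residues_prime K lp.
have /choice[f fP] k : exists r, r \in s /\ exists y, a ^+ k = r + l%:R * y.
  by have [r rs rE] := sP (a ^+ k); exists r.
have /(uniqPn 0)[i [j [ij jn fij]]] : ~~ uniq [seq f k | k <- iota 0 (size s).+1].
  apply/negP => /(uniq_leq_size (s2 := s)); rewrite size_map size_iota ltnn.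
  by move=> H; suff: false by []; apply: H => _ /mapP[k _ ->]; case: (fP k).
move: jn fij; rewrite size_map size_iota => jn.
rewrite !(nth_map 0%N) ?size_iota ?(ltn_trans ij) // !nth_iota ?(ltn_trans ij) // !add0n.
have [_ [y iE]] := fP i; have [_ [z jE]] := fP j => fij.
exists i, (j - i)%N, (y - z); rewrite subn_gt0; split=> //.
by rewrite mulrBr mulr1 -exprD subnKC ?(ltnW ij) // iE jE fij mulrBr opprD addrACA subrr add0r.
Qed.

Lemma prime_idealrX (a : O) k : a ^+ k.+1 \in p -> a \in p.
Proof.
elim: k => [|k IHk] //; rewrite exprS prime_idealrM => /orP[] //.
Qed.

(* In the localization O_p, b / l generates the inverse of the ideal p. *)
Lemma residual_multiplier l : prime l -> (l%:R : O) \in p ->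
  exists2 b : O, (forall s y, s \notin p -> s * b != l%:R * y) &
    forall a, a \in p -> exists y, b * a = l%:R * y.
Proof.
move=> lprime lp; have [s sP] := finite_residues_prime K lprime.
pose P (b : O) := forall s y, s \notin p -> s * b != l%:R * y.
suff [b Pb bs] : exists2 b, P b & forall a, a \in s -> a \in p -> exists y, b * a = l%:R * y.
  exists b => // a ap; have [r rs [y aE]] := sP a.
  have rp : r \in p.
    by rewrite (_ : r = a - y * l%:R) ?rpredB ?idealMr // aE mulrC addrK.
  by have [z bE] := bs r rs rp; exists (z + b * y); rewrite aE !mulrDr bE mulrCA.
elim: s {sP} => [|a s [b Pb bs]].
  exists 1 => // s y sp; rewrite mulr1; apply: contra sp => /eqP ->.
  by rewrite mulrC idealMr.
have [ap|ap] := boolP (a \in p); last first.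
  by exists b => // c; rewrite inE => /orP[/eqP ->|/bs //]; rewrite (negPf ap).
(* Take the largest power of a that preserves [P]. If all powers did, a collision would put b a^i (1
   - a^j) into lO although 1 - a^j lies outside p. *)
have [k Pk nPk] : exists2 k, P (b * a ^+ k) & ~ P (b * a ^+ k.+1).
  apply: contrapT => H.
  have Pk k : P (b * a ^+ k).
    elim: k => [|k IHk]; first by rewrite mulr1.
    by apply: contrapT => nP; apply: H; exists k.
  have [i [j [y [j0 E]]]] := power_collision a lprime.
  have naj : 1 - a ^+ j \notin p.
    apply/negP => aj; have : 1 - a ^+ j + a ^+ j \in p.
      by rewrite rpredD // -(prednK j0) exprSr idealMr.
    by rewrite subrK idealr1.
  have /eqP[] := Pk i (1 - a ^+ j) (b * y) naj.
  by rewrite [RHS]mulrCA -E; ring.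
have [s' [y [s'p E]]] : exists s' y, s' \notin p /\ s' * (b * a ^+ k.+1) = l%:R * y.
  apply: contrapT => H; apply: nPk => s' y s'p; apply/eqP => E; apply: H.
  by exists s', y.
exists (s' * (b * a ^+ k)) => [s'' z s''p|c].
  rewrite mulrA; apply: Pk; by rewrite prime_idealrM negb_or s''p.
rewrite inE => /orP[/eqP -> _|cs cp].
  by exists y; rewrite -E exprSr !mulrA.
have [z cE] := bs c cs cp; exists (s' * a ^+ k * z).
by rewrite [RHS]mulrCA -cE; ring.
Qed.

(** Locally at p, [pi] generates p. Let gam = b / l with b from [residual_multiplier]. If gam mapped
    p into p, all l gam^k would be integral, so gam would be integral by [almost_integral], which
    the choice of b excludes. Hence b pi = l u for some pi in p and u outside p, and b x = l y gives
    u x = pi y. *)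
Lemma prime_uniformizer : exists pi u : O, [/\ pi \in p, u \notin p &
  forall x, x \in p -> exists y, u * x = pi * y].
Proof.
have [l lprime lp] := prime_number_in_prime_ideal.
have l0 : (l%:R : O) != 0 by rewrite integers_natf_neq0 // prime_gt0.
have [b Pb bp] := residual_multiplier lprime lp.
have [pi [u [pip up piE]]] : exists pi u, [/\ pi \in p, u \notin p & b * pi = l%:R * u].
  apply: contrapT => H.
  have stab x : x \in p -> exists2 y, y \in p & b * x = l%:R * y.
    move=> xp; have [y yE] := bp x xp; exists y => //.
    by apply: contrapT => /negP yp; apply: H; exists x, y.
  pose gam : K := val b / l%:R.
  have lK : (l%:R : K) != 0.
    by apply: contra l0 => /eqP lK; apply/eqP/val_inj; rewrite rmorph_nat rmorph0.
  have gamE x y : b * x = l%:R * y -> gam * val x = val y.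
    move=> E; apply: (mulfI lK); rewrite /gam mulrA mulrCA divff // mulr1.
    by have := congr1 val E; rewrite !rmorphM rmorph_nat.
  have gamk k : exists2 y, y \in p & val y = l%:R * gam ^+ k.
    elim: k => [|k [y yp yE]]; first by exists (l%:R) => //; rewrite rmorph_nat mulr1.
    have [z zp zE] := stab y yp; exists z => //.
    by rewrite exprS mulrCA -yE (gamE _ _ zE).
  have : integralOver (intr : int -> K) gam.
    apply: (almost_integral (prime_gt0 lprime)) => k; have [y _ <-] := gamk k.
    exact: integers_integral.
  case/integers_lift => g gE; have := Pb 1 g; rewrite idealr1 => /(_ isT)/eqP[].
  by apply: val_inj; rewrite mul1r rmorphM rmorph_nat /= [X in _ * X]gE /gam mulrCA divff ?mulr1.
exists pi, u; split=> // x xp; have [y yE] := bp x xp; exists y.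
apply: (integers_mulfI l0); rewrite mulrA -piE mulrAC yE; ring.
Qed.

End PrimeIdeal.

(** * The cocycle and its radicals *)

Section Cocycle.
Variables (m n : nat) (R : comNzRingType).
Implicit Types u v : 'rV[R]_(2 * m + 2 * n).

Lemma Qbracket_ll i j :
  @Qbracket m n R (lshift _ i) (lshift _ j) = ((Jmx m i j)%:~R, 0).
Proof.
rewrite /Qbracket /commutator_mx block_mxEul mxE.
rewrite [LHS]surjective_pairing; congr pair.
  by rewrite [LHS](raddfMz (fst : {additive R * 'M[R]_(2 * m, 2 * n) -> R})).
by rewrite [LHS](raddfMz (snd : {additive R * 'M[R]_(2 * m, 2 * n) -> _})) /= mul0rz.
Qed.

Lemma Qbracket_lr i j :
  @Qbracket m n R (lshift _ i) (rshift _ j) = (0, delta_mx i j).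
Proof. by rewrite /Qbracket /commutator_mx block_mxEur mxE. Qed.

Lemma Qbracket_rr i j : @Qbracket m n R (rshift _ i) (rshift _ j) = 0.
Proof. by rewrite /Qbracket /commutator_mx block_mxEdr mxE. Qed.

Lemma QcocycleE u v : Qcocycle u v =
  (\sum_(i < 2 * m) \sum_(j < 2 * m | (i < j)%N)
      u 0 (lshift _ i) * v 0 (lshift _ j) * (Jmx m i j)%:~R,
   (lsubmx u)^T *m rsubmx v).
Proof.
have sum1 (I : finType) (P : pred I) (F : I -> Qcenter m n R) :
    (\sum_(i | P i) F i).1 = \sum_(i | P i) (F i).1.
  exact: (raddf_sum (fst : {additive R * 'M[R]_(2 * m, 2 * n) -> R})).
have sum2 (I : finType) (P : pred I) (F : I -> Qcenter m n R) :
    (\sum_(i | P i) F i).2 = \sum_(i | P i) (F i).2.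
  exact: (raddf_sum (snd : {additive R * 'M[R]_(2 * m, 2 * n) -> _})).
rewrite /Qcocycle big_split_ord /= [X in _ + X]big1 ?addr0; last first.
  move=> i _; rewrite big_mkcond big_split_ord /= big1 ?add0r.
    by rewrite big1 // => j _; rewrite Qbracket_rr /Qscale /= mulr0 scaler0; case: ifP.
  by move=> j _; rewrite ltnNge (leq_trans (ltnW (ltn_ord j))) ?leq_addr.
rewrite [LHS]surjective_pairing; congr pair.
  rewrite sum1; apply: eq_bigr => i _; rewrite sum1 big_mkcond big_split_ord /=.
  rewrite [X in _ + X]big1 ?addr0 => [|j _]; last first.
    by rewrite Qbracket_lr /= mulr0; case: ifP.
  by rewrite -big_mkcond; apply: eq_bigr => j _; rewrite Qbracket_ll.
apply/matrixP => k l; rewrite sum2 summxE mxE;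
  apply: etrans (_ : _ = \sum_i (u 0 (lshift _ i) * v 0 (rshift _ l)) *+ (i == k)) _.
  apply: eq_bigr => i _; rewrite sum2 summxE big_mkcond big_split_ord /=.
  rewrite big1 ?add0r => [|j _]; last by rewrite Qbracket_ll /= scaler0 mxE; case: ifP.
  rewrite (bigD1 l) //= big1 ?addr0 => [|j jl]; last first.
    by rewrite Qbracket_lr /= !mxE [l == j]eq_sym (negPf jl) andbF mulr0; case: ifP.
  rewrite (leq_trans (ltn_ord i)) ?leq_addr // Qbracket_lr /= !mxE eqxx andbT eq_sym.
  by case: (_ == _); rewrite ?mulr1 ?mulr0.
rewrite (bigD1 k) //= big1 ?addr0 => [|i ik]; last by rewrite (negPf ik).
by rewrite big_ord1 !mxE eqxx.
Qed.

End Cocycle.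

Section BaseChange.
Variables (m n : nat) (R S : comNzRingType) (f : {rmorphism R -> S}).

Definition Qcenter_map (z : Qcenter m n R) : Qcenter m n S := (f z.1, map_mx f z.2).
Definition Qgroup_map (g : Qgroup m n R) : Qgroup m n S :=
  (map_mx f g.1, Qcenter_map g.2).

Lemma Qcenter_mapD z w : Qcenter_map (z + w) = Qcenter_map z + Qcenter_map w.
Proof. by rewrite /Qcenter_map rmorphD map_mxD. Qed.

Lemma Qcocycle_map (u v : 'rV[R]_(2 * m + 2 * n)) :
  Qcenter_map (Qcocycle u v) = Qcocycle (map_mx f u) (map_mx f v).
Proof.
rewrite !QcocycleE /Qcenter_map /=; congr pair.
  rewrite rmorph_sum; apply: eq_bigr => i _; rewrite rmorph_sum.
  by apply: eq_bigr => j _; rewrite !rmorphM rmorph_int !mxE.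
by rewrite map_mxM; congr (_ *m _); apply/matrixP => k l; rewrite !mxE.
Qed.

Lemma Qgroup_mapM (g h : Qgroup m n R) :
  Qgroup_map (Qmul g h) = Qmul (Qgroup_map g) (Qgroup_map h).
Proof.
by rewrite /Qgroup_map /Qmul /= map_mxD !Qcenter_mapD Qcocycle_map.
Qed.

Lemma Qgroup_map1 : Qgroup_map (Qone m n R) = Qone m n S.
Proof. by rewrite /Qgroup_map /Qcenter_map /= rmorph0 !map_mx0. Qed.

End BaseChange.

Section Coordinates.
Variable R : comNzRingType.
Local Notation row6 := 'rV[R]_(2 * 2 + 2 * 1).
Implicit Types u v : row6.

(** The index type ['I_(2 * 2 + 2 * 1)] is convertible to ['I_(5.+1)], which lets [inord] accept
    numerals. *)
Definition coord u (k : nat) : R := u 0 (inord k : 'I_(5.+1)).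

Lemma coordE u (i : 'I_(2 * 2 + 2 * 1)) : u 0 i = coord u i.
Proof. by rewrite /coord; congr (u 0 _); apply: val_inj; rewrite /= inordK. Qed.

Definition unit_row (k : nat) (r : R) : row6 := \row_(i < 6) (r *+ (i == k :> nat)).

Lemma coord_unit_row k r j : (j < 6)%N -> coord (unit_row k r) j = r *+ (j == k).
Proof. by move=> j6; rewrite /coord mxE inordK. Qed.

Lemma Qcocycle21 u v : Qcocycle u v =
  (coord u 0 * coord v 1 + coord u 2 * coord v 3,
   \matrix_(i, j) (coord u i * coord v (4 + j))).
Proof.
rewrite QcocycleE; congr pair; last first.
  by apply/matrixP => i j; rewrite !mxE big_ord1 !mxE !coordE.
under eq_bigr do rewrite big_mkcond.
rewrite !big_ord_recl !big_ord0 /= !mxE /= !coordE /=.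
rewrite /bump /=; ring.
Qed.

Lemma Qcenter_delta (z : Qcenter 2 1 R) :
  z = (z.1, 0) + \sum_i \sum_j ((0, z.2 i j *: delta_mx i j) : Qcenter 2 1 R).
Proof.
rewrite [LHS]surjective_pairing; congr pair.
  rewrite /= [X in _ + X](raddf_sum (fst : {additive R * 'M[R]_(2 * 2, 2 * 1) -> R})).
  rewrite big1 ?addr0 // => i _.
  by rewrite [LHS](raddf_sum (fst : {additive R * 'M[R]_(2 * 2, 2 * 1) -> R})) big1.
rewrite /= [X in _ + X](raddf_sum (snd : {additive R * 'M[R]_(2 * 2, 2 * 1) -> _})).
rewrite add0r {1}[z.2]matrix_sum_delta; apply: eq_bigr => i _.
by rewrite [RHS](raddf_sum (snd : {additive R * 'M[R]_(2 * 2, 2 * 1) -> _})).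
Qed.

(* The centre is generated by commutators. *)
Lemma hom_center_trivial (F : fieldType) (chi : Qgroup 2 1 R -> F) :
    chi (Qone 2 1 R) = 1 -> (forall g h, chi (Qmul g h) = chi g * chi h) ->
  forall z, chi (0, z) = 1.
Proof.
move=> chi1 chiM.
have mulz z w : Qmul (0, z) (0, w) = (0, z + w) :> Qgroup 2 1 R.
  by rewrite /Qmul /= addr0 Qcocycle0l addr0.
have chiD z w : chi (0, z + w) = chi (0, z) * chi (0, w) by rewrite -chiM mulz.
have chi0 z : chi (0, z) != 0.
  apply/eqP => E; have := chiD z (- z); rewrite subrr E mul0r.
  by move/eqP; rewrite -[(0, 0)]/(Qone 2 1 R) chi1 oner_eq0.
have chic u v : chi (0, Qcocycle u v) = chi (0, Qcocycle v u).
  have E : chi (Qmul (u, 0) (v, 0)) = chi (Qmul (v, 0) (u, 0)) by rewrite !chiM mulrC.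
  have split w z : (w, z) = Qmul (0, z) (w, 0) :> Qgroup 2 1 R.
    by rewrite /Qmul /= Qcocycle0l !addr0 add0r.
  have uv0 : chi (u + v, 0) != 0.
    apply/eqP => E0; have := chiM (u + v, 0) (Qinv (u + v, 0)).
    by rewrite QmulrN chi1 E0 mul0r => /eqP; rewrite oner_eq0.
  move: E; rewrite /Qmul /= !add0r (split _ (Qcocycle u v)) (split _ (Qcocycle v u)) !chiM.
  by rewrite [v + u]addrC => /(mulIf uv0).
have c1 r : chi (0, (r, 0)) = 1.
  have E1 : Qcocycle (unit_row 0 r) (unit_row 1 1) = (r, 0).
    rewrite Qcocycle21 !coord_unit_row //= mulr1 mul0r addr0; congr pair.
    by apply/matrixP => i j; rewrite !mxE [coord _ (4 + j)]coord_unit_row ?mulr0 //; case: j => -[|[|]].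
  have E2 : Qcocycle (unit_row 1 1) (unit_row 0 r) = 0.
    rewrite Qcocycle21 !coord_unit_row //= !mul0r addr0; congr pair.
    by apply/matrixP => i j; rewrite !mxE [coord _ (4 + j)]coord_unit_row ?mulr0 //; case: j => -[|[|]].
  by rewrite -E1 chic E2.
have c2 r (i : 'I_(2 * 2)) (j : 'I_(2 * 1)) : chi (0, (0, r *: delta_mx i j)) = 1.
  have i4 := ltn_ord i; have j2 := ltn_ord j.
  have E1 : Qcocycle (unit_row i r) (unit_row (4 + j) 1) = (0, r *: delta_mx i j).
    rewrite Qcocycle21 !coord_unit_row // !mulr0 addr0; congr pair.
    apply/matrixP => k l; rewrite !mxE.
    have k4 := ltn_ord k; have l2 := ltn_ord l.
    rewrite coord_unit_row; last by rewrite (leq_trans k4).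
    rewrite coord_unit_row; last by rewrite -addnS leq_add2l.
    rewrite eqn_add2l -[k == i]/(val k == val i) -[l == j]/(val l == val j) /=.
    by case: (_ == _); case: (_ == _); rewrite ?mulr0 ?mulr1 ?mul0r.
  have E2 : Qcocycle (unit_row (4 + j) 1) (unit_row i r) = 0.
    rewrite Qcocycle21 !coord_unit_row // !mul0r addr0; congr pair.
    apply/matrixP => k l; rewrite !mxE.
    have k4 := ltn_ord k; have l2 := ltn_ord l.
    rewrite coord_unit_row; last by rewrite (leq_trans k4).
    by rewrite eqn_leq [X in _ && X]leqNgt (leq_trans k4) ?leq_addr // andbF mul0r.
  by rewrite -E1 chic E2.
have csum (I : Type) (r : seq I) (F' : I -> Qcenter 2 1 R) :
    chi (0, \sum_(i <- r) F' i) = \prod_(i <- r) chi (0, F' i).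
  by elim/big_rec2: _ => [|i x w _ <-]; rewrite ?chiD // -[(0, 0)]/(Qone 2 1 R).
move=> z; rewrite (Qcenter_delta z) chiD c1 mul1r csum big1 // => i _.
by rewrite csum big1.
Qed.

End Coordinates.

Section Pairing.
Variable A : finComNzRingType.
Local Notation row6 := 'rV[A]_(2 * 2 + 2 * 1).
Implicit Types (u v : row6) (d : Qcenter 2 1 A).

Definition coef d (k l : nat) : A := d.2 (inord k : 'I_(3.+1)) (inord l : 'I_(1.+1)).

Definition pairing d (z : Qcenter 2 1 A) : A :=
  d.1 * z.1 + \sum_i \sum_j d.2 i j * z.2 i j.

Lemma pairing_commutator d u v : pairing d (Qcocycle u v - Qcocycle v u) =
  (- d.1 * coord u 1 - coord u 4 * coef d 0 0 - coord u 5 * coef d 0 1) * coord v 0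
  + (d.1 * coord u 0 - coord u 4 * coef d 1 0 - coord u 5 * coef d 1 1) * coord v 1
  + (- d.1 * coord u 3 - coord u 4 * coef d 2 0 - coord u 5 * coef d 2 1) * coord v 2
  + (d.1 * coord u 2 - coord u 4 * coef d 3 0 - coord u 5 * coef d 3 1) * coord v 3
  + (coord u 0 * coef d 0 0 + coord u 1 * coef d 1 0 + coord u 2 * coef d 2 0
     + coord u 3 * coef d 3 0) * coord v 4
  + (coord u 0 * coef d 0 1 + coord u 1 * coef d 1 1 + coord u 2 * coef d 2 1
     + coord u 3 * coef d 3 1) * coord v 5.
Proof.
have dE i j : d.2 i j = coef d i j.
  by rewrite /coef; congr (d.2 _ _); apply: val_inj; rewrite /= inordK.
rewrite /pairing !Qcocycle21 /=.
under eq_bigr do under eq_bigr do rewrite dE !mxE.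
rewrite !big_ord_recl !big_ord0 /= /bump /=; ring.
Qed.

Lemma pairingD d z w : pairing d (z + w) = pairing d z + pairing d w.
Proof.
rewrite /pairing mulrDr addrACA; congr (_ + _); rewrite -big_split /=.
apply: eq_bigr => i _; rewrite -big_split /=; apply: eq_bigr => j _.
by rewrite mxE mulrDr.
Qed.

Definition coef_quad d (l : nat) : quad A :=
  (coef d 0 l, coef d 1 l, coef d 2 l, coef d 3 l).

(** The substitution x to x J under which the kernel of the commutator matrix becomes [in_ker]. *)
Definition row_quad u : quad A * A * A :=
  ((- coord u 1, coord u 0, - coord u 3, coord u 2), coord u 4, coord u 5).

Lemma row_quad_bij : bijective row_quad.
Proof.
pose g (x : quad A * A * A) : row6 := let: ((s1, s2, s3, s4), w1, w2) := x in
  \row_(i < 6) nth 0 [:: s2; - s1; s4; - s3; w1; w2] i.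
have gE x k : (k < 6)%N -> coord (g x) k = let: ((s1, s2, s3, s4), w1, w2) := x in
    nth 0 [:: s2; - s1; s4; - s3; w1; w2] k.
  by case: x => [[[[[s1 s2] s3] s4] w1] w2] k6; rewrite /coord /g mxE inordK.
exists g => [u|[[[[[s1 s2] s3] s4] w1] w2]]; last by rewrite /row_quad !gE //= !opprK.
apply/rowP => i; rewrite !coordE gE // /row_quad !opprK.
by case: i => -[|[|[|[|[|[|//]]]]]] i6.
Qed.

Variables (C : numClosedFieldType) (chi : A -> C).
Hypothesis chi_prim : primitive_char chi.

Definition dual_char d (z : Qcenter 2 1 A) : C := chi (pairing d z).

Lemma dual_char_unit d : unit_char (dual_char d).
Proof.
case: chi_prim => -[c0 cD] _; split=> [|z w]; last by rewrite /dual_char pairingD cD.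
rewrite /dual_char -[RHS]c0; congr chi; apply: (addrI (pairing d 0)).
by rewrite -pairingD !addr0.
Qed.

(** The elements e0 to e5 below are the coefficients of v in the pairing of d with the commutator of
    u and v. Testing on multiples of unit rows, primitivity of [chi] turns triviality of the
    character into the vanishing of each of them. *)
Lemma card_radical d : #|radical (@Qcocycle 2 1 A) (dual_char d)| =
  ker_size d.1 (coef_quad d 0) (coef_quad d 1).
Proof.
rewrite /ker_size pair_bigA pair_bigA /= (reindex row_quad) /=; last first.
  exact: onW_bij row_quad_bij.
rewrite -card_sum1; apply: eq_card => u; rewrite !inE /=.
rewrite /in_ker /qscale /coef_quad quadD quadP /symp.
set c00 := coef d 0 0; set c10 := coef d 1 0; set c20 := coef d 2 0; set c30 := coef d 3 0.
set c01 := coef d 0 1; set c11 := coef d 1 1; set c21 := coef d 2 1; set c31 := coef d 3 1.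
set u0 := coord u 0; set u1 := coord u 1; set u2 := coord u 2; set u3 := coord u 3.
set w1 := coord u 4; set w2 := coord u 5; set y := d.1.
pose e0 := - y * u1 - w1 * c00 - w2 * c01; pose e1 := y * u0 - w1 * c10 - w2 * c11.
pose e2 := - y * u3 - w1 * c20 - w2 * c21; pose e3 := y * u2 - w1 * c30 - w2 * c31.
pose e4 := u0 * c00 + u1 * c10 + u2 * c20 + u3 * c30.
pose e5 := u0 * c01 + u1 * c11 + u2 * c21 + u3 * c31.
have -> : [&& [&& y * - u1 == w1 * c00 + w2 * c01, y * u0 == w1 * c10 + w2 * c11,
       y * - u3 == w1 * c20 + w2 * c21 & y * u2 == w1 * c30 + w2 * c31],
       - u1 * c10 - u0 * c00 + - u3 * c30 - u2 * c20 == 0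
     & - u1 * c11 - u0 * c01 + - u3 * c31 - u2 * c21 == 0] =
   [&& [&& e0 == 0, e1 == 0, e2 == 0 & e3 == 0], e4 == 0 & e5 == 0].
  rewrite -[y * - u1 == _]subr_eq0 -[y * u0 == _]subr_eq0 -[y * - u3 == _]subr_eq0.
  rewrite -[y * u2 == _]subr_eq0 -[e4 == 0]oppr_eq0 -[e5 == 0]oppr_eq0.
  have -> : y * - u1 - (w1 * c00 + w2 * c01) = e0 by rewrite /e0; ring.
  have -> : y * u0 - (w1 * c10 + w2 * c11) = e1 by rewrite /e1; ring.
  have -> : y * - u3 - (w1 * c20 + w2 * c21) = e2 by rewrite /e2; ring.
  have -> : y * u2 - (w1 * c30 + w2 * c31) = e3 by rewrite /e3; ring.
  have -> : - u1 * c10 - u0 * c00 + - u3 * c30 - u2 * c20 = - e4 by rewrite /e4; ring.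
  by have -> : - u1 * c11 - u0 * c01 + - u3 * c31 - u2 * c21 = - e5 by rewrite /e5; ring.
have pE v : pairing d (Qcocycle u v - Qcocycle v u) = e0 * coord v 0 + e1 * coord v 1
    + e2 * coord v 2 + e3 * coord v 3 + e4 * coord v 4 + e5 * coord v 5.
  exact: pairing_commutator.
apply/forallP/idP => [H|]; last first.
  case/and3P => /and4P[/eqP z0 /eqP z1 /eqP z2 /eqP z3] /eqP z4 /eqP z5 v.
  rewrite /dual_char pE z0 z1 z2 z3 z4 z5 !mul0r !addr0.
  by case: chi_prim => -[-> _] _.
pose v k r : row6 := unit_row k r.
have E (k : nat) (f : A) :
    (forall r, pairing d (Qcocycle u (v k r) - Qcocycle (v k r) u) = f * r) -> f == 0.
  move=> fE; apply/eqP; case: chi_prim => _; apply => r; rewrite -fE.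
  exact/eqP/H.
apply/and3P; split; [apply/and4P; split| |].
- by apply: (E 0%N) => r; rewrite pE !coord_unit_row //= ?mulr0n ?mulr1n; ring.
- by apply: (E 1%N) => r; rewrite pE !coord_unit_row //= ?mulr0n ?mulr1n; ring.
- by apply: (E 2%N) => r; rewrite pE !coord_unit_row //= ?mulr0n ?mulr1n; ring.
- by apply: (E 3%N) => r; rewrite pE !coord_unit_row //= ?mulr0n ?mulr1n; ring.
- by apply: (E 4%N) => r; rewrite pE !coord_unit_row //= ?mulr0n ?mulr1n; ring.
- by apply: (E 5%N) => r; rewrite pE !coord_unit_row //= ?mulr0n ?mulr1n; ring.
Qed.

Lemma dual_char_surj (psi : Qcenter 2 1 A -> C) : unit_char psi ->
  exists d, forall z, psi z = dual_char d z.
Proof.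
case=> p0 pD.
have /(primitive_char_dual chi_prim)[y yE] : unit_char (fun x : A => psi (x, 0)).
  by split=> // z w; rewrite -pD; congr psi; congr pair; rewrite addr0.
have /choice[M ME] (ij : 'I_(2 * 2) * 'I_(2 * 1)) :
    exists a, forall x, psi (0, x *: delta_mx ij.1 ij.2) = chi (a * x).
  apply: (primitive_char_dual chi_prim); split; first by rewrite scale0r.
  by move=> z w; rewrite -pD scalerDl; congr psi; congr pair; rewrite addr0.
exists (y, \matrix_(i, j) M (i, j)) => z.
have psum (I : Type) (r : seq I) (F : I -> Qcenter 2 1 A) :
    psi (\sum_(i <- r) F i) = \prod_(i <- r) psi (F i).
  by elim/big_rec2: _ => // i x w _ <-; rewrite pD.
have csum (I : Type) (r : seq I) (F : I -> A) :
    chi (\sum_(i <- r) F i) = \prod_(i <- r) chi (F i).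
  by case: chi_prim => -[c0 cD] _; elim/big_rec2: _ => // i x w _ <-; rewrite cD.
rewrite {1}(Qcenter_delta z) pD yE psum /dual_char /pairing.
case: (chi_prim) => -[_ cD] _; rewrite cD csum; congr (_ * _).
apply: eq_bigr => i _; rewrite psum csum; apply: eq_bigr => j _.
by rewrite (ME (i, j)) mxE.
Qed.

End Pairing.

Section FiniteLevel.
Variables (A : finComNzRingType) (pi : A) (N : nat).
Hypothesis chA : chain_ring pi N.
Variables (C : numClosedFieldType) (chi : A -> C).
Hypothesis chi_prim : primitive_char chi.

Local Notation cc := (@Qcocycle 2 1 A).

Definition char_dim (d : Qcenter 2 1 A) : nat :=
  (#|ann pi| ^ dim_len pi N d.1 (coef_quad d 0) (coef_quad d 1))%N.

Lemma level_dim k (rho : 'rV[A]_(2 * 2 + 2 * 1) * Qcenter 2 1 A -> 'M[C]_k) d :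
  ext_irr cc rho -> (forall z, rho (0, z) = (dual_char chi d z)%:M) -> k = char_dim d.
Proof.
move=> ir rE.
have := rep_dim (@QcocycleDl 2 1 A) (@QcocycleDr 2 1 A) ir (dual_char_unit chi_prim d) rE.
rewrite card_radical // card_mx mul1n -(ker_size_dim_len chA d.1 (coef_quad d 0) (coef_quad d 1)).
have ker0 : (0 < ker_size d.1 (coef_quad d 0) (coef_quad d 1))%N.
  have [j ->] := ker_size_square chA d.1 (coef_quad d 0) (coef_quad d 1).
  by rewrite expn_gt0 (ltnW (card_ann_pi_gt1 chA)).
rewrite mulnC => /eqP; rewrite eqn_pmul2l // eqn_exp2r // => /eqP.
by [].
Qed.

Lemma level_central k (rho : 'rV[A]_(2 * 2 + 2 * 1) * Qcenter 2 1 A -> 'M[C]_k) :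
  ext_irr cc rho -> exists d, forall z, rho (0, z) = (dual_char chi d z)%:M.
Proof.
move=> ir; have [psi [pc pE]] := central_char (@QcocycleDl 2 1 A) (@QcocycleDr 2 1 A) ir.
by have [d dE] := dual_char_surj chi_prim pc; exists d => z; rewrite pE dE.
Qed.

Lemma level_exists d : exists (rho : 'rV[A]_(2 * 2 + 2 * 1) * Qcenter 2 1 A -> 'M[C]_(char_dim d)),
  ext_irr cc rho /\ forall z, rho (0, z) = (dual_char chi d z)%:M.
Proof.
have [k [rho [ir rE]]] := central_rep_exists (@QcocycleDl 2 1 A) (@QcocycleDr 2 1 A)
  (dual_char_unit chi_prim d).
by have E := level_dim ir rE; case: _ / E rho ir rE => rho ir rE; exists rho.
Qed.

Lemma dual_char_inj d d' : (forall z, dual_char chi d z = dual_char chi d' z) -> d = d'.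
Proof.
move=> dd; have [cc' cp] := chi_prim; have [c0 cD] := cc'.
have eqc (a b : A) : (forall x, chi (a * x) = chi (b * x)) -> a = b.
  move=> ab; apply/eqP; rewrite -subr_eq0; apply/eqP; apply: cp => x.
  rewrite mulrBl cD unit_charN // ab divff //; exact: unit_char_neq0.
case: d d' dd => [y M] [y' M'] dd; congr pair.
  apply: eqc => x; have := dd (x, 0); rewrite /dual_char /pairing /=.
  have z0 (P : 'M[A]_(2 * 2, 2 * 1)) : \sum_i \sum_j P i j * (0 : 'M[A]_(2 * 2, 2 * 1)) i j = 0.
    by rewrite big1 // => i _; rewrite big1 // => j _; rewrite mxE mulr0.
  by rewrite !z0 !addr0.
apply/matrixP => i j; apply: eqc => x.
have := dd (0, x *: delta_mx i j); rewrite /dual_char /pairing /= !mulr0 !add0r.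
have E (P : 'M[A]_(2 * 2, 2 * 1)) : \sum_i0 \sum_j0 P i0 j0 * (x *: delta_mx i j) i0 j0 = P i j * x.
  rewrite (bigD1 i) //= (bigD1 j) //= !mxE !eqxx mulr1 !big1 ?addr0 //.
    move=> l li; rewrite big1 // => l' _; by rewrite !mxE (negPf li) !mulr0.
  by move=> l lj; rewrite !mxE (negPf lj) andbF !mulr0.
by rewrite !E.
Qed.

(** By [dim_len_le] the triple is divisible by [pi ^+ (N - m)]; the character therefore factors
    through a lower level, which [central_at_small] exploits. *)
Lemma char_dim_factor m d : (m <= N)%N -> (char_dim d <= #|ann pi| ^ m)%N ->
  exists d', forall z, dual_char chi d z = chi (pi ^+ (N - m) * pairing d' z).
Proof.
move=> mN; rewrite leq_exp2l ?(card_ann_pi_gt1 chA) // => /(dim_len_le chA mN).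
case=> y [[[[a0 a1] a2] a3] [[[[b0 b1] b2] b3] [yE aE bE]]].
move: aE bE; rewrite /coef_quad /qscale => -[a0E a1E a2E a3E] [b0E b1E b2E b3E].
pose M : 'M[A]_(2 * 2, 2 * 1) := \matrix_(i, j)
  (if j == 0 :> nat then nth 0 [:: a0; a1; a2; a3] i else nth 0 [:: b0; b1; b2; b3] i).
exists (y, M) => z; rewrite /dual_char /pairing /= yE; congr chi.
rewrite mulrDr mulrA mulr_sumr; congr (_ + _); apply: eq_bigr => i _.
rewrite mulr_sumr; apply: eq_bigr => j _; rewrite mulrA; congr (_ * _).
have -> : d.2 i j = coef d i j.
  by rewrite /coef; congr (d.2 _ _); apply: val_inj; rewrite /= inordK.
rewrite mxE; case: j => -[|[|//]] _ /=; by case: i => -[|[|[|[|//]]]] _ /=.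
Qed.

Lemma sum_char_dim (F : numFieldType) (f : nat -> F) :
  \sum_(d : A * 'M[A]_(2 * 2, 2 * 1)) f (dim_len pi N d.1 (coef_quad d 0) (coef_quad d 1)) =
  \sum_y \sum_a \sum_b f (dim_len pi N y a b).
Proof.
rewrite -(pair_bigA _ (fun y M => f (dim_len pi N y (coef_quad (y, M) 0) (coef_quad (y, M) 1)))) /=.
apply: eq_bigr => y _; rewrite pair_bigA /=.
pose h (M : 'M[A]_(2 * 2, 2 * 1)) : quad A * quad A := (coef_quad (y, M) 0, coef_quad (y, M) 1).
rewrite (reindex h) //=; exists (fun ab : quad A * quad A =>
  let: ((a0, a1, a2, a3), (b0, b1, b2, b3)) := ab in \matrix_(i, j)
  (if j == 0 :> nat then nth 0 [:: a0; a1; a2; a3] i else nth 0 [:: b0; b1; b2; b3] i)).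
  move=> M _; apply/matrixP => i j; rewrite mxE /coef_quad /coef /=.
  have -> : M i j = M (inord i : 'I_(3.+1)) (inord j : 'I_(1.+1)).
    by congr (M _ _); apply: val_inj; rewrite /= inordK.
  by case: j => -[|[|//]] _ /=; case: i => -[|[|[|[|//]]]] _ /=.
move=> [[[[a0 a1] a2] a3] [[[b0 b1] b2] b3]] _.
by rewrite /h /coef_quad /coef /= !mxE !inordK.
Qed.

End FiniteLevel.

From mathcomp Require Import finmap classical_sets cardinality.
Local Open Scope quotient_scope.
Local Open Scope ring_scope.

(** * Residue rings *)

Definition nonzero_ideal (R : comNzRingType) (I : {pred R}) : Prop :=
  exists2 x, x \in I & x != 0.

Section ResidueRings.
Variables (K : fieldExtType rat) (p : prime_idealr (ring_of_integers K)).
Local Notation O := (ring_of_integers K).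
Hypothesis p_neq0 : nonzero_ideal p.

Lemma pow_mem_ideal_powS (x : O) n : x \in p -> x ^+ n.+1 \in ideal_powS p n.
Proof.
move=> xp; elim: n => [|n IHn] //=.
by apply/asboolP; exists [:: (x, x ^+ n.+1)]; split; [move=> _ /[!inE] /eqP ->|rewrite big_seq1 -exprS].
Qed.

Lemma residues_listed n :
  exists s : seq {ideal_quot (ideal_powS p n)}, forall x, x \in s.
Proof.
have [l lp lin] := prime_number_in_prime_ideal p_neq0.
have [s sP] := finite_residues_exp K n.+1 lp.
exists [seq \pi_({ideal_quot (ideal_powS p n)}) r | r <- s] => x.
rewrite -[x]reprK; have [r rs [y ->]] := sP (repr x).
apply/mapP; exists r => //; apply/eqP; rewrite -Quotient.idealrBE.
by rewrite addrAC subrr add0r mulrC idealMr // pow_mem_ideal_powS.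
Qed.

(* The phantom argument [h] carries the finiteness of the quotient, so that *)
(* the type has a canonical finType structure. *)
Definition residue_ring (h : nonzero_ideal p) (n : nat) : Type :=
  {ideal_quot (ideal_powS p n)}.

End ResidueRings.

Section ResidueRingFinite.
Variables (K : fieldExtType rat) (p : prime_idealr (ring_of_integers K)).
Variables (h : nonzero_ideal p) (n : nat).
Local Notation O := (ring_of_integers K).

HB.instance Definition _ := GRing.ComNzRing.copy (residue_ring h n)
  {ideal_quot (ideal_powS p n)}.

Definition residue_enum : seq (residue_ring h n) := undup (projT1 (cid (residues_listed h n))).

Lemma mem_residue_enum x : x \in residue_enum.
Proof. by rewrite mem_undup; apply: (projT2 (cid (residues_listed h n))). Qed.

Lemma residue_pickleK : pcancel (fun x : residue_ring h n => index x residue_enum)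
  (fun i => nth None (map some residue_enum) i).
Proof.
by move=> x; rewrite (nth_map x) ?index_mem ?mem_residue_enum // nth_index // mem_residue_enum.
Qed.

HB.instance Definition _ := PCanIsCountable residue_pickleK.

Lemma residue_enumP : Finite.axiom residue_enum.
Proof. by move=> x; rewrite count_uniq_mem ?undup_uniq // mem_residue_enum. Qed.

HB.instance Definition _ := isFinite.Build (residue_ring h n) residue_enumP.

End ResidueRingFinite.

Section ResidueRingChain.
Variables (K : fieldExtType rat) (p : prime_idealr (ring_of_integers K)).
Variable (h : nonzero_ideal p).
Local Notation O := (ring_of_integers K).

Definition residue n (x : O) : residue_ring h n := \pi_({ideal_quot (ideal_powS p n)}) x.

Lemma residueD n : {morph @residue n : x y / x + y}. Proof. exact: rmorphD. Qed.
Lemma residueM n : {morph @residue n : x y / x * y}. Proof. exact: rmorphM. Qed.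
Lemma residue1 n : @residue n 1 = 1. Proof. exact: rmorph1. Qed.
Lemma residue0 n : @residue n 0 = 0. Proof. exact: rmorph0. Qed.
Lemma residueX n x k : @residue n (x ^+ k) = residue n x ^+ k. Proof. exact: rmorphXn. Qed.

Lemma residue_eq n x y : (residue n x == residue n y) = (x - y \in ideal_powS p n).
Proof. by rewrite Quotient.idealrBE. Qed.

Lemma residue_eq0 n x : (residue n x == 0) = (x \in ideal_powS p n).
Proof. by rewrite -(residue0 n) residue_eq subr0. Qed.

Lemma residue_surj n (x : residue_ring h n) : exists y, x = residue n y.
Proof. by exists (repr x); rewrite /residue reprK. Qed.

Lemma ideal_powS_le n x : x \in ideal_powS p n -> x \in p.
Proof. by elim: n x => [|n IHn] x // /ideal_powS_sub/IHn. Qed.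

Lemma invert_mod n (x : O) : x \notin p -> exists y, residue n x * residue n y = 1.
Proof.
move=> xp; suff [y E] : exists y, x * y - 1 \in ideal_powS p n.
  by exists y; apply/eqP; rewrite -residueM -(residue1 n) residue_eq.
elim: n => [|n [y E]].
  have [l lp lin] := prime_number_in_prime_ideal h.
  have [i [j [y [j0 E]]]] := power_collision x lp.
  exists (x ^+ j.-1); rewrite -exprS prednK //.
  have : x ^+ i * (1 - x ^+ j) \in p by rewrite E mulrC idealMr.
  rewrite prime_idealrM -[_ \in ideal_powS _ _]/(_ \in p) -(opprB 1) rpredN => /orP[|//].
  by case: i {E} => [|i /prime_idealrX]; rewrite ?idealr1 // (negPf xp).
(* Newton's step: the error 1 - x y is squared, which gains at least one power of p. *)
exists (y * (2 - x * y)).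
rewrite (_ : _ - 1 = - ((x * y - 1) * (x * y - 1))); last by ring.
rewrite rpredN /=; apply/asboolP; exists [:: (x * y - 1, x * y - 1)].
rewrite big_seq1; split=> // _ /[!inE] /eqP -> /=; split=> //.
exact: ideal_powS_le E.
Qed.

(** The length is n+1 because [ideal_powS p n] is p^(n+1). If pi^n were in p^(n+1), then u^(n+1)
    pi^n would be a multiple of pi^(n+1), so u would lie in p. *)
Lemma residue_chain_ring n : exists2 pi : residue_ring h n, chain_ring pi n.+1 &
  forall x, ~~ invertible (residue n x) = (x \in p).
Proof.
have [pi [u [pip up upi]]] := prime_uniformizer h.
have pi0 : pi != 0.
  have [x xp x0] := h; have [y yE] := upi x xp; apply/eqP => pi0; case/eqP: x0.
  have u0 : u != 0 by apply: contra up => /eqP ->; exact: idealr0.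
  by apply: (integers_mulfI u0); rewrite yE pi0 mul0r mulr0.
have upow k x : x \in ideal_powS p k -> exists y, u ^+ k.+1 * x = pi ^+ k.+1 * y.
  elim: k x => [|k IHk] x; first by move=> /upi[y yE]; exists y; rewrite !expr1.
  move=> /asboolP[s [sP ->]].
  elim: s sP => [|ab s IHs] sP; first by exists 0; rewrite big_nil !mulr0.
  have [|y yE] := IHs; first by move=> cd cds; apply: sP; rewrite inE cds orbT.
  have [/upi[a' aE] /IHk[b' bE]] := sP ab (mem_head _ _).
  exists (a' * b' + y); rewrite big_cons !mulrDr yE; congr (_ + _).
  by rewrite [u ^+ _]exprS [pi ^+ _]exprS mulrACA aE bE; ring.
have chA : chain_ring (residue n pi) n.+1.
  split=> //=.
  - move=> x; have [r ->] := residue_surj x.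
    have [rp|rp] := boolP (r \in p); last first.
      by right; have [y yE] := invert_mod n rp; exists (residue n y).
    left; have [y yE] := upi r rp; have [v vE] := invert_mod n up.
    exists (residue n (v * y)); rewrite -residueM mulrCA -yE !residueM.
    by rewrite mulrA [_ * residue n u]mulrC vE mul1r.
  - by apply/eqP; rewrite -residueX residue_eq0 pow_mem_ideal_powS.
  rewrite -residueX residue_eq0; apply/negP => /upow[y].
  rewrite [pi ^+ n.+1]exprSr mulrC -mulrA => E'.
  case/negP: up; apply: (@prime_idealrX _ _ _ n).
  have pin0 : pi ^+ n != 0.
    elim: (n) => [|m IHm]; first by rewrite expr0 oner_neq0.
    apply/eqP; rewrite exprS -[0](mulr0 pi) => /(integers_mulfI pi0) E0.
    by rewrite E0 eqxx in IHm.
  by rewrite (integers_mulfI pin0 E') mulrC idealMr.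
exists (residue n pi) => // x; apply/idP/idP.
  apply: contraR => xp; have [y yE] := invert_mod n xp.
  by apply/existsP; exists (residue n y); rewrite yE.
move=> xp; apply/(invertibleP chA).
have [y yE] := upi x xp; have [v vE] := invert_mod n up.
exists (residue n (v * y)); rewrite -residueM mulrCA -yE !residueM.
by rewrite mulrA [_ * residue n u]mulrC vE mul1r.
Qed.

(** Both numbers, multiplied by the number of non-units, give the size of the ring: fibres of
    multiplication by [pi] on one side, fibres of reduction modulo p on the other. *)
Lemma card_residue_ann n (pi : residue_ring h n) : chain_ring pi n.+1 ->
  (forall x, ~~ invertible (residue n x) = (x \in p)) ->
  #|ann pi| = ideal_card p.
Proof.
move=> chA inv.
have -> : ideal_card p = #|{: residue_ring h 0}|.
  pose f (x : residue_ring h 0) := \pi_({ideal_quot p}) (repr x).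
  have fP x : x \in [seq f y | y <- enum {: residue_ring h 0}].
    apply/mapP; exists (residue 0 (repr x)); first by rewrite mem_enum.
    rewrite -[LHS]reprK /f; apply/eqP; rewrite -Quotient.idealrBE -opprB rpredN.
    by rewrite -[_ \in p]/(_ \in ideal_powS p 0) -residue_eq /residue reprK.
  have fin : finite_set [set: {ideal_quot p}].
    apply/finite_seqP; exists [seq f y | y <- enum {: residue_ring h 0}].
    by apply/seteqP; split=> x //= _; exact: fP.
  rewrite /ideal_card cardE -(size_map f); apply: perm_size; apply: uniq_perm.
  - exact: fset_uniq.
  - rewrite map_inj_uniq ?enum_uniq // => x y /eqP; rewrite -Quotient.idealrBE.
    rewrite -[_ \in p]/(_ \in ideal_powS p 0) -residue_eq /residue !reprK.
    by move/eqP.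
  - by move=> x; rewrite in_fset_set // fP in_setT.
have inv0 : (0 < #|[set x : residue_ring h n | ~~ invertible x]|)%N.
  by apply/card_gt0P; exists 0; rewrite inE -(residue0 n) inv idealr0.
apply/eqP; rewrite -(eqn_pmul2r inv0).
have /= := sum_mul_pi chA (fun=> 1%N); rewrite !sum1_card.
rewrite -[X in _ = X]mulr_natl natn => E.
have cE : #|[set x : residue_ring h n | ~~ invertible x]| =
     #|[pred x : residue_ring h n | ~~ invertible x]|.
  by apply: eq_card => x; rewrite inE.
rewrite cE; apply/eqP; etransitivity; first exact: esym E.
pose red (x : residue_ring h n) : residue_ring h 0 := residue 0 (repr x).
have redE x y : (red (residue n x) == residue 0 y) = ~~ invertible (residue n (x - y)).
  rewrite inv residue_eq /=; rewrite -[repr _](subrK x) -addrA.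
  rewrite rpredDl //; apply: (@ideal_powS_le n).
  by rewrite -residue_eq /residue reprK.
rewrite -[LHS]sum1_card (partition_big red xpredT) //=.
rewrite -sum_nat_const; apply: eq_bigr => y _.
have [z ->] := residue_surj y.
rewrite sum1_card -[RHS](card_imset _ (addrI (residue n z))).
apply: eq_card => x; rewrite -[LHS]/(red x == residue 0 z); apply/idP/imsetP.
  have [w ->] := residue_surj x; rewrite redE => nw.
  by exists (residue n (w - z)) => //; rewrite -residueD addrC subrK.
case=> w; rewrite inE; have [w' ->] := residue_surj w => nw ->.
by rewrite -residueD redE addrAC subrr add0r.
Qed.

End ResidueRingChain.

From mathcomp Require Import finmap.
From mathcomp Require Import all_classical all_reals all_analysis.
From mathcomp Require Import complex.
Import numFieldNormedType.Exports.
Import Order.TTheory GRing.Theory Num.Theory.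
Local Open Scope classical_set_scope.
Local Open Scope quotient_scope.
Local Open Scope ring_scope.

(** * Continuous representations and finite levels *)

Section Reduction.
Variables (K : fieldExtType rat) (p : prime_idealr (ring_of_integers K)).
Variable h : nonzero_ideal p.
Local Notation o := (completion p).
Local Notation A n := (residue_ring h n).
Local Notation G := (Qgroup 2 1 o).

Definition cres n (x : o) : A n := cproj x n.

Lemma cres_zmod n : zmod_morphism (cres n). Proof. by []. Qed.
Lemma cres_monoid n : monoid_morphism (cres n). Proof. by []. Qed.

HB.instance Definition _ n := GRing.isZmodMorphism.Build o (A n) (cres n) (cres_zmod n).
HB.instance Definition _ n := GRing.isMonoidMorphism.Build o (A n) (cres n) (cres_monoid n).

Arguments cres : simpl never.

Definition reduce n (g : G) : Qgroup 2 1 (A n) := Qgroup_map (cres n) g.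

Lemma const_cproj (r : ring_of_integers K) n :
  quo_red (\pi_({ideal_quot (ideal_powS p n.+1)}) r) = \pi_({ideal_quot (ideal_powS p n)}) r.
Proof. exact: quo_red_pi. Qed.

Definition const_completion (r : ring_of_integers K) : o := Completion (const_cproj r).

Definition clift n (x : A n) : o :=
  const_completion (@repr _ {ideal_quot (ideal_powS p n)} x).

Lemma cres_clift n (x : A n) : cres n (clift x) = x.
Proof. exact: (@reprK _ {ideal_quot (ideal_powS p n)}). Qed.

Definition glift n (g : Qgroup 2 1 (A n)) : G :=
  (map_mx (@clift n) g.1, (clift g.2.1, map_mx (@clift n) g.2.2)).

Lemma reduce_glift n g : reduce n (glift g) = g.
Proof.
have liftK a b (M : 'M[A n]_(a, b)) : map_mx (cres n) (map_mx (@clift n) M) = M.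
  by apply/matrixP => i j; rewrite !mxE cres_clift.
by case: g => u [x M]; rewrite /reduce /glift /Qgroup_map /Qcenter_map /= cres_clift !liftK.
Qed.

Lemma reduceM n g g' : reduce n (Qmul g g') = Qmul (reduce n g) (reduce n g').
Proof. exact: Qgroup_mapM. Qed.

Lemma reduce1 n : reduce n (Qone 2 1 o) = Qone 2 1 (A n).
Proof. exact: Qgroup_map1. Qed.

Lemma reduce_le m n g g' : (m <= n)%N -> reduce n g = reduce n g' -> reduce m g = reduce m g'.
Proof.
move=> mn; rewrite /reduce /Qgroup_map /Qcenter_map => -[E1 E2 E3].
have mapE a b (M M' : 'M[o]_(a, b)) : map_mx (cres n) M = map_mx (cres n) M' ->
    map_mx (cres m) M = map_mx (cres m) M'.
  move/matrixP => E; apply/matrixP => i j; have := E i j; rewrite !mxE.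
  exact: cproj_le.
rewrite (mapE _ _ _ _ E1) (mapE _ _ _ _ E3); congr pair; congr pair.
exact: cproj_le E2.
Qed.

Lemma nbhs_level (g : G) n : nbhs (g : (G : topologicalType)) [set g' | reduce n g' = reduce n g].
Proof.
have nb (x : o) : nbhs x [set y | cproj y n = cproj x n] by exists n.
exists ([set u | map_mx (cres n) u = map_mx (cres n) g.1],
        [set z : Qcenter 2 1 o | Qcenter_map (cres n) z = Qcenter_map (cres n) g.2]).
  split=> /=.
    exists (fun i j => [set y | cproj y n = cproj (g.1 i j) n]) => [i j|u ug]; first exact: nb.
    by apply/matrixP => i j; rewrite !mxE; exact: ug.
  exists ([set y | cproj y n = cproj g.2.1 n], [set M | map_mx (cres n) M = map_mx (cres n) g.2.2]).
    split=> /=; first exact: nb.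
    exists (fun i j => [set y | cproj y n = cproj (g.2.2 i j) n]) => [i j|u ug]; first exact: nb.
    by apply/matrixP => i j; rewrite !mxE; exact: ug.
  by case=> x M [/= xE ME]; rewrite /Qcenter_map /= ME; congr pair; exact: xE.
by case=> u z [/= uE zE]; rewrite /reduce /Qgroup_map /= uE zE.
Qed.

Lemma nbhs_mx_level a b (M : 'M[o]_(a, b)) (B : set 'M[o]_(a, b)) : nbhs M B ->
  exists n, forall M' : 'M[o]_(a, b), (forall i j, cproj (M' i j) n = cproj (M i j) n) -> B M'.
Proof.
case=> P MP PB.
have /choice[f fP] (ij : 'I_a * 'I_b) : exists n, forall y, cproj y n = cproj (M ij.1 ij.2) n ->
    P ij.1 ij.2 y.
  by have [n _ nP] := MP ij.1 ij.2; exists n => y yE; apply: nP.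
exists (\max_ij f ij)%N => M' M'E; apply: PB => i j; apply: (fP (i, j)).
by apply: cproj_le (M'E i j); exact: (leq_bigmax (i, j)).
Qed.

Lemma level_nbhs (g : G) (B : set G) : nbhs (g : (G : topologicalType)) B ->
  exists n, forall g', reduce n g' = reduce n g -> B g'.
Proof.
case=> -[P1 P2] /= [/nbhs_mx_level[n1 n1P] [[P3 P4] /= [[n2 _ n2P] /nbhs_mx_level[n3 n3P]] P34]] P12.
exists (maxn n1 (maxn n2 n3)) => g' gE; apply: P12; split=> /=.
  apply: n1P => i j; have := reduce_le (leq_maxl _ _) gE.
  by case=> /matrixP/(_ i j); rewrite !mxE.
apply: P34; split=> /=.
  have := reduce_le (leq_trans (leq_maxl n2 n3) (leq_maxr n1 _)) gE.
  by case=> _ E _; apply: n2P.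
apply: n3P => i j; have := reduce_le (leq_trans (leq_maxr n2 n3) (leq_maxr n1 _)) gE.
by case=> _ _ /matrixP/(_ i j); rewrite !mxE.
Qed.

Lemma continuous_of_level (T : topologicalType) n (f : G -> T) :
  (forall g g', reduce n g = reduce n g' -> f g = f g') ->
  continuous (f : (G : topologicalType) -> T).
Proof.
move=> fE g B /= gB; apply: filterS (nbhs_level g n) => g' gE /=.
by rewrite (fE g' g) //; exact: nbhs_singleton.
Qed.

End Reduction.

(** * Absence of small subgroups in GL_k(C) *)

Section ComplexBounds.
Variable R : realType.
Local Notation C := (complexes R).

Lemma complex_norm_bound (z : C) : exists n : nat, `|z| <= n%:R.
Proof.
have [r rE] : exists r : R, `|z| = r%:C%C by eexists; exact: normc_def.
exists (Num.bound `|r|); rewrite rE -(rmorph_nat (real_complex R)) lecR.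
by apply: le_trans (ler_norm r) _; apply: ltW; apply: archi_boundP.
Qed.

Lemma geometric_small (z e : C) : e > 0 -> exists n : nat, `|z| * 2^-1 ^+ n < e.
Proof.
move=> e0; have [n nP] := complex_norm_bound (z / e); exists n.
have E : `|e| = e by rewrite ger0_norm ?ltW.
move: nP; rewrite normrM normfV E ler_pdivrMr // => nP.
rewrite exprVn ltr_pdivrMr ?exprn_gt0 //.
apply: le_lt_trans nP _; rewrite mulrC ltr_pM2l // -natrX ltr_nat ltn_expl //.
Qed.

Lemma complex_small (z e : C) (c : C) : (forall n, `|z| <= e * (3 / 4) ^+ n) -> z = 0.
Proof.
move=> H; apply/eqP; rewrite -normr_eq0; apply: contraT => z0.
have z_gt0 : 0 < `|z| by rewrite lt_def z0 normr_ge0.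
have [n nP] := geometric_small e z_gt0.
have e0 : 0 <= e by apply: le_trans (ltW z_gt0) _; have := H 0%N; rewrite mulr1.
(* Three factors 3/4 beat one factor 1/2, as 27/64 is at most 1/2. *)
suff le : e * (3 / 4) ^+ (3 * n) <= e * 2^-1 ^+ n.
  by have := lt_le_trans nP (le_trans (H _) le); rewrite (ger0_norm e0) ltxx.
apply: ler_wpM2l => //; rewrite exprM; apply: lerXn2r.
- by rewrite nnegrE exprn_ge0 // divr_ge0.
- by rewrite nnegrE invr_ge0.
rewrite (_ : (3 / 4) ^+ 3 = 27 / 64 :> C); last by field.
by rewrite ler_pdivrMr ?ltr0n // (_ : 2^-1 * 64 = 32 :> C) ?ler_nat //; field.
Qed.

End ComplexBounds.

Section NoSmallSubgroups.
Variables (K : fieldExtType rat) (p : prime_idealr (ring_of_integers K)).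
Variable h : nonzero_ideal p.
Local Notation o := (completion p).
Local Notation G := (Qgroup 2 1 o).
Variable R : realType.
Local Notation C := (complexes R).

(* If U is close to 1 then U^2 - 1 = 2 (U - 1) + (U - 1)^2 is about twice as *)
(* far from 1 as U, so a subgroup of matrices close to 1 is trivial. *)
Lemma cont_rep_level k (rho : (G : topGroupType) -> 'M[C]_k) : cont_rep rho ->
  exists n, forall g, reduce h n g = Qone 2 1 (residue_ring h n) -> rho g = 1%:M.
Proof.
case=> r1 rM rc.
(* Chosen so that k e is at most 1/2, which bounds the entries of [M *m M] by d / 2. *)
pose e : C := (2 * k.+1%:R)^-1.
have e0 : 0 < e by rewrite invr_gt0 mulr_gt0 ?ltr0n.
pose B := [set M : 'M[C]_k | forall i j, `|(1%:M : 'M[C]_k) i j - M i j| < e].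
have nB : nbhs (rho 1%g) B.
  rewrite r1; exists (fun i j => [set x | `|(1%:M : 'M[C]_k) i j - x| < e]) => [i j|M //].
  have := nbhsx_ballx ((1%:M : 'M[C]_k) i j) e e0.
  by rewrite -ball_normE.
have [n nP] := level_nbhs h (rc _ _ nB).
exists n => g0 g0n.
have bnd j : forall g, reduce h n g = Qone 2 1 _ -> forall a b, `|(rho g - 1%:M) a b| <= e * (3 / 4) ^+ j.
  elim: j => [|j IHj] g gn a b.
    rewrite mulr1 !mxE distrC; apply: ltW; have := nP g; rewrite gn reduce1 => /(_ erefl).
    by move/(_ a b); rewrite !mxE.
  have ggn : reduce h n (Qmul g g) = Qone 2 1 _ by rewrite reduceM gn Qmul1.
  pose M := rho g - 1%:M.
  have E : rho (Qmul g g) - 1%:M = M *+ 2 + M *m M.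
    rewrite (rM g g) /M mulmxBl !mulmxBr !mulmx1 mul1mx mulr2n.
    move: (rho g *m rho g) (rho g) (1%:M : 'M[C]_k) => Y X I.
    by apply/matrixP => i l; rewrite !mxE; ring.
  have M0 a' b' : `|M a' b'| <= e.
    apply: le_trans (IHj g gn a' b') _; apply: ler_piMr; first exact: ltW.
    apply: exprn_ile1; first by rewrite divr_ge0 ?ler0n.
    by rewrite ler_pdivrMr ?ltr0n // mul1r ler_nat.
  set d := e * (3 / 4) ^+ j.
  have Md a' b' : `|M a' b'| <= d by exact: IHj.
  rewrite exprSr [e * _]mulrA -/d -/M.
  have d0 : 0 <= d by apply: le_trans (Md a b); rewrite normr_ge0.
  have gg : `|(rho (Qmul g g) - 1%:M) a b| <= d := IHj _ ggn a b; move: M E M0 Md gg => M E M0 Md gg.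
  have MM : `|(M *m M) a b| <= d / 2.
    rewrite mxE; apply: le_trans (ler_norm_sum _ _ _) _.
    apply: (@le_trans _ _ (\sum_(l < k) (e * d))).
      by apply: ler_sum => l _; rewrite normrM; apply: ler_pM.
    rewrite sumr_const card_ord -[_ *+ k]mulr_natr mulrAC mulrC; apply: ler_wpM2l => //.
    rewrite /e invfM -mulrA ler_piMr ?invr_ge0 // mulrC ler_pdivrMr ?ltr0n // mul1r.
    by rewrite ler_nat.
  have M2 : `|M a b| * 2 <= d + d / 2.
    rewrite -[X in _ * X <= _]normr_nat -normrM mulr_natr;
      apply: le_trans (_ : `|(rho (Qmul g g) - 1%:M) a b| + `|(M *m M) a b| <= _).
      by have -> : M a b *+ 2 = (rho (Qmul g g) - 1%:M) a b - (M *m M) a b;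
        [rewrite E [in RHS]mxE addrK mulmxnE | exact: ler_normB].
    by apply: lerD.
  move: M2; rewrite -ler_pdivlMr ?ltr0n // => /le_trans; apply.
  by rewrite (_ : (d + d / 2) / 2 = d * (3 / 4)) //; field.
apply/eqP; rewrite -subr_eq0; apply/eqP/matrixP => a b; rewrite [RHS]mxE.
by apply: (@complex_small _ _ e) => // j; apply: bnd.
Qed.
End NoSmallSubgroups.

Lemma card_fset_set_image (T : finType) (U : choiceType) (D : {pred T}) (f : T -> U)
    (S : set U) : {in D &, injective f} ->
    (forall c, S c <-> exists2 d, d \in D & f d = c) ->
  finite_set S /\ #|` fset_set S| = #|D|.
Proof.
move=> fI SE.
have mS c : (c \in [seq f d | d <- enum D]) = (c \in S).
  apply/mapP/idP => [[d]|]; first by rewrite mem_enum => dD ->; rewrite inE; apply/SE; exists d.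
  by rewrite inE => /SE[d dD <-]; exists d => //; rewrite mem_enum.
have fS : finite_set S.
  apply/finite_seqP; exists [seq f d | d <- enum D].
  by apply/seteqP; split=> c /=; rewrite mS inE.
split=> //; rewrite cardE -(size_map f); apply: perm_size; apply: uniq_perm.
- exact: fset_uniq.
- by rewrite map_inj_in_uniq ?enum_uniq // => x y; rewrite !mem_enum; exact: fI.
- by move=> c; rewrite in_fset_set // mS.
Qed.

(** * Twist classes and central characters *)

Section Transport.
Variables (K : fieldExtType rat) (p : prime_idealr (ring_of_integers K)).
Variable h : nonzero_ideal p.
Local Notation o := (completion p).
Local Notation G := (Qgroup 2 1 o : topGroupType).
Local Notation A n := (residue_ring h n).
Variable R : realType.
Local Notation C := (complexes R).
Local Notation Zmap n := (Qcenter_map (cres h n)).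

Lemma reduceV n (g g' : Qgroup 2 1 o) : reduce h n g = reduce h n g' ->
  reduce h n (Qmul (Qinv g') g) = Qone 2 1 (A n).
Proof. by move=> E; rewrite reduceM E -reduceM QmulN reduce1. Qed.

Lemma reduce_center n z : reduce h n (0, z) = (0, Zmap n z).
Proof. by rewrite /reduce /Qgroup_map /= map_mx0. Qed.

Section Factor.
Variables (k n : nat) (rho : G -> 'M[C]_k).
Hypothesis rho_rep : cont_rep rho.
Hypothesis rho_level : forall g, reduce h n g = Qone 2 1 (A n) -> rho g = 1%:M.

Lemma rep_eq_level g g' : reduce h n g = reduce h n g' -> rho g = rho g'.
Proof.
case: rho_rep => r1 rM _ E.
have gE : g = (g' * Qmul (Qinv g') g)%g :> G.
  by rewrite -[(_ * _)%g]/(Qmul g' (Qmul (Qinv g') g)) QmulA QmulrN Qmul1.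
by rewrite gE rM (rho_level (reduceV E)) mulmx1.
Qed.

Definition level_rep (g : 'rV[A n]_(2 * 2 + 2 * 1) * Qcenter 2 1 (A n)) : 'M[C]_k :=
  rho (glift g).

Lemma level_repE g : rho g = level_rep (reduce h n g).
Proof. by apply: rep_eq_level; rewrite reduce_glift. Qed.

Lemma level_rep_ext : ext_rep (@Qcocycle 2 1 (A n)) level_rep.
Proof.
case: rho_rep => r1 rM _; split.
  by rewrite -[(0, 0)]/(Qone 2 1 (A n)) -(reduce1 h n) -level_repE -r1.
move=> g g'; rewrite /level_rep -rM; apply: rep_eq_level.
by rewrite reduce_glift [reduce _ _ (_ * _)%g]reduceM !reduce_glift.
Qed.

End Factor.

Lemma level_rep_irr k n (rho : G -> 'M[C]_k) : irr_rep rho ->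
  (forall g, reduce h n g = Qone 2 1 (A n) -> rho g = 1%:M) ->
  ext_irr (@Qcocycle 2 1 (A n)) (level_rep rho (n := n)).
Proof.
case=> k0 rr ir rl; split=> //; first exact: level_rep_ext.
move=> W Ws W0; apply: ir => // g; rewrite (level_repE rr rl); exact: Ws.
Qed.

Lemma irr_of_level k n (rho : 'rV[A n]_(2 * 2 + 2 * 1) * Qcenter 2 1 (A n) -> 'M[C]_k) :
  ext_irr (@Qcocycle 2 1 (A n)) rho -> irr_rep (fun g : G => rho (reduce h n g)).
Proof.
case=> k0 [r1 rM] ir; split=> //.
  split.
  - by rewrite -r1 -[(0, 0)]/(Qone 2 1 (A n)) -(reduce1 h n).
  - by move=> g g'; rewrite -rM -[ext_mul _ _ _]/(Qmul _ _) -reduceM.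
  - by apply: (@continuous_of_level _ _ h _ n) => g g' ->.
move=> W Ws W0; apply: ir => // g; rewrite -(reduce_glift g); exact: Ws.
Qed.

Lemma common_level k (rho : G -> 'M[C]_k) (m : nat) : cont_rep rho ->
  exists2 n, (m <= n)%N & forall g, reduce h n g = Qone 2 1 (A n) -> rho g = 1%:M.
Proof.
move=> rc; have [n nP] := cont_rep_level h rc.
exists (maxn m n); first exact: leq_maxl.
move=> g gE; apply: nP; rewrite -(reduce1 h n); apply: (reduce_le (leq_maxr m n)).
by rewrite gE reduce1.
Qed.

Lemma irr_center_scalar k (rho : G -> 'M[C]_k) z : irr_rep rho -> exists a, rho (0, z) = a%:M.
Proof.
move=> ir; have [_ rr _] := ir; have [n _ nP] := common_level 0 rr.
have [psi [_ pE]] := central_char (@QcocycleDl 2 1 _) (@QcocycleDr 2 1 _) (level_rep_irr ir nP).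
by exists (psi (Zmap n z)); rewrite (level_repE rr nP) reduce_center pE.
Qed.

(** A one-dimensional twist is trivial on the centre ([hom_center_trivial]), and the centre acts by
    scalars, which an isomorphism preserves. Conversely, both representations factor through a
    common finite level, where [same_central_twist] applies. *)
Lemma twist_equiv_center k (rho sigma : G -> 'M[C]_k) : irr_rep rho -> irr_rep sigma ->
  twist_equiv rho sigma <-> forall z, sigma (0, z) = rho (0, z).
Proof.
move=> ri si; have [k0 rr _] := ri; have [_ sr _] := si; split.
  case=> chi [chi1 chiM _] [B Bu BE] z.
  have chiz : chi (0, z) 0 0 = 1.
    apply: (@hom_center_trivial _ _ (fun g => chi g 0 0)).
      by rewrite -[Qone 2 1 _]/(1%g : G) chi1 mxE.
    by move=> g g'; rewrite -[Qmul g g']/((g * g')%g : G) chiM mxE big_ord1.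
  have [a aE] := irr_center_scalar z ri.
  have := BE (0, z); rewrite /twist chiz scale1r aE => /(congr1 (mulmx^~ (invmx B))).
  by rewrite mulmxK // => ->; rewrite mul_mx_scalar -scalemxAl mulmxV // scalemx1.
move=> sE; have [n1 _ n1P] := common_level 0 rr.
have [n n1n sl] := common_level n1 sr.
have rl g : reduce h n g = Qone 2 1 (A n) -> rho g = 1%:M.
  move=> gE; apply: n1P; rewrite -(reduce1 h n1); apply: (reduce_le n1n).
  by rewrite gE reduce1.
have ri' := level_rep_irr ri rl; have si' := level_rep_irr si sl.
have [psi [pc pE]] := central_char (@QcocycleDl 2 1 _) (@QcocycleDr 2 1 _) ri'.
have pE' z : level_rep sigma (n := n) (0, z) = (psi z)%:M.
  rewrite -pE /level_rep.
  have red0 : reduce h n (0, (clift z.1, map_mx (@clift _ _ h n) z.2)) = (0, z).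
    by have := reduce_glift (0, z); rewrite /reduce /Qgroup_map /= map_mx0 => -[_ ->].
  have E : reduce h n (glift (0, z)) = reduce h n (0, (clift z.1, map_mx (@clift _ _ h n) z.2)).
    by rewrite reduce_glift red0.
  by rewrite (rep_eq_level sr sl E) (rep_eq_level rr rl E) sE.
have [chi [B [chi1 chiM Bu BE]]] :=
  same_central_twist (@QcocycleDl 2 1 _) (@QcocycleDr 2 1 _) si' ri' pc pE' pE.
exists (fun g => (chi (reduce h n g))%:M).
  split.
  - by rewrite -[reduce h n 1%g]/(reduce h n (Qone 2 1 o)) reduce1 chi1.
  - move=> g g'; rewrite -scalar_mxM -chiM; congr (chi _)%:M; exact: reduceM.
  - by apply: (@continuous_of_level _ _ h _ n) => g g' ->.
exists B => // g; rewrite /twist mxE eqxx mulr1n (level_repE sr sl) (level_repE rr rl).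
exact: BE.
Qed.

End Transport.

(** * Counting twist classes by dimension *)

Section Counting.
Variables (K : fieldExtType rat) (p : prime_idealr (ring_of_integers K)).
Variable h : nonzero_ideal p.
Local Notation o := (completion p).
Local Notation G := (Qgroup 2 1 o : topGroupType).
Local Notation A n := (residue_ring h n).
Variable R : realType.
Local Notation C := (complexes R).
Local Notation Zmap n := (Qcenter_map (cres h n)).

Lemma Zmap_surj n (w : Qcenter 2 1 (A n)) : exists z, w = Zmap n z.
Proof.
exists (clift w.1, map_mx (@clift _ _ h n) w.2).
by have := reduce_glift (0, w); rewrite /reduce /Qgroup_map /= => -[_ ->].
Qed.

Definition uniformizer n (pi : A n) := chain_ring pi n.+1 /\
  forall x, ~~ invertible (residue h n x) = (x \in p).

Lemma uniformizer_exists n : exists pi : A n, uniformizer pi.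
Proof. by have [pi ? ?] := residue_chain_ring h n; exists pi. Qed.

Lemma residue_ideal_powS n k (pi : A n) (r : ring_of_integers K) : uniformizer pi ->
  r \in ideal_powS p k -> exists y, residue h n r = pi ^+ k.+1 * y.
Proof.
case=> chA inv; have mem x : x \in p -> exists y, residue h n x = pi * y.
  by rewrite -inv => /(invertibleP chA).
elim: k r => [|k IHk] r; first by move=> /mem; rewrite expr1.
move=> /asboolP[s [sP ->]]; elim: s sP => [|ab s IHs] sP.
  by exists 0; rewrite big_nil residue0 mulr0.
have [|y yE] := IHs; first by move=> cd cds; apply: sP; rewrite inE cds orbT.
have [/mem[a' aE] /IHk[b' bE]] := sP ab (mem_head _ _).
exists (a' * b' + y); rewrite big_cons residueD residueM yE aE bE mulrDr; congr (_ + _).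
by rewrite [pi ^+ k.+2]exprS mulrACA.
Qed.

(** Such an x becomes a multiple of [pi ^+ m.+1] at level n, and [pi ^+ n.+1 = 0] there. *)
Lemma cres_kernel m n (pi : A n) (x : o) : (m <= n)%N -> uniformizer pi ->
  cres h m x = 0 -> pi ^+ (n - m) * cres h n x = 0.
Proof.
move=> mn upi x0.
have [r rE] := residue_surj (cres h n x).
have : r \in ideal_powS p m.
  rewrite -(residue_eq0 h) -x0; apply/eqP.
  have E : cproj (@const_completion K p r) n = cproj x n by exact: esym rE.
  exact: (cproj_le mn E).
rewrite rE => /(residue_ideal_powS upi)[y ->].
case: upi => chA _; rewrite mulrA -exprD addnS subnK //.
by rewrite (eqP (_ : pi ^+ n.+1 == 0)) ?mul0r // (chain_pow_eq0 chA).
Qed.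

Section AtLevel.
Variables (n : nat) (pi : A n) (chi : A n -> C).
Hypotheses (pi_unif : uniformizer pi) (chi_prim : primitive_char chi).

Let chA : chain_ring pi n.+1 := proj1 pi_unif.

Definition central_at k (rho : G -> 'M[C]_k) d :=
  forall z, rho (0, z) = (dual_char chi d (Zmap n z))%:M.

Lemma central_rep_at d : exists rho : G -> 'M[C]_(char_dim pi n.+1 d),
  [/\ irr_rep rho, central_at rho d &
      forall g, reduce h n g = Qone 2 1 (A n) -> rho g = 1%:M].
Proof.
have [rho [ir rE]] := level_exists chA chi_prim d.
exists (fun g => rho (reduce h n g)); split; first exact: irr_of_level.
  by move=> z; rewrite reduce_center rE.
by move=> g ->; case: ir => _ [].
Qed.

Lemma central_at_level k (rho : G -> 'M[C]_k) : irr_rep rho ->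
  (forall g, reduce h n g = Qone 2 1 (A n) -> rho g = 1%:M) ->
  exists2 d, central_at rho d & k = char_dim pi n.+1 d.
Proof.
move=> ir rl; have [_ rr _] := ir; have ir' := level_rep_irr ir rl.
have [d dE] := level_central chi_prim ir'; exists d.
  by move=> z; rewrite (level_repE rr rl) reduce_center dE.
exact: (level_dim chA chi_prim ir' dE).
Qed.

Lemma central_at_inj k l (rho : G -> 'M[C]_k) (sigma : G -> 'M[C]_l) d d' :
  (0 < k)%N -> (0 < l)%N -> central_at rho d -> central_at sigma d' ->
  (forall z a, rho (0, z) = a%:M -> sigma (0, z) = a%:M) -> d = d'.
Proof.
move=> k0 l0 rd sd E; apply: (dual_char_inj chi_prim) => w.
have [z ->] := Zmap_surj w; have := E z _ (rd z); rewrite sd.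
move/matrixP/(_ (Ordinal l0) (Ordinal l0)); rewrite !mxE eqxx !mulr1n.
by [].
Qed.

End AtLevel.

(* A character of the centre that gives dimension at most q^(n+1) is trivial on *)
(* the kernel of the reduction to level n. *)
Lemma central_at_small n (pi : A n) (chi : A n -> C) k (rho : G -> 'M[C]_k) :
  uniformizer pi -> primitive_char chi -> irr_rep rho ->
  (k <= ideal_card p ^ n.+1)%N ->
  exists2 d, central_at chi rho d & k = char_dim pi n.+1 d.
Proof.
move=> upi cprim ir kn; have [k0 rr _] := ir.
have [m nm rl] := common_level h n rr.
have [pi' upi'] := uniformizer_exists m.
have [chi' cprim'] := primitive_char_exists C (proj1 upi').
have [d' rd' kE] := central_at_level upi' cprim' ir rl.
have [d'' d''E] : exists d'', forall z, dual_char chi' d' z =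
    chi' (pi' ^+ (m - n) * pairing d'' z).
  have := char_dim_factor (proj1 upi') chi' (m := n.+1) (d := d').
  rewrite -subSS; apply=> //; rewrite -kE (card_residue_ann (proj1 upi') (proj2 upi')) //.
have factor z : Zmap n z = 0 -> dual_char chi' d' (Zmap m z) = 1.
  move=> z0; rewrite d''E.
  have z1 : cres h n z.1 = 0 by have := congr1 fst z0.
  have z2 i j : cres h n (z.2 i j) = 0.
    by have := congr1 snd z0 => /matrixP/(_ i j); rewrite !mxE.
  rewrite (_ : _ * _ = 0); first by case: cprim' => -[].
  rewrite /pairing /= mulrDr mulrCA (cres_kernel nm upi' z1) mulr0 add0r mulr_sumr.
  rewrite big1 // => i _; rewrite mulr_sumr big1 // => j _.
  by rewrite mxE mulrCA (cres_kernel nm upi' (z2 i j)) mulr0.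
have factorE z z' : Zmap n z = Zmap n z' ->
    dual_char chi' d' (Zmap m z) = dual_char chi' d' (Zmap m z').
  move=> E; have := factor (z - z').
  have ZB l u v : Zmap l (u - v) = Zmap l u - Zmap l v.
    apply: (addIr (Zmap l v)); rewrite -Qcenter_mapD !subrK //.
  rewrite !ZB E subrr => /(_ erefl).
  have du := dual_char_unit cprim' d'; case: (du) => _ ->.
  rewrite (unit_charN _ du) => /divr1_eq //.
have /choice[lft lftE] (w : Qcenter 2 1 (A n)) : exists z, w = Zmap n z := Zmap_surj w.
have pu : unit_char (fun w => dual_char chi' d' (Zmap m (lft w))).
  have [d0 dD] := dual_char_unit cprim' d'; split=> [|w w'].
    by apply: factor; rewrite -lftE.
  by rewrite -dD -Qcenter_mapD; apply: factorE; rewrite Qcenter_mapD -!lftE.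
have [d dE] := dual_char_surj cprim pu.
have rd : central_at chi rho d.
  by move=> z; rewrite rd' -dE; congr _%:M; apply: factorE; rewrite -lftE.
exists d => //.
(* To compare dimensions, a representation built from d at level n is viewed at level m: it has the
   central character of [rho], hence the same dimension. *)
have [sigma [si sd sl]] := central_rep_at upi cprim d; have [l0 sr _] := si.
have sl' g : reduce h m g = Qone 2 1 (A m) -> sigma g = 1%:M.
  move=> gE; apply: sl; rewrite -(reduce1 h n); apply: (reduce_le nm).
  by rewrite gE reduce1.
have [d3 sd3 ->] := central_at_level upi' cprim' si sl'.
rewrite kE; congr (char_dim _ _ _); apply: (central_at_inj cprim' k0 l0 rd' sd3) => z a.
rewrite rd sd => /matrixP/(_ (Ordinal k0) (Ordinal k0)); rewrite !mxE eqxx !mulr1n.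
by move=> ->.
Qed.

Lemma twist_classes_count n (pi : A n) k : uniformizer pi -> (0 < k)%N ->
  (k <= ideal_card p ^ n.+1)%N ->
  finite_set (twist_isoclasses C G k) /\
  num_twist_isoclasses C G k =
    #|[pred d : A n * 'M[A n]_(2 * 2, 2 * 1) | char_dim pi n.+1 d == k]|.
Proof.
move=> upi k0 kn; have [chi cprim] := primitive_char_exists C (proj1 upi).
have /choice[rep repP] (d : A n * 'M[A n]_(2 * 2, 2 * 1)) : exists rho : G -> 'M[C]_k,
    char_dim pi n.+1 d = k -> irr_rep rho /\ central_at chi rho d.
  have [kE|kE] := eqVneq (char_dim pi n.+1 d) k; last first.
    by exists (fun=> 0) => /eqP; rewrite (negPf kE).
  have [rho [ri rd _]] := central_rep_at upi cprim d.
  by case: _ / kE in rho ri rd *; exists rho.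
pose cls (rho : G -> 'M[C]_k) := [set sigma | irr_rep sigma /\ twist_equiv rho sigma].
have clsE (rho rho' : G -> 'M[C]_k) : irr_rep rho -> irr_rep rho' ->
    (forall z, rho (0, z) = rho' (0, z)) -> cls rho = cls rho'.
  move=> ri ri' E; apply/seteqP; split=> sigma [si] /= /(twist_equiv_center h) H.
    by split=> //; apply/(twist_equiv_center h) => // z; rewrite -E; apply: H.
  by split=> //; apply/(twist_equiv_center h) => // z; rewrite E; apply: H.
apply: (card_fset_set_image (f := fun d => cls (rep d))).
  move=> d d' /eqP/repP[ri rd] /eqP/repP[ri' rd'] E.
  have : cls (rep d) (rep d').
    by rewrite E; split=> //; apply/(twist_equiv_center h).
  case=> _ /(twist_equiv_center h) H.
  apply: (central_at_inj cprim k0 k0 rd rd') => z a <-; exact: H.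
move=> c; split.
  case=> rho ri <-; have [d rd kE] := central_at_small upi cprim ri kn.
  exists d; first by rewrite inE -kE.
  have [ri' rd'] := repP d (esym kE).
  by apply: clsE => // z; rewrite rd rd'.
by case=> d /eqP/repP[ri rd] <-; exists (rep d).
Qed.

End Counting.

(** * The Dirichlet series *)

Section ComplexPowers.
Variable R : realType.
Local Notation C := (complexes R).

Lemma cexpD (z w : C) : cexp (z + w) = cexp z * cexp w.
Proof.
case: z w => [a b] [c d]; rewrite /cexp /= expRD cosD sinD.
by apply/eqP; rewrite eq_complex /=; apply/andP; split; apply/eqP; ring.
Qed.

Lemma norm_cexp (z : C) : `|cexp z| = (expR (complex.Re z))%:C%C.
Proof.
rewrite normc_def /cexp /=; congr (_%:C)%C.
by rewrite !exprMn -mulrDr cos2Dsin2 mulr1 sqrtr_sqr ger0_norm // expR_ge0.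
Qed.

Lemma natpowM a b (s : C) : (0 < a)%N -> (0 < b)%N ->
  natpow (a * b) s = natpow a s * natpow b s.
Proof.
move=> a0 b0; rewrite /natpow -cexpD -mulrDr natrM lnM ?posrE ?ltr0n //.
by rewrite rmorphD.
Qed.

Lemma natpow1 (s : C) : natpow 1 s = 1.
Proof.
rewrite /natpow ln1 mulr0 /cexp /= expR0 cos0 sin0 mulr1 mulr0.
by [].
Qed.

Lemma natpowX a e (s : C) : (0 < a)%N -> natpow (a ^ e) s = natpow a s ^+ e.
Proof.
move=> a0; elim: e => [|e IHe]; first by rewrite expn0 natpow1.
by rewrite expnS natpowM ?expn_gt0 ?a0 // IHe exprS.
Qed.

Lemma natpow_neq0 a (s : C) : natpow a s != 0.
Proof.
rewrite -normr_eq0 norm_cexp -(rmorph0 (real_complex R)).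
by rewrite (inj_eq (fmorph_inj _)) gt_eqF // expR_gt0.
Qed.

Lemma norm_natpow_le a (s : C) n : (1 < a)%N -> n%:R < complex.Re s ->
  `|natpow a (- s)| <= (a%:R ^+ n)^-1.
Proof.
move=> a1 sn; rewrite norm_cexp.
have a0 : (0 < a)%N by exact: ltnW.
have -> : complex.Re (- s * (ln a%:R)%:C%C) = - complex.Re s * ln a%:R.
  by case: s sn => x y _ /=; rewrite mulr0 oppr0 addr0.
have -> : (a%:R ^+ n)^-1 = ((a%:R ^+ n)^-1)%:C%C :> C.
  by rewrite fmorphV rmorphXn /= rmorph_nat.
rewrite lecR -[leRHS]lnK ?posrE ?invr_gt0 ?exprn_gt0 ?ltr0n // ler_expR.
rewrite lnV ?posrE ?exprn_gt0 ?ltr0n // lnXn ?ltr0n // -[ln _ *+ n]mulr_natl -mulNr.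
apply: ler_wpM2r; first by rewrite ln_ge0 // ler1n.
by rewrite lerN2 ltW.
Qed.

End ComplexPowers.

Section SmallParameter.
Variables (F : numFieldType) (q : nat) (t : F).
Hypotheses (q1 : (1 < q)%N) (t0 : t != 0) (ts : `|t| <= (q%:R ^+ 10)^-1).

(** The hypothesis gives q^8 |t| at most 1/q^2, hence at most 1/4. This bounds the four ratios of
    [seqS_bound] and keeps all denominators of the closed forms away from 0. *)
Lemma zeta_approx : exists B : F, forall n,
  `|q%:R ^+ (9 * n) * seqS (q%:R^-1) t n - zeta_value (q%:R) t| <= B * 2^-1 ^+ n.
Proof.
have Q0 : 0 < q%:R :> F by rewrite ltr0n ltnW.
have Qn0 : q%:R != 0 :> F by rewrite gt_eqF.
have Q1 : 1 <= q%:R :> F by rewrite ler1n ltnW.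
have Q8 : q%:R ^+ 8 * `|t| <= 4^-1.
  apply: (@le_trans _ _ (q%:R ^+ 8 * (q%:R ^+ 10)^-1)).
    by apply: ler_wpM2l => //; rewrite exprn_ge0 ?ler0n.
  rewrite (_ : q%:R ^+ 8 / q%:R ^+ 10 = (q%:R ^+ 2)^-1); last by field.
  rewrite lef_pV2 ?posrE ?exprn_gt0 ?ltr0n ?(ltnW q1) //.
  by rewrite -natrX ler_nat (@leq_exp2r 2 _ 2).
have Qle k : (k <= 8)%N -> q%:R ^+ k * `|t| <= 4^-1.
  move=> k8; apply: (le_trans _ Q8); apply: ler_wpM2r => //.
  by apply: ler_weXn2l.
have tle : `|t| <= 4^-1 by have := Qle 0%N isT; rewrite mul1r.
have le41 : 4^-1 <= 1 :> F by rewrite invf_le1 ?ltr0n // ler1n.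
have t1 : `|t| <= 1 by exact: le_trans tle le41.
have nrm k j : (k <= 8)%N -> `|q%:R ^+ k * t ^+ j.+1| <= 4^-1.
  move=> k8; rewrite normrM !normrX normr_nat exprS mulrA.
  apply: le_trans (Qle k k8); apply: ler_piMr; last by rewrite exprn_ile1.
  by rewrite mulr_ge0 ?exprn_ge0 ?ler0n.
have neq1 (r : F) : `|r| <= 4^-1 -> 1 - r != 0.
  move=> rle; apply/eqP => /eqP; rewrite subr_eq0 => /eqP E.
  have lt41 : 4^-1 < 1 :> F by rewrite invf_lt1 ?ltr0n // ltr1n.
  by have := le_lt_trans rle lt41; rewrite -E normr1 ltxx.
have uneq k : (k <= 8)%N -> t - q%:R^-1 ^+ k != 0.
  move=> k8; rewrite subr_eq0; apply/eqP => tE.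
  have /neq1 := nrm k 0%N k8; rewrite expr1 {1}tE -exprMn divff // expr1n subrr eqxx.
  by [].
have r1 : `|q%:R ^+ 9 * t ^+ 3| <= 4^-1.
  rewrite (_ : _ * _ = (q%:R ^+ 8 * t ^+ 1) * ((q%:R ^+ 1 * t ^+ 1) * t)); last by ring.
  rewrite normrM -[leRHS]mulr1; apply: ler_pM => //; first exact: nrm.
  rewrite normrM -[leRHS]mulr1; apply: ler_pM => //.
  exact: le_trans (nrm 1%N 0%N isT) le41.
have u30 : 1 - q%:R^-1 ^+ 3 != 0 :> F.
  rewrite subr_eq0; apply/eqP => E.
  have : (q ^ 3)%:R = 1 :> F by rewrite natrX -[LHS]mulr1 {2}E -exprMn divff // expr1n.
  by move/eqP; rewrite -[1]/(1%:R) eqr_nat -(exp1n 3) eqn_exp2r // gtn_eqF.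
have V : (q%:R^-1 : F)^-1 = q%:R by rewrite invrK.
have := @seqS_bound F q%:R^-1 t; rewrite V; apply => //.
- by rewrite invr_eq0.
- exact: (uneq 1%N).
- exact: uneq.
- exact: uneq.
- exact: neq1.
- by apply: neq1; apply: nrm.
- by apply: neq1; apply: (nrm 5%N 0%N).
- by apply: neq1; apply: nrm.
- by apply: neq1; apply: (nrm 4%N 0%N).
- by apply: nrm.
- by apply: (nrm 5%N 0%N).
- by apply: nrm.
Qed.

End SmallParameter.

Section Main.
Variables (R : realType) (K : fieldExtType rat).
Variable p : prime_idealr (ring_of_integers K).
Hypothesis h : nonzero_ideal p.
Local Notation C := (complexes R).
Local Notation G := (Qgroup 2 1 (completion p) : topGroupType).
Local Notation A n := (residue_ring h n).
Local Notation q := (ideal_card p).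

Lemma ideal_card_gt1 : (1 < q)%N.
Proof.
have [pi [chA inv]] := uniformizer_exists h 0.
by rewrite -(card_residue_ann chA inv) (card_ann_pi_gt1 chA).
Qed.

Section Partial.
Variables (n : nat) (pi : A n).
Hypothesis upi : uniformizer pi.
Local Notation T := (A n * 'M[A n]_(2 * 2, 2 * 1))%type.
Local Notation dlen d := (dim_len pi n.+1 d.1 (coef_quad d 0) (coef_quad d 1)).

Lemma char_dimE (d : T) : char_dim pi n.+1 d = (q ^ dlen d)%N.
Proof. by rewrite /char_dim (card_residue_ann (proj1 upi) (proj2 upi)). Qed.

Lemma sum_dlen (t : C) :
  \sum_(d : T) t ^+ dlen d = q%:R ^+ (9 * n.+1) * seqS (q%:R^-1) t n.+1.
Proof.
rewrite (sum_char_dim _ _ (fun e => t ^+ e)) -(card_residue_ann (proj1 upi) (proj2 upi)).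
rewrite -(sumS0 (proj1 upi)) /sumS; apply: eq_bigr => y _.
apply: eq_bigr => v _; apply: eq_bigr => w _.
by rewrite expr0 mul1r !qscale1.
Qed.

(** Dimensions up to n are all visible in O/p^(n+1), since n is at most q^(n+1). *)
Lemma zeta_partial_sum (s : C) : zeta_partial G s n =
  \sum_(d : T | (q ^ dlen d <= n)%N) natpow q (- s) ^+ dlen d.
Proof.
have q1 := ideal_card_gt1; rewrite /zeta_partial.
transitivity (\sum_(1 <= k < n.+1) \sum_(d : T | (q ^ dlen d)%N == k) natpow q (- s) ^+ dlen d).
  apply: eq_big_nat => k /andP[k0 kn].
  have kq : (k <= q ^ n.+1)%N.
    by apply: leq_trans (ltnW (ltn_expl n.+1 q1)); exact: ltnW.
  have [_ ->] := twist_classes_count R upi k0 kq.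
  rewrite (eq_bigr (fun=> natpow k (- s))); last first.
    by move=> d /eqP <-; rewrite natpowX // ltnW.
  rewrite sumr_const -[RHS]mulr_natl; congr (_%:R * _); apply: eq_card => d.
  by rewrite !inE char_dimE.
rewrite (exchange_big_dep xpredT) //= [RHS]big_mkcond; apply: eq_bigr => d _.
under eq_bigl => k do rewrite eq_sym.
rewrite big_nat1_eq expn_gt0 (ltnW q1) /= ltnS.
by case: ifP.
Qed.

(* The terms of dimension [q ^ d > n] are at most [n.+1^-1 * (|t| q) ^ d]. *)
Lemma zeta_partial_bound (s t : C) : t = natpow q (- s) ->
  `|zeta_partial G s n - q%:R ^+ (9 * n.+1) * seqS (q%:R^-1) t n.+1| <=
  n.+1%:R^-1 * (q%:R ^+ (9 * n.+1) * seqS (q%:R^-1) (`|t| * q%:R) n.+1).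
Proof.
move=> tE; rewrite -[X in `|_ - X|](sum_dlen t).
rewrite -[X in _ <= _ * X](sum_dlen (`|t| * q%:R)).
rewrite zeta_partial_sum -tE.
rewrite [X in _ - X](bigID (fun d : T => (q ^ dlen d <= n)%N)) /= opprD addrA subrr add0r normrN.
apply: le_trans (ler_norm_sum _ _ _) _.
rewrite mulr_sumr [leRHS](bigID (fun d : T => (q ^ dlen d <= n)%N)) /=.
rewrite -[leLHS]add0r; apply: lerD.
  apply: sumr_ge0 => d _.
  by rewrite mulr_ge0 ?invr_ge0 ?ler0n ?exprn_ge0 // mulr_ge0 ?ler0n.
apply: ler_sum => d; rewrite -ltnNge => nd.
rewrite normrX exprMn mulrCA; apply: ler_peMr; first by rewrite exprn_ge0.
by rewrite mulrC ler_pdivlMr ?ltr0n // mul1r -natrX ler_nat.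
Qed.

End Partial.

(** The bound 11 makes |t| q at most q^-10, so [zeta_approx] applies to t, giving the limit, and to
    |t| q, bounding the excess in [zeta_partial_bound]. The total error is M / (N+1). *)
Lemma zeta_partial_limit (s : C) : 11%:R < complex.Re s ->
  zeta_partial G s @ \oo --> zeta_value (q%:R : C) (natpow q (- s)).
Proof.
move=> s11; have q1 := ideal_card_gt1; set t := natpow q (- s).
have Q0 : 0 < q%:R :> C by rewrite ltr0n ltnW.
have Q1 : 1 <= q%:R :> C by rewrite ler1n ltnW.
have t11 : `|t| <= (q%:R ^+ 11)^-1 by apply: norm_natpow_le.
have tq : `|t| * q%:R <= (q%:R ^+ 10)^-1.
  rewrite -ler_pdivlMr //; apply: le_trans t11 _.
  by rewrite [q%:R ^+ 11]exprSr invfM.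
have t10 : `|t| <= (q%:R ^+ 10)^-1.
  by apply: le_trans tq; rewrite ler_peMr.
have t0 : t != 0 := natpow_neq0 _ _.
have [B1 b1] := zeta_approx q1 t0 t10.
have tq0 : `|t| * q%:R != 0 by rewrite mulf_neq0 ?normr_eq0 // gt_eqF.
have ntq : `| `|t| * q%:R | <= (q%:R ^+ 10)^-1 :> C.
  by rewrite normrM normr_id (ger0_norm (ltW Q0)).
have [B2 b2] := zeta_approx q1 tq0 ntq.
set Z := zeta_value _ _ in b1 *; set Z' := zeta_value _ (`|t| * q%:R) in b2.
pose M := `|B1| + (`|B2| + `|Z'|).
have bound N : `|Z - zeta_partial G s N| <= N.+1%:R^-1 * M.
  have [pi upi] := uniformizer_exists h N.
  have half : 2^-1 ^+ N.+1 <= N.+1%:R^-1 :> C.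
    rewrite exprVn lef_pV2 ?posrE ?exprn_gt0 ?ltr0n // -natrX ler_nat.
    exact: ltnW (ltn_expl _ _).
  have half0 : 0 <= 2^-1 ^+ N.+1 :> C by rewrite exprn_ge0 // invr_ge0 ler0n.
  have half1 : 2^-1 ^+ N.+1 <= 1 :> C.
    by apply: exprn_ile1; rewrite ?invr_ge0 ?ler0n // invf_le1 ?ltr0n // ler1n.
  pose S : C := q%:R ^+ (9 * N.+1) * seqS (q%:R^-1) t N.+1.
  pose S' : C := q%:R ^+ (9 * N.+1) * seqS (q%:R^-1) (`|t| * q%:R) N.+1.
  have bS : `|zeta_partial G s N - S| <= N.+1%:R^-1 * S'.
    exact: (zeta_partial_bound upi (erefl t)).
  rewrite -(subrKA S) /M mulrDr; apply: le_trans (ler_normD _ _) _; apply: lerD.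
    rewrite distrC; apply: le_trans (b1 N.+1) _.
    have B10 : 0 <= B1 * 2^-1 ^+ N.+1 by apply: le_trans (b1 N.+1); rewrite normr_ge0.
    rewrite -[leLHS]ger0_norm // normrM mulrC; apply: ler_pM => //.
    by rewrite ger0_norm.
  rewrite distrC; apply: le_trans bS _; apply: ler_wpM2l; first by rewrite invr_ge0 ler0n.
  have S'0 : 0 <= S'.
    rewrite /S' -(sum_dlen upi); apply: sumr_ge0 => d _.
    by rewrite exprn_ge0 // mulr_ge0 ?ler0n.
  rewrite -[leLHS]ger0_norm // -[S'](subrK Z'); apply: le_trans (ler_normD _ _) _.
  rewrite lerD2r; apply: le_trans (b2 N.+1) _.
  have B20 : 0 <= B2 * 2^-1 ^+ N.+1 by apply: le_trans (b2 N.+1); rewrite normr_ge0.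
  by rewrite -[leLHS]ger0_norm // normrM ler_piMr // ger0_norm.
apply/cvgrPdist_le => e e0; have [n0 n0P] := complex_norm_bound (M / e).
exists n0 => // N /= nN; apply: le_trans (bound N) _.
have M0 : 0 <= M by rewrite !addr_ge0.
rewrite mulrC ler_pdivrMr ?ltr0n // mulrC -ler_pdivrMr //.
move: n0P; rewrite ger0_norm ?divr_ge0 ?(ltW e0) // => /le_trans; apply.
by rewrite ler_nat leqW.
Qed.

End Main.

Theorem theorem1p3 (R : realType) (K : fieldExtType rat)
    (p : prime_idealr (ring_of_integers K)) (p_neq0 : exists2 x, x \in p & x != 0) :
  let G : topGroupType := Qgroup 2 1 (completion p) in
  (forall k, (0 < k)%N -> finite_set (twist_isoclasses (complexes R) G k)) /\
  exists sigma0 : R, forall s : complexes R, sigma0 < complex.Re s ->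
    let q : complexes R := (ideal_card p)%:R in
    let t : complexes R := natpow (ideal_card p) (- s) in
    cvgn (zeta_partial G s) /\
    zeta G s =
      ((1 - t) * (1 + q ^+ 3 * t) * (1 - q ^+ 2 * t) *
       (q ^+ 8 * t ^+ 3 - q ^+ 7 * t ^+ 2 + q ^+ 6 * t ^+ 2 - q ^+ 5 * t ^+ 2
        - q ^+ 3 * t + q ^+ 2 * t - q * t + 1))
      / ((1 - q ^+ 5 * t) * (1 - q ^+ 5 * t ^+ 2) * (1 - q ^+ 4 * t)
         * (1 - q ^+ 8 * t ^+ 2)).
Proof.
move=> G; split=> [k k0|].
  have [pi upi] := uniformizer_exists p_neq0 k.
  have kq : (k <= ideal_card p ^ k.+1)%N.
    by apply: leq_trans (ltnW (ltn_expl _ (ideal_card_gt1 p_neq0))); exact: leqnSn.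
  exact: (twist_classes_count R upi k0 kq).1.
exists 11%:R => s s11 q t; have lim := zeta_partial_limit p_neq0 s11.
split; first by apply/cvg_ex; eexists; exact: lim.
exact: (cvg_lim (@norm_hausdorff _ _) lim).
Qed.
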